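(* Let $z>0$ be real and let $N\geq 1$ be an integer. Then \[ (-1)^N \gamma_{2N-1} \ge 0 \quad\text{and}\quad (-1)^{N+1}\gamma_{2N} \ge 0 , \] and there exist numbers $\Theta_i(z,N)$ ($i=1,2,3$), depending on $z$ and $N$, with $0<\Theta_i(z,N)<1$, such that \[ (-1)^{N+1} R_{2N-1}(z) = \Theta_1(z,N)(-1)^N \frac{\gamma_{2N-1}}{z^{2N-1}} + \Theta_2(z,N)(-1)^{N+1}\frac{\gamma_{2N}}{z^{2N}}, \] \[ (-1)^{N+1} R_{2N}(z) = \Theta_2(z,N)(-1)^{N+1} \frac{\gamma_{2N}}{z^{2N}} - \Theta_3(z,N)(-1)^{N+1}\frac{\gamma_{2N+1}}{z^{2N+1}}, \] \[ (-1)^{N} \widetilde R_{2N-1}(z) = \Theta_1(z,N)(-1)^N \frac{\gamma_{2N-1}}{z^{2N-1}} - \Theta_2(z,N)(-1)^{N+1}\frac{\gamma_{2N}}{z^{2N}}, \] \[ (-1)^{N+1} \widetilde R_{2N}(z) = \Theta_2(z,N)(-1)^{N+1} \frac{\gamma_{2N}}{z^{2N}} + \Theta_3(z,N)(-1)^{N+1}\frac{\gamma_{2N+1}}{z^{2N+1}}. \] In particular, \[ |R_{2N-1}(z)| = (-1)^{N+1}R_{2N-1}(z) < (-1)^N \frac{\gamma_{2N-1}}{z^{2N-1}} + (-1)^{N+1}\frac{\gamma_{2N}}{z^{2N}}, \] \[ |R_{2N}(z)| < \max\left((-1)^{N+1}\frac{\gamma_{2N}}{z^{2N}},\, (-1)^{N+1}\frac{\gamma_{2N+1}}{z^{2N+1}}\right),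 \] \[ |\widetilde R_{2N-1}(z)| < \max\left((-1)^{N}\frac{\gamma_{2N-1}}{z^{2N-1}},\, (-1)^{N+1}\frac{\gamma_{2N}}{z^{2N}}\right), \] \[ |\widetilde R_{2N}(z)| = (-1)^{N+1}\widetilde R_{2N}(z) < (-1)^{N+1} \frac{\gamma_{2N}}{z^{2N}} + (-1)^{N+1}\frac{\gamma_{2N+1}}{z^{2N+1}}. \]
   Context: The scaled gamma function is $\Gamma^\ast(z) = \dfrac{\Gamma(z)}{\sqrt{2\pi}\, z^{z-\frac12} e^{-z}}$ for $|\arg z|<\pi$ (principal branch of the power). The Stirling coefficients $\gamma_n$ ($n\ge 0$) are the real numbers in the asymptotic expansion $\Gamma^\ast(z)\sim\sum_{n\ge 0}(-1)^n\gamma_n z^{-n}$ as $z\to\infty$ in $|\arg z|\le\pi-\delta$; equivalently, they are given by the formal power series identity \[ \exp\left(\sum_{n=1}^\infty \frac{B_{2n}}{2n(2n-1)}x^{2n-1}\right)=\sum_{n=0}^\infty(-1)^n\gamma_n x^n, \] where $B_{k}$ are the Bernoulli numbers. Thus $\gamma_0=1$, $\gamma_1=-\frac1{12}$, $\gamma_2=\frac1{288}$, $\gamma_3=\frac{139}{51840}$, $\gamma_4=-\frac{571}{2488320}$. One also has $1/\Gamma^\ast(z)\sim\sum_{n\ge0}\gamma_n z^{-n}$. For every integer $N\ge 1$ the remainders $R_N(z)$, $\widetilde R_N(z)$ are defined by \[ \Gamma^\ast(z)=\sum_{n=0}^{N-1}(-1)^n\frac{\gamma_n}{z^n}+R_N(z),\qquad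 \frac1{\Gamma^\ast(z)}=\sum_{n=0}^{N-1}\frac{\gamma_n}{z^n}+\widetilde R_N(z). \] *)

(* Defs.v *)
From HB Require Import structures.
From mathcomp Require Import all_boot all_order all_algebra.
From mathcomp Require Import all_classical all_reals all_analysis.

Set Implicit Arguments.
Unset Strict Implicit.
Unset Printing Implicit Defensive.

Import Order.TTheory GRing.Theory Num.Theory.
Import numFieldNormedType.Exports.

Local Open Scope ring_scope.

(* [bernoulli_seq F n] is [:: B_0; ...; B_(n-1)]. *)
Fixpoint bernoulli_seq (F : numFieldType) (n : nat) : seq F :=
  if n is m.+1 then
    let s := bernoulli_seq F m in
    rcons s (if m == 0 then 1
             else - (m.+1%:R)^-1 * \sum_(k < m) 'C(m.+1, k)%:R * s`_k)
  else [::].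

Definition bernoulli (F : numFieldType) (n : nat) : F := (bernoulli_seq F n.+1)`_n.

Lemma size_bernoulli_seq (F : numFieldType) (n : nat) :
  size (bernoulli_seq F n) = n.
Proof. by elim: n => //= n IHn; rewrite size_rcons IHn. Qed.

Lemma nth_bernoulli_seq (F : numFieldType) (n k : nat) :
  (k < n)%N -> (bernoulli_seq F n)`_k = bernoulli F k.
Proof.
elim: n => // n IHn; rewrite ltnS leq_eqVlt => /predU1P[->//|kn].
by rewrite /= nth_rcons size_bernoulli_seq kn IHn.
Qed.

Lemma bernoulli_rec (F : numFieldType) (n : nat) :
  \sum_(k < n.+1) 'C(n.+1, k)%:R * bernoulli F k = (n == 0)%:R.
Proof.
rewrite big_ord_recr /= binSn {2}/bernoulli /= nth_rcons size_bernoulli_seq.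
rewrite ltnn eqxx; case: eqVneq => [->|n0]; first by rewrite big_ord0 add0r mulr1.
rewrite mulrA mulrN divff ?pnatr_eq0// mulN1r.
under [X in _ - X]eq_bigr do rewrite nth_bernoulli_seq//.
by rewrite subrr.
Qed.

(* Truncation at n = M of the formal power series
   \sum_(n >= 1) B_(2n) / (2n (2n - 1)) x^(2n - 1). *)
Definition stirling_series (F : numFieldType) (M : nat) : {poly F} :=
  \sum_(1 <= n < M.+1)
    (bernoulli F (2 * n) / ((2 * n)%:R * (2 * n - 1)%:R)) *: 'X^(2 * n - 1).

(* (-1)^n gamma_n is the coefficient of x^n in the formal exponential of the
   series above.  Since that series has zero constant term, its k-th power
   contributes to x^n only for k <= n; and the terms omitted by truncating at
   M = n have degree at least 2n + 1 > n. *)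
Definition stirling_coef (F : numFieldType) (n : nat) : F :=
  (-1) ^+ n * (\sum_(k < n.+1) (k`!%:R)^-1 *: stirling_series F n ^+ k)`_n.

(* Euler's integral; meaningful for z > 0. *)
Definition Gamma (R : realType) (z : R) : R :=
  \int[@lebesgue_measure R]_(t in `]0, +oo[%classic)
    (t `^ (z - 1) * expR (- t)).

Definition scaled_Gamma (R : realType) (z : R) : R :=
  Gamma z / (Num.sqrt (2 * pi) * z `^ (z - 2^-1) * expR (- z)).

Definition Gamma_rem (R : realType) (N : nat) (z : R) : R :=
  scaled_Gamma z - \sum_(0 <= n < N) (-1) ^+ n * (stirling_coef R n / z ^+ n).

Definition Gamma_inv_rem (R : realType) (N : nat) (z : R) : R :=
  (scaled_Gamma z)^-1 - \sum_(0 <= n < N) stirling_coef R n / z ^+ n.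

(* Main.v *)
(** By Binet's first formula [scaled_Gamma z = exp (mu z)], where [mu] is the
Laplace transform of [binet].  The partial fraction expansion of the hyperbolic
cotangent exhibits [binet] as the limit of the sums [binet_sum K] of the
functions [2 / (c^2 + t^2)] with [c = 2 pi (k + 1)].  For each [K], let [mu_K]
be the Laplace transform, and [A], [B] the cosine and sine transforms, of
[binet_sum K].  Then
  [sinh (mu_K z) = (2 z / pi) * int sinh (A y) cos (B y) / (z^2 + y^2) dy],
  [cosh (mu_K z) - 1 = (2 / pi) * int y sinh (A y) sin (B y) / (z^2 + y^2) dy]
over [y > 0].  Since [0 < A] and [0 < B <= 7 pi / 16], both weights are positive,
so expanding [1 / (z^2 + y^2)] in powers of [z^-1] gives alternating expansions
whose remainders have strict signs, uniformly in [K].  By uniqueness of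
asymptotic expansions, the moments converge to the Stirling coefficients as [K]
grows, the odd ones from [sinh] and the even ones from [cosh].  Finally
[scaled_Gamma z] and its inverse are [cosh (mu z) + sinh (mu z)] and
[cosh (mu z) - sinh (mu z)], and each remainder is a sum or difference of a
[sinh] remainder and a [cosh] remainder.  A remainder and its successor, taken
with their signs, are positive and add up to the absolute value of the term
between them, hence each is a proper fraction of that term. *)

Require Import Defs.
From mathcomp Require Import all_boot all_order all_algebra.
From mathcomp Require Import all_classical all_reals all_analysis.
From mathcomp Require Import measurable_realfun.
From mathcomp Require Import ring lra.

Set Implicit Arguments.
Unset Strict Implicit.
Unset Printing Implicit Defensive.

Import Order.TTheory GRing.Theory Num.Theory.
Import numFieldNormedType.Exports.

Local Open Scope classical_set_scope.
Local Open Scope ring_scope.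

(** * Differentiation rules in pointwise form, and a tactic applying them *)

Section Derivative.
Context {R : realType}.
Implicit Types (f g : R -> R) (x y c d : R).

(** The truncation at [K] is forced by [binet] itself: it decays only like 1 / (2 t), hence is not
    integrable, and its cosine transform - log (1 - e^(-2 pi y)) / 2 is infinite at 0. Limits in [K]
    preserve only weak inequalities, so signs are proved through lower bounds independent of [K],
    drawn from the first term [binet_term 0].

    The integral formulas need no complex analysis. Shifting s in e^(-x s) and integrating against
    the density multiplies by the Laplace transform; with e^(-x s) written as a Fourier integral in
    y, the same operation is a factor A + i B, and the exponential series turns (A + i B)^n / n!
    into e^A (cos B + i sin B). Combining this with the formula for the negated density leaves sinh
    A. For cosh the kernel y / (x^2 + y^2) is not integrable: a difference at two points is used,
    one of which is sent to infinity.

    What matters about 7 pi / 16 is that it is below pi / 2; it comes from a rational majorant of 1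
    - cos.

    Binet's formula is a rigidity statement: Gamma divided by its conjectured form has period 1, is
    constant by Young's inequality, and Wallis's product gives sqrt (2 pi). *)

Lemma is_derive_fcst c x : is_derive x 1 (fun _ : R => c) 0.
Proof. exact: is_derive_cst. Qed.

Lemma is_derive_fid x : is_derive x 1 (fun y : R => y) 1.
Proof. exact: is_derive_id. Qed.

Lemma is_derive_fD f g x df dg : is_derive x 1 f df -> is_derive x 1 g dg ->
  is_derive x 1 (fun y => f y + g y) (df + dg).
Proof. by move=> hf hg; exact: is_deriveD. Qed.

Lemma is_derive_fN f x df : is_derive x 1 f df ->
  is_derive x 1 (fun y => - f y) (- df).
Proof. by move=> hf; exact: is_deriveN. Qed.

Lemma is_derive_fM f g x df dg : is_derive x 1 f df -> is_derive x 1 g dg ->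
  is_derive x 1 (fun y => f y * g y) (df * g x + f x * dg).
Proof.
move=> hf hg; apply: is_derive_eq (is_deriveM hf hg) _.
by rewrite /GRing.scale /= addrC mulrC.
Qed.

Lemma is_derive_fV f x df : f x != 0 -> is_derive x 1 f df ->
  is_derive x 1 (fun y => (f y)^-1) (- df / f x ^+ 2).
Proof.
move=> f0 hf; apply: is_derive_eq (is_deriveV f0 hf) _.
by rewrite /GRing.scale /= mulrC mulrN mulNr.
Qed.

Lemma is_derive_fX n f x df : is_derive x 1 f df ->
  is_derive x 1 (fun y => f y ^+ n) (n%:R * f x ^+ n.-1 * df).
Proof.
move=> hf; rewrite (_ : (fun y => f y ^+ n) = f ^+ n); first exact: is_deriveX.
by apply/funext => y; rewrite exprfctE.
Qed.

Lemma is_derive_fcomp (h : R -> R) g x dh dg : is_derive (g x) 1 h dh ->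
  is_derive x 1 g dg -> is_derive x 1 (fun y => h (g y)) (dh * dg).
Proof. by move=> hh hg; exact: is_derive1_comp. Qed.

Lemma is_derive_fexpR f x df : is_derive x 1 f df ->
  is_derive x 1 (fun y => expR (f y)) (expR (f x) * df).
Proof. by move=> hf; apply: is_derive_fcomp hf; exact: is_derive_expR. Qed.

Lemma is_derive_fcos f x df : is_derive x 1 f df ->
  is_derive x 1 (fun y => cos (f y)) (- sin (f x) * df).
Proof. by move=> hf; apply: is_derive_fcomp hf; exact: is_derive_cos. Qed.

Lemma is_derive_fsin f x df : is_derive x 1 f df ->
  is_derive x 1 (fun y => sin (f y)) (cos (f x) * df).
Proof. by move=> hf; apply: is_derive_fcomp hf; exact: is_derive_sin. Qed.

Lemma is_derive_fatan f x df : is_derive x 1 f df ->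
  is_derive x 1 (fun y => atan (f y)) ((1 + f x ^+ 2)^-1 * df).
Proof. by move=> hf; apply: is_derive_fcomp hf; exact: is_derive1_atan. Qed.

Lemma is_derive_fln f x df : 0 < f x -> is_derive x 1 f df ->
  is_derive x 1 (fun y => ln (f y)) ((f x)^-1 * df).
Proof. by move=> f0 hf; apply: is_derive_fcomp hf; exact: is_derive1_ln. Qed.

Lemma is_derive_fpowR f p x df : 0 < f x -> is_derive x 1 f df ->
  is_derive x 1 (fun y => f y `^ p) (p * f x `^ (p - 1) * df).
Proof. by move=> f0 hf; apply: (is_derive_fcomp (h := fun y => y `^ p)) hf; exact: is_derive1_powR. Qed.

Lemma is_derive_fsum n (F : nat -> R -> R) (d : nat -> R) x :
  (forall i, (i < n)%N -> is_derive x 1 (F i) (d i)) ->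
  is_derive x 1 (fun y => \sum_(i < n) F i y) (\sum_(i < n) d i).
Proof.
elim: n => [|n IHn] Fd.
  by rewrite big_ord0; under [X in is_derive _ _ X _]eq_fun do rewrite big_ord0;
    exact: is_derive_fcst.
under eq_fun do rewrite big_ord_recr /=.
rewrite big_ord_recr /=; apply: is_derive_fD; last exact: Fd.
by apply: IHn => i ni; apply: Fd; rewrite ltnS ltnW.
Qed.

Lemma is_derive_continuous f x d : is_derive x 1 f d -> {for x, continuous f}.
Proof.
by move=> hf; apply/differentiable_continuous/derivable1_diffP; exact: ex_derive.
Qed.

End Derivative.

(** The rule is selected by the shape of the body under the binder, the derivative being left as an
    existential variable. Nonvanishing and positivity premises, and derivatives of unknown
    functions, remain as goals; after [der] they are followed by the equality with the announced
    derivative. *)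
Ltac der_rule :=
  lazymatch goal with
  | |- is_derive _ _ (fun _ => ?c) _ => notypeclasses refine (is_derive_fcst _ _)
  | |- is_derive _ _ (fun t => t) _ => notypeclasses refine (is_derive_fid _)
  | |- is_derive _ _ (fun t => @?f t + @?g t) _ => notypeclasses refine (@is_derive_fD _ f g _ _ _ _ _)
  | |- is_derive _ _ (fun t => - @?f t) _ => notypeclasses refine (@is_derive_fN _ f _ _ _)
  | |- is_derive _ _ (fun t => @?f t * @?g t) _ => notypeclasses refine (@is_derive_fM _ f g _ _ _ _ _)
  | |- is_derive _ _ (fun t => (@?f t)^-1) _ => notypeclasses refine (@is_derive_fV _ f _ _ _ _)
  | |- is_derive _ _ (fun t => @?f t ^+ ?n) _ => notypeclasses refine (@is_derive_fX _ n f _ _ _)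
  | |- is_derive _ _ (fun t => expR (@?f t)) _ => notypeclasses refine (@is_derive_fexpR _ f _ _ _)
  | |- is_derive _ _ (fun t => cos (@?f t)) _ => notypeclasses refine (@is_derive_fcos _ f _ _ _)
  | |- is_derive _ _ (fun t => sin (@?f t)) _ => notypeclasses refine (@is_derive_fsin _ f _ _ _)
  | |- is_derive _ _ (fun t => atan (@?f t)) _ => notypeclasses refine (@is_derive_fatan _ f _ _ _)
  | |- is_derive _ _ (fun t => ln (@?f t)) _ => notypeclasses refine (@is_derive_fln _ f _ _ _ _)
  | |- is_derive _ _ (fun t => @?f t `^ ?p) _ => notypeclasses refine (@is_derive_fpowR _ f p _ _ _ _)
  end.
Ltac der :=
  notypeclasses refine (is_derive_eq _ _); [repeat der_rule|];
  cbv beta.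

(** * Monotonicity from the sign of the derivative *)

Section MeanValue.
Context {R : realType}.
Implicit Types (f : R -> R).

Lemma le_of_derive_ge0 f df (a b : R) : a <= b ->
  (forall x, a <= x <= b -> is_derive x 1 f (df x)) ->
  (forall x, a < x < b -> 0 <= df x) -> f a <= f b.
Proof.
move=> ab fd df0; have [->//|neq] := eqVneq a b.
have {neq}ltab : a < b by rewrite lt_neqAle neq.
have [] := @MVT R f df a b ltab.
- by move=> x; rewrite in_itv /= => /andP[/ltW ax /ltW xb]; apply: fd; rewrite ax xb.
- apply: continuous_in_subspaceT => x; rewrite inE /= in_itv /= => xab.
  exact: (is_derive_continuous (fd x xab)).
- move=> c; rewrite in_itv /= => cab fE; rewrite -subr_ge0 fE mulr_ge0 ?df0//.
  by rewrite subr_ge0 ltW.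
Qed.

Lemma eq_of_derive0 f (a b : R) : a <= b ->
  (forall x, a <= x <= b -> is_derive x 1 f 0) -> f a = f b.
Proof.
move=> ab fd; apply/eqP; rewrite eq_le; apply/andP; split.
  by apply: (@le_of_derive_ge0 f (fun=> 0)).
rewrite -lerN2; apply: (@le_of_derive_ge0 (fun x => - f x) (fun=> - 0)) => //.
  by move=> x xab; exact/is_derive_fN/fd.
Qed.

End MeanValue.

(** * Measurability of elementary functions *)

Section Measurability.
Context {R : realType}.

(** [powR] with exponent -1 is inversion on nonnegative numbers only, hence the detour x / x^2; at 0
    both sides are 0. *)
Lemma measurable_inv : measurable_fun [set: R] (fun x : R => x^-1).
Proof.
rewrite (_ : (fun _ => _) = (fun x : R => x * (x ^+ 2) `^ (- 1))).
  apply: measurable_funM => //.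
  apply: (measurableT_comp (f := fun y : R => y `^ (- 1))).
    exact: measurable_powR.
  exact: exprn_measurable.
apply/funext => x; rewrite powR_inv1 ?sqr_ge0//.
have [->|x0] := eqVneq x 0; first by rewrite invr0 mul0r.
by rewrite expr2 invfM mulrA divff// mul1r.
Qed.

Lemma measurable_cos : measurable_fun [set: R] (@cos R).
Proof. by apply: continuous_measurable_fun; exact: continuous_cos. Qed.

Lemma measurable_sin : measurable_fun [set: R] (@sin R).
Proof. by apply: continuous_measurable_fun; exact: continuous_sin. Qed.

Context d (T : measurableType d) (D : set T).
Implicit Types f g : T -> R.

Lemma measurable_fV f : measurable_fun D f -> measurable_fun D (fun x => (f x)^-1).
Proof. by move=> mf; apply: measurableT_comp mf; exact: measurable_inv. Qed.

Lemma measurable_fexpR f : measurable_fun D f -> measurable_fun D (fun x => expR (f x)).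
Proof. by move=> mf; apply: measurableT_comp mf; exact: measurable_expR. Qed.

Lemma measurable_fcos f : measurable_fun D f -> measurable_fun D (fun x => cos (f x)).
Proof. by move=> mf; apply: measurableT_comp mf; exact: measurable_cos. Qed.

Lemma measurable_fsin f : measurable_fun D f -> measurable_fun D (fun x => sin (f x)).
Proof. by move=> mf; apply: measurableT_comp mf; exact: measurable_sin. Qed.

Lemma measurable_fpowR p f : measurable_fun D f -> measurable_fun D (fun x => f x `^ p).
Proof.
by move=> mf; apply: (measurableT_comp (f := fun y : R => y `^ p)) mf; exact: measurable_powR.
Qed.

Lemma measurable_fN f : measurable_fun D f -> measurable_fun D (fun x => - f x).
Proof. by move=> mf; apply: measurableT_comp mf. Qed.

Lemma measurable_fcomp (h : R -> R) f : measurable_fun setT h ->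
  measurable_fun D f -> measurable_fun D (fun x => h (f x)).
Proof. by move=> mh mf; apply: measurableT_comp mf. Qed.

Lemma measurable_fsum n (F : 'I_n -> T -> R) : (forall i, measurable_fun D (F i)) ->
  measurable_fun D (fun x => \sum_(i < n) F i x).
Proof. by move=> mF; apply: measurable_sum => i. Qed.

End Measurability.

Ltac meas_rule :=
  lazymatch goal with
  | |- measurable_fun _ (fun _ => ?c) => apply: measurable_cst
  | |- measurable_fun _ (fun x => x) => apply: measurable_id
  | |- measurable_fun _ (fun x => x.1) => apply: measurable_fst
  | |- measurable_fun _ (fun x => x.2) => apply: measurable_snd
  | |- measurable_fun _ (fun x => @?f x - @?g x) => apply: (@measurable_funB _ _ _ _ f g)
  | |- measurable_fun _ (fun x => @?f x + @?g x) => apply: (@measurable_funD _ _ _ _ f g)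
  | |- measurable_fun _ (fun x => - @?f x) => apply: (@measurable_fN _ _ _ _ f)
  | |- measurable_fun _ (fun x => @?f x * @?g x) => apply: (@measurable_funM _ _ _ _ f g)
  | |- measurable_fun _ (fun x => (@?f x)^-1) => apply: (@measurable_fV _ _ _ _ f)
  | |- measurable_fun _ (fun x => @?f x ^+ ?n) => apply: (@measurable_funX _ _ _ _ f n)
  | |- measurable_fun _ (fun x => expR (@?f x)) => apply: (@measurable_fexpR _ _ _ _ f)
  | |- measurable_fun _ (fun x => cos (@?f x)) => apply: (@measurable_fcos _ _ _ _ f)
  | |- measurable_fun _ (fun x => sin (@?f x)) => apply: (@measurable_fsin _ _ _ _ f)
  | |- measurable_fun _ (fun x => @?f x `^ ?p) => apply: (@measurable_fpowR _ _ _ _ p f)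
  | |- measurable_fun _ (fun x => bigop.body _ _ _) => apply: measurable_fsum => ?
  | |- measurable_fun _ (fun x => ?h (@?f x)) => apply: (@measurable_fcomp _ _ _ _ h f)
  end.
Ltac meas := repeat (assumption || meas_rule).

Ltac der_cont := notypeclasses refine (is_derive_continuous _); der.

(** * Integrals over real intervals *)

Section IntegralOn.
Context {R : realType}.
Implicit Types (i : interval R) (f g : R -> R) (c x t : R).
Local Notation mu := (@lebesgue_measure R).

(** The finite part of an extended integral: its value is informative only together with
    [integrable_on], which is therefore tracked separately. *)
Definition int_on i f : R := \int[mu]_(t in [set` i]) f t.

Definition integrable_on i f : Prop := mu.-integrable [set` i] (EFin \o f).

Lemma measurable_onT i f : measurable_fun setT f -> measurable_fun [set` i] f.
Proof. exact: measurable_funTS. Qed.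

Lemma integrable_on_measurable i f : integrable_on i f -> measurable_fun [set` i] f.
Proof. by move=> /measurable_int/measurable_EFinP. Qed.

Lemma integrable_onW i f g : measurable_fun [set` i] f -> integrable_on i g ->
  (forall t, t \in i -> `|f t| <= g t) -> integrable_on i f.
Proof.
move=> mf ig fg; apply: (le_integrable _ _ _ ig) => //.
  exact/measurable_EFinP.
by move=> t it /=; rewrite lee_fin (le_trans (fg t it))// ler_norm.
Qed.

Lemma eq_int_on i f g : (forall t, t \in i -> f t = g t) -> int_on i f = int_on i g.
Proof. by move=> fg; apply: eq_Rintegral => t; rewrite inE => /fg. Qed.

Lemma eq_integrable_on i f g : (forall t, t \in i -> f t = g t) ->
  integrable_on i f -> integrable_on i g.
Proof.
move=> fg; apply: eq_integrable => //= t.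
by rewrite inE => it /=; rewrite fg.
Qed.

Lemma integrable_onD i f g : integrable_on i f -> integrable_on i g ->
  integrable_on i (fun t => f t + g t).
Proof. by move=> fi gi; exact: (@integrableD _ _ _ mu _ (measurable_itv i) _ _ fi gi). Qed.

Lemma int_onD i f g : integrable_on i f -> integrable_on i g ->
  int_on i (fun t => f t + g t) = int_on i f + int_on i g.
Proof. by move=> fi gi; exact: RintegralD. Qed.

Lemma integrable_onZ i c f : integrable_on i f -> integrable_on i (fun t => c * f t).
Proof. by move=> fi; exact: (@integrableZl _ _ _ mu _ (measurable_itv i) c _ fi). Qed.

Lemma int_onZ i c f : integrable_on i f ->
  int_on i (fun t => c * f t) = c * int_on i f.
Proof. by move=> fi; exact: RintegralZl. Qed.

Lemma integrable_onB i f g : integrable_on i f -> integrable_on i g ->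
  integrable_on i (fun t => f t - g t).
Proof. by move=> fi gi; exact: (@integrableB _ _ _ mu _ (measurable_itv i) _ _ fi gi). Qed.

Lemma int_onB i f g : integrable_on i f -> integrable_on i g ->
  int_on i (fun t => f t - g t) = int_on i f - int_on i g.
Proof. by move=> fi gi; exact: RintegralB. Qed.

Lemma integrable_on0 i : integrable_on i (fun=> 0).
Proof. exact: integrable0. Qed.

Lemma int_on0 i : int_on i (fun=> 0) = 0.
Proof. by rewrite /int_on /Rintegral integral0. Qed.

Lemma integrable_on_sum i n (F : nat -> R -> R) :
  (forall k, (k < n)%N -> integrable_on i (F k)) ->
  integrable_on i (fun t => \sum_(k < n) F k t).
Proof.
elim: n => [|n IHn] Fi.
  by under eq_fun do rewrite big_ord0; exact: integrable_on0.
under eq_fun do rewrite big_ord_recr /=.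
apply: integrable_onD; last exact: Fi.
by apply: IHn => k kn; apply: Fi; rewrite ltnS ltnW.
Qed.

Lemma int_on_sum i n (F : nat -> R -> R) :
  (forall k, (k < n)%N -> integrable_on i (F k)) ->
  int_on i (fun t => \sum_(k < n) F k t) = \sum_(k < n) int_on i (F k).
Proof.
elim: n => [|n IHn] Fi.
  by under eq_fun do rewrite big_ord0; rewrite int_on0 big_ord0.
have Fi' k : (k < n)%N -> integrable_on i (F k).
  by move=> kn; apply: Fi; rewrite ltnS ltnW.
under eq_fun do rewrite big_ord_recr /=.
rewrite big_ord_recr /= int_onD ?IHn//; first exact: integrable_on_sum.
exact: Fi.
Qed.

Lemma le_int_on i f g : integrable_on i f -> integrable_on i g ->
  (forall t, t \in i -> f t <= g t) -> int_on i f <= int_on i g.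
Proof. by move=> fi gi fg; apply: le_Rintegral => // t; exact: fg. Qed.

Lemma int_on_ge0 i f : (forall t, t \in i -> 0 <= f t) -> 0 <= int_on i f.
Proof. by move=> f0; apply: Rintegral_ge0 => t; exact: f0. Qed.

Lemma integrable_on_norm i f : integrable_on i f -> integrable_on i (fun t => `|f t|).
Proof. by move=> fi; exact: integrable_norm. Qed.

Lemma normr_int_on i f : integrable_on i f ->
  `|int_on i f| <= int_on i (fun t => `|f t|).
Proof. by move=> fi; exact: le_normr_Rintegral. Qed.

Lemma normr_int_on_le i f g : measurable_fun [set` i] f -> integrable_on i g ->
  (forall t, t \in i -> `|f t| <= g t) -> `|int_on i f| <= int_on i g.
Proof.
move=> mf gi fg; have fi := integrable_onW mf gi fg.
by apply: le_trans (normr_int_on fi) _; apply: le_int_on => //; exact: integrable_on_norm.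
Qed.

Lemma EFin_int_on i f : integrable_on i f ->
  (int_on i f)%:E = (\int[mu]_(t in [set` i]) (f t)%:E)%E.
Proof. by move=> fi; rewrite /int_on /Rintegral fineK//; exact: integrable_fin_num. Qed.

Lemma int_on_dct i (F : nat -> R -> R) f g :
  (forall n, measurable_fun [set` i] (F n)) ->
  (forall t, t \in i -> F n t @[n --> \oo] --> f t) ->
  integrable_on i g ->
  (forall n t, t \in i -> `|F n t| <= g t) ->
  integrable_on i f /\ int_on i (F n) @[n --> \oo] --> int_on i f.
Proof.
move=> mF Ff gi Fg.
have mf : measurable_fun [set` i] f by exact: (measurable_fun_cvg mF).
have [||||fi _] := @dominated_convergence _ _ R mu [set` i] (measurable_itv i)
  (fun n => EFin \o F n) (EFin \o f) (EFin \o g) _ _ _ gi.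
- by move=> n; apply/measurable_EFinP; exact: mF.
- exact/measurable_EFinP.
- apply: aeW => t it; apply: cvg_EFin; [exact: nearW|exact: Ff].
- by apply: aeW => t n it; rewrite lee_fin; exact: Fg.
move=> FL; split=> //; apply: fine_cvg.
by rewrite -/(int_on i f) EFin_int_on.
Qed.

Lemma int_on_eq0 i f : integrable_on i f -> (forall t, t \in i -> 0 <= f t) ->
  int_on i f = 0 -> {ae mu, forall t, t \in i -> f t = 0}.
Proof.
move=> fi f0 if0; have mf := measurable_int _ fi.
have /(ae_eq_integral_abs mu (measurable_itv i) mf) : (\int[mu]_(t in [set` i]) `|(EFin \o f) t|)%E = 0%E.
  transitivity (\int[mu]_(t in [set` i]) (f t)%:E)%E; last by rewrite -EFin_int_on// if0.
  by apply: eq_integral => t; rewrite inE => it /=; rewrite ger0_norm// f0.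
apply: filterS => t /= ft it.
by have := ft it => -[].
Qed.

(** If the integral vanished, the nonnegative [f] would be zero almost everywhere on [i], and [j],
    where [f] is positive, would be a null set. *)
Lemma int_on_gt0 i (j : interval R) f : mu [set` j] != 0%E ->
  (forall t, t \in j -> t \in i) -> integrable_on i f ->
  (forall t, t \in i -> 0 <= f t) -> (forall t, t \in j -> 0 < f t) -> 0 < int_on i f.
Proof.
move=> j0 ji fi f0 fj; rewrite lt_neqAle int_on_ge0 ?andbT//.
apply/eqP => /esym if0.
have [N [mN N0 sN]] := int_on_eq0 fi f0 if0.
move/eqP : j0; apply; apply: (@subset_measure0 _ _ R mu [set` j] N) => //.
apply: subset_trans sN => t /= jt /(_ (ji t jt)) ft0.
by have := fj t jt; rewrite ft0 ltxx.
Qed.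

Lemma integrable_on_continuous (a b : R) f : {in `[a, b], forall t, {for t, continuous f}} ->
  integrable_on `[a, b] f.
Proof.
move=> cf; apply: continuous_compact_integrable; first exact: segment_compact.
by apply: continuous_in_subspaceT => t; rewrite inE => /cf.
Qed.

Lemma int_on_FTC (a b : R) F f : a < b ->
  (forall t, a <= t <= b -> is_derive t 1 F (f t)) ->
  {in `[a, b], forall t, {for t, continuous f}} ->
  int_on `[a, b] f = F b - F a.
Proof.
move=> ab dF cf.
have cF t : a <= t <= b -> {for t, continuous F}.
  by move=> tab; exact: (is_derive_continuous (dF t tab)).
have := @continuous_FTC2 R f F a b ab; rewrite /int_on /Rintegral => ->//.
- by apply: continuous_in_subspaceT => t; rewrite inE => /cf.
- split.
  + move=> t; rewrite in_itv /= => /andP[/ltW at_ /ltW tb].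
    by apply: ex_derive; apply: dF; rewrite at_ tb.
  + by apply: cvg_at_right_filter; apply: cF; rewrite lexx ltW.
  + by apply: cvg_at_left_filter; apply: cF; rewrite lexx ltW.
- move=> t; rewrite in_itv /= => /andP[/ltW at_ /ltW tb].
  by rewrite derive1E; apply: derive_val; apply: dF; rewrite at_ tb.
Qed.

End IntegralOn.

(** * The fundamental theorem of calculus on the open half-line *)

Notation hline := (`]0, +oo[%R).

Section HalfLine.
Context {R : realType}.
Implicit Types (f g F : R -> R) (c x t l : R).
Local Notation mu := (@lebesgue_measure R).

Lemma in_hline t : (t \in hline) = (0 < t).
Proof. by rewrite in_itv /= andbT. Qed.

Lemma hline_measure_neq0 : mu [set` hline] != 0%E.
Proof. by rewrite lebesgue_measure_itv /= ltry. Qed.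

(** Compact intervals exhausting the open half-line; the shift by 2 keeps the endpoints distinct
    already for n = 0. *)
Let cut (n : nat) : set R := `[n.+2%:R^-1, n.+2%:R].

Let mcut n : measurable (cut n). Proof. exact: measurable_itv. Qed.

Let cut_lt n : n.+2%:R^-1 < n.+2%:R :> R.
Proof. by apply: (@lt_trans _ _ 1); rewrite ?invf_lt1 ?ltr0n ?ltr1n. Qed.

Let cut_sub n t : cut n t -> 0 < t.
Proof. by rewrite /cut /= in_itv /= => /andP[+ _]; apply: lt_le_trans; rewrite invr_gt0. Qed.

Let cut_near t : 0 < t -> \forall n \near \oo, cut n t.
Proof.
move=> t0; near=> n.
have n2 : n%:R <= n.+2%:R :> R by rewrite ler_nat -addn2 leq_addr.
rewrite /cut /= in_itv /=; apply/andP; split.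
  rewrite invf_ple ?posrE//; apply: le_trans n2.
  by near: n; exact: nbhs_infty_ger.
apply: le_trans n2.
by near: n; exact: nbhs_infty_ger.
Unshelve. all: by end_near. Qed.

Let cut_le m n t : (m <= n)%N -> cut m t -> cut n t.
Proof.
move=> mn; rewrite /cut /= !in_itv /= => /andP[mt tm]; apply/andP; split.
  by apply: le_trans mt; rewrite lef_pV2 ?posrE ?ltr0n// ler_nat !ltnS.
by apply: le_trans tm _; rewrite ler_nat !ltnS.
Qed.

Let int_cut n F f : (forall t, 0 < t -> is_derive t 1 F (f t)) ->
  (forall t, 0 < t -> {for t, continuous f}) ->
  (\int[mu]_(t in [set` hline]) ((f \_ (cut n)) t)%:E =
   (F n.+2%:R - F n.+2%:R^-1)%:E)%E.
Proof.
move=> dF cf; have cfn : {in `[n.+2%:R^-1 : R, n.+2%:R], forall t, {for t, continuous f}}.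
  by move=> t tn; apply: cf; exact: (@cut_sub n).
have dFn t : n.+2%:R^-1 <= t <= n.+2%:R -> is_derive t 1 F (f t).
  by move=> tn; apply: dF; apply: (@cut_sub n); rewrite /cut /= in_itv.
have <- := int_on_FTC (cut_lt n) dFn cfn.
rewrite EFin_int_on; last exact: integrable_on_continuous.
transitivity (\int[mu]_(t in [set` hline]) (((EFin \o f) \_ (cut n)) t))%E.
  by apply: eq_integral => t _; rewrite restrict_EFin.
rewrite -integral_mkcondr setIidr// => t /cut_sub.
by rewrite /= in_itv /= andbT.
Qed.

Let FTC_lim F l l0 : F t @[t --> +oo] --> l -> F t @[t --> 0^'+] --> l0 ->
  F n.+2%:R - F n.+2%:R^-1 @[n --> \oo] --> l - l0.
Proof.
move=> Fl Fl0; apply: cvgB.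
  move/cvg_pinftyP : Fl; apply.
  have := @cvgr_idn R.
  by rewrite -(cvg_shiftS (fun n => n%:R : R)) -(cvg_shiftS (fun n => n.+1%:R : R)).
move/cvg_at_rightP : Fl0; apply; split=> [n|]; first by rewrite invr_gt0.
have := @cvg_harmonic R; rewrite /harmonic.
by rewrite -(cvg_shiftS (fun n => n.+1%:R^-1 : R)).
Qed.

Lemma half_line_FTC F f l l0 : (forall t, 0 < t -> is_derive t 1 F (f t)) ->
  (forall t, 0 < t -> {for t, continuous f}) ->
  F t @[t --> +oo] --> l -> F t @[t --> 0^'+] --> l0 ->
  integrable_on hline f -> int_on hline f = l - l0.
Proof.
move=> dF cf Fl Fl0 fi.
have mf := integrable_on_measurable fi.
have [n||n t _|_] := @int_on_dct R hline (fun n => f \_ (cut n)) f (fun t => `|f t|) _ _ (integrable_on_norm fi).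
- apply/(measurable_restrict _ (mcut n)) => //.
  exact: (measurable_funS (measurable_itv hline) (@subIsetl _ _ _) mf).
- move=> t; rewrite in_hline => t0; apply: cvg_near_cst.
  by near=> n; rewrite patchE ifT// inE; near: n; exact: cut_near.
- by rewrite patchE; case: ifP => // _; rewrite normr0.
have E : (fun n => int_on hline (f \_ (cut n))) = (fun n => F n.+2%:R - F n.+2%:R^-1).
  by apply/funext => n; rewrite /int_on /Rintegral (int_cut n dF cf).
move=> FL; apply: (cvg_unique _ FL) => //=.
by rewrite E; exact: FTC_lim.
Unshelve. all: by end_near. Qed.

(** Monotone convergence along the intervals [cut n] turns the finite limits of [F] at both ends
    into integrability of [f]; the value then comes from [half_line_FTC]. *)
Lemma half_line_FTC_ge0 F f l l0 : (forall t, 0 < t -> is_derive t 1 F (f t)) ->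
  (forall t, 0 < t -> {for t, continuous f}) ->
  F t @[t --> +oo] --> l -> F t @[t --> 0^'+] --> l0 ->
  (forall t, 0 < t -> 0 <= f t) ->
  integrable_on hline f /\ int_on hline f = l - l0.
Proof.
move=> dF cf Fl Fl0 f0.
have mf : measurable_fun [set` (hline : interval R)] f.
  apply: open_continuous_measurable_fun => //.
  by move=> t; rewrite inE /= in_hline; exact: cf.
suff fi : integrable_on hline f by split => //; exact: half_line_FTC.
apply/integrableP; split; first exact/measurable_EFinP.
have -> : (\int[mu]_(t in [set` hline]) `|(EFin \o f) t|)%E =
    (\int[mu]_(t in [set` hline]) limn (fun n => ((f \_ (cut n)) t)%:E))%E.
  apply: eq_integral => t; rewrite inE /= in_hline => t0.
  rewrite ger0_norm ?f0//; apply/esym/cvg_lim => //; apply: cvg_near_cst.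
  by near=> n; rewrite patchE ifT// inE; near: n; exact: cut_near.
have := @cvg_monotone_convergence _ _ R mu [set` hline] (measurable_itv _)
  (fun n t => ((f \_ (cut n)) t)%:E).
move=> /(_ _ _ _)/cvg_lim <-//; last 3 first.
- move=> n; apply/measurable_EFinP/(measurable_restrict _ (mcut n)) => //.
  exact: (measurable_funS (measurable_itv hline) (@subIsetl _ _ _) mf).
- move=> n t /=; rewrite in_hline => t0; rewrite patchE.
  by case: ifP => // _; rewrite lee_fin f0.
- move=> t /=; rewrite in_hline => t0 m n mn; rewrite !patchE lee_fin.
  have [|mt] := boolP (t \in cut m); last by case: ifP => // _; exact: f0.
  by rewrite inE => /(cut_le mn) nt; rewrite ifT ?inE.
have -> : (fun n => \int[mu]_(t in [set` hline]) ((f \_ (cut n)) t)%:E)%E =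
    (fun n => (F n.+2%:R - F n.+2%:R^-1)%:E).
  by apply/funext => n; rewrite (int_cut n dF cf).
rewrite (_ : limn _ = (l - l0)%:E) ?ltry//.
apply/cvg_lim => //.
by apply: cvg_EFin; [exact: nearW|exact: FTC_lim].
Unshelve. all: by end_near. Qed.

Lemma cvg_pinfty_le F l c : (forall t, 1 <= t -> `|F t - l| <= c / t) ->
  F t @[t --> +oo] --> l.
Proof.
move=> Fl; apply/cvgrPdist_le => e e0; near=> t.
have t1 : 1 <= t by near: t; exact: nbhs_pinfty_ge.
have ct : c / e <= t by near: t; apply: nbhs_pinfty_ge; exact: num_real.
rewrite distrC (le_trans (Fl t t1))//.
by rewrite ler_pdivrMr ?(lt_le_trans ltr01)// mulrC -ler_pdivrMr.
Unshelve. all: by end_near. Qed.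

Lemma cvg_at_right_is_derive F (a d l : R) : is_derive a 1 F d -> F a = l ->
  F t @[t --> a^'+] --> l.
Proof. by move=> dF <-; apply: cvg_at_right_filter; exact: (is_derive_continuous dF). Qed.

End HalfLine.

(** * Integrals depending on a parameter, and Fubini's theorem under a product bound *)

Section Parametric.
Context {R : realType}.
Implicit Types (i j : interval R) (g h : R -> R) (F : R -> R -> R).
Local Notation mu := (@lebesgue_measure R).

Lemma int_on_continuous i F g : (forall s, measurable_fun [set` i] (F s)) ->
  (forall t, t \in i -> continuous (F ^~ t)) -> integrable_on i g ->
  (forall s t, t \in i -> `|F s t| <= g t) ->
  continuous (fun s => int_on i (F s)).
Proof.
move=> mF cF gi Fg s; apply/(@cvg_nbhsP _ R^o) => u us.
have [|||_] := @int_on_dct _ i (fun n => F (u n)) (F s) g _ _ gi; last exact.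
- by [].
- by move=> t it; exact: (cvg_comp _ _ us (cF t it s)).
- by move=> n t it; exact: Fg.
Qed.

Lemma int_on_derive i F dF g a u v : u < a < v ->
  (forall s, u < s < v -> integrable_on i (F s)) ->
  (forall s t, u < s < v -> t \in i -> is_derive s 1 (F ^~ t) (dF s t)) ->
  integrable_on i g ->
  (forall s t, u < s < v -> t \in i -> `|dF s t| <= g t) ->
  is_derive a 1 (fun s => int_on i (F s)) (int_on i (dF a)).
Proof.
move=> auv Fi dFE gi dFg.
have Ia : [set` `]u, v[ ] a by rewrite /= in_itv.
have Fi' s : [set` `]u, v[ ] s -> mu.-integrable [set` i] (EFin \o F s).
  by rewrite /= in_itv /=; exact: Fi.
have dE s t : [set` `]u, v[ ] s -> [set` i] t -> is_derive s 1 (F ^~ t) (dF s t).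
  by rewrite /= in_itv /=; exact: dFE.
have dF1 s t : [set` `]u, v[ ] s -> [set` i] t -> derivable (F ^~ t) s 1.
  by move=> suv it; case: (dE s t suv it).
have pE s t : [set` `]u, v[ ] s -> [set` i] t -> partial1of2 F s t = dF s t.
  by move=> suv it; rewrite partial1of2E; case: (dE s t suv it).
(* The differentiation theorem asks for a majorant that is nonnegative everywhere, so [g] is
   replaced by its absolute value. *)
have G0 t : 0 <= `|g t| by [].
have G_ub s t : [set` `]u, v[ ] s -> [set` i] t -> `|partial1of2 F s t| <= `|g t|.
  move=> suv it; rewrite pE// (le_trans _ (ler_norm _))//.
  by apply: dFg => //; move: suv; rewrite /= in_itv.
have gi' : mu.-integrable [set` i] (EFin \o (fun t => `|g t|)).
  exact: integrable_on_norm.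
have D := @derivable_under_integral R _ _ mu F [set` i] (measurable_itv i) a u v Ia Fi' dF1 _ G0 gi' G_ub.
have V := @differentiation_under_integral R _ _ mu F [set` i] (measurable_itv i) a u v Ia Fi' dF1 _ G0 gi' G_ub.
apply: DeriveDef; first exact: D.
rewrite -derive1E [LHS]V; apply: eq_int_on => t it.
exact: pE.
Qed.

Section Fubini.
Variables (i j : interval R) (F : R -> R -> R) (g h : R -> R).
Hypothesis mF : measurable_fun setT (fun z : R * R => F z.1 z.2).
Hypothesis gi : integrable_on i g.
Hypothesis hj : integrable_on j h.
Hypothesis Fgh : forall t y, t \in i -> y \in j -> `|F t y| <= g t * h y.

Let A := [set` i] `*` [set` j].
(** Extension by zero outside the rectangle lets Fubini's theorem be applied on the whole plane;
    [inner1] and [inner2] recover the integrals over [j] and [i]. *)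
Let G := (fun z : R * R => (F z.1 z.2)%:E) \_ A.

Let mA : measurable A. Proof. by apply: measurableX; exact: measurable_itv. Qed.

Let mG : measurable_fun setT G.
Proof.
apply/(measurable_restrictT _ mA)/measurable_funTS/measurable_EFinP.
exact: mF.
Qed.

Let mFt t : measurable_fun setT (F t).
Proof. exact: (measurableT_comp mF (measurable_pair1 t)). Qed.

Let mFy y : measurable_fun setT (F ^~ y).
Proof. exact: (measurableT_comp mF (measurable_pair2 y)). Qed.

Let GE t y : G (t, y) = if (t \in i) && (y \in j) then (F t y)%:E else 0%E.
Proof.
rewrite /G patchE /= /A.
have -> : ((t, y) \in [set` i] `*` [set` j]) = (t \in i) && (y \in j).
  by apply/idP/idP; rewrite inE /= => /andP.
by [].
Qed.

Let Fi t : t \in i -> integrable_on j (F t).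
Proof.
move=> it; apply: (integrable_onW _ (integrable_onZ (g t) hj)).
  exact: measurable_onT (mFt t).
by move=> y jy; exact: Fgh.
Qed.

Let Fj y : y \in j -> integrable_on i (F ^~ y).
Proof.
move=> jy; apply: (integrable_onW _ (integrable_onZ (h y) gi)).
  exact: measurable_onT (mFy y).
by move=> t it; rewrite mulrC; exact: Fgh.
Qed.

Let inner1 t : (\int[mu]_y G (t, y))%E = ((fun t => (int_on j (F t))%:E) \_ [set` i]) t.
Proof.
rewrite patchE; have [|it] := boolP (t \in [set` i]).
  rewrite inE /= => it; rewrite EFin_int_on; last exact: Fi.
  rewrite [RHS]integral_mkcond; apply: eq_integral => y _.
  by rewrite GE it patchE /= mem_setE.
apply: integral0_eq => y _; rewrite GE.
by case: ifP => // /andP[it']; rewrite mem_setE it' in it.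
Qed.

Let inner2 y : (\int[mu]_t G (t, y))%E = ((fun y => (int_on i (F ^~ y))%:E) \_ [set` j]) y.
Proof.
rewrite patchE; have [|jy] := boolP (y \in [set` j]).
  rewrite inE /= => jy; rewrite EFin_int_on; last exact: Fj.
  rewrite [RHS]integral_mkcond; apply: eq_integral => t _.
  by rewrite GE jy patchE /= mem_setE andbT.
apply: integral0_eq => t _; rewrite GE.
by case: ifP => // /andP[_ jy']; rewrite mem_setE jy' in jy.
Qed.

(** By Tonelli, it suffices that the iterated integral of the absolute value is at most the product
    of the integrals of the absolute values of [g] and [h]. *)
Let iG : (mu \x mu)%E.-integrable setT G.
Proof.
apply/integrable12ltyP => //.
pose H := int_on j (fun y => `|h y|).
apply: (@le_lt_trans _ _ (\int[mu]_t ((fun t => (`|g t| * H)%:E) \_ [set` i]) t)%E).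
  apply: ge0_le_integral => //.
  - by move=> t _; exact: integral_ge0.
  - apply: (measurable_fun_fubini_tonelli_F (m2 := mu) (abse \o G)).
      exact: measurableT_comp.
    by move=> z; exact: abse_ge0.
  - apply/(measurable_restrictT (D := [set` i]) (fun t => (`|g t| * H)%:E)) => //.
    apply/measurable_EFinP.
    apply: measurable_funM => //.
    by have /integrable_on_measurable := integrable_on_norm gi.
  move=> t _; rewrite patchE; have [|it] := boolP (t \in [set` i]).
    rewrite inE /= => it.
    rewrite EFinM /H EFin_int_on; last exact: integrable_on_norm.
    rewrite -integralZl//; last exact: (integrable_on_norm hj).
    rewrite [leRHS]integral_mkcond; apply: ge0_le_integral => //.
    + by apply: measurableT_comp => //; exact: (measurableT_comp mG (measurable_pair1 t)).
    + apply/(measurable_restrictT (D := [set` j]) (fun y => `|g t|%:E * (`|h y|)%:E)%E) => //.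
      apply: measurable_funeM.
      exact: measurable_int (integrable_on_norm hj).
    + move=> y _; rewrite GE it patchE mem_setE /=; case: ifPn => [jy|]; last by rewrite abse0.
      by rewrite -EFinM lee_fin -normrM (le_trans (Fgh it jy))// ler_norm.
  rewrite le_eqVlt; apply/orP; left; apply/eqP; apply: integral0_eq => y _; rewrite GE.
  by case: ifP => [/andP[it']|]; [rewrite mem_setE it' in it|rewrite abse0].
rewrite -integral_mkcond -EFin_int_on ?ltry//.
apply: (@eq_integrable_on _ _ (fun t => H * `|g t|)).
  by move=> t _; rewrite mulrC.
by apply: integrable_onZ; exact: integrable_on_norm.
Qed.

Lemma int_on_Fubini :
  int_on i (fun t => int_on j (F t)) = int_on j (fun y => int_on i (F ^~ y)).
Proof.
have := Fubini iG.
under eq_integral do rewrite inner1.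
under [in X in _ = X -> _]eq_integral do rewrite inner2.
rewrite -!integral_mkcond => E.
by rewrite /int_on /Rintegral E.
Qed.

End Fubini.

End Parametric.

(** * Cauchy kernels *)

Section ExponentialMoments.
Context {R : realType}.
Implicit Types (x t : R).

(** Induction on n: the difference of the two sides is nonnegative at 0, and its derivative is n + 1
    times the difference one stage earlier. *)
Lemma exprn_le_fact_expR n t : 0 <= t -> t ^+ n <= n`!%:R * expR t.
Proof.
elim: n t => [|n IHn] t t0; first by rewrite expr0 fact0 mul1r -expR0 ler_expR.
rewrite -subr_ge0.
apply: (@le_trans _ _ (n.+1`!%:R * expR 0 - 0 ^+ n.+1)).
  by rewrite expR0 mulr1 expr0n subr0.
apply: (@le_of_derive_ge0 _ (fun t => n.+1`!%:R * expR t - t ^+ n.+1)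
  (fun t => n.+1%:R * (n`!%:R * expR t - t ^+ n)) 0 t t0).
  by move=> u _; der; rewrite factS natrM /=; ring.
by move=> u /andP[/ltW u0 _]; rewrite mulr_ge0// subr_ge0 IHn.
Qed.

Lemma exprn_expRN_le n x t : 0 < x -> 0 <= t ->
  t ^+ n * expR (- (x * t)) <= n`!%:R / x ^+ n.
Proof.
move=> x0 t0; rewrite ler_pdivlMr ?exprn_gt0// mulrAC -exprMn (mulrC t).
by rewrite expRN ler_pdivrMr ?expR_gt0// exprn_le_fact_expR// mulr_ge0// ltW.
Qed.

Lemma integrable_on_expRN x : 0 < x ->
  integrable_on hline (fun t => expR (- (x * t))).
Proof.
move=> x0; suff [] : integrable_on hline (fun t => expR (- (x * t))) /\
  int_on hline (fun t => expR (- (x * t))) = 0 - (- x^-1) by [].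
apply: (@half_line_FTC_ge0 _ (fun t => - x^-1 * expR (- (x * t)))).
- by move=> t _; der; field; rewrite gt_eqF.
- by move=> t _; der_cont; reflexivity.
- apply: (@cvg_pinfty_le _ _ _ (x^-1 * (1`!%:R / x ^+ 1))) => t t1.
  have t0 : 0 < t by apply: lt_le_trans t1.
  rewrite subr0 normrM normrN !gtr0_norm ?invr_gt0 ?expR_gt0//.
  rewrite -mulrA ler_pM2l ?invr_gt0// ler_pdivlMr// mulrC.
  by rewrite -[t in leLHS]expr1 exprn_expRN_le// ltW.
- notypeclasses refine (cvg_at_right_is_derive _ _); first by der; reflexivity.
  by rewrite mulr0 oppr0 expR0 mulr1.
- by move=> t _; exact: expR_ge0.
Qed.

Lemma integrable_on_exprn_expRN n x : 0 < x ->
  integrable_on hline (fun t => t ^+ n * expR (- (x * t))).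
Proof.
(* Half of the exponent absorbs the power, and the other half is integrated. *)
move=> x0; have x20 : 0 < x / 2 by rewrite divr_gt0.
apply: (integrable_onW _ (integrable_onZ (n`!%:R / (x / 2) ^+ n) (integrable_on_expRN x20))).
  by apply: measurable_onT; meas.
move=> t; rewrite in_hline => t0.
rewrite ger0_norm ?mulr_ge0 ?exprn_ge0 ?expR_ge0// ?(ltW t0)//.
have -> : - (x * t) = - (x / 2 * t) + - (x / 2 * t) by field.
by rewrite expRD mulrA ler_wpM2r ?expR_ge0// exprn_expRN_le// ltW.
Qed.

(** Integration by parts: the derivative of t^(n+1) e^(-x t) has integral 0, which is the recursion
    in n. *)
Lemma int_on_exprn_expRN n x : 0 < x ->
  int_on hline (fun t => t ^+ n * expR (- (x * t))) = n`!%:R / x ^+ n.+1.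
Proof.
move=> x0; have xn0 : x != 0 by rewrite gt_eqF.
have cF0 m : t ^+ m * expR (- (x * t)) @[t --> 0^'+] --> (0 : R) ^+ m.
  notypeclasses refine (cvg_at_right_is_derive _ _); first by der; reflexivity.
  by rewrite mulr0 oppr0 expR0 mulr1.
have cFy m : t ^+ m * expR (- (x * t)) @[t --> +oo] --> (0 : R).
  apply: (@cvg_pinfty_le _ _ _ (m.+1`!%:R / x ^+ m.+1)) => t t1.
  have t0 : 0 < t by apply: lt_le_trans t1.
  rewrite subr0 ger0_norm ?mulr_ge0 ?exprn_ge0 ?expR_ge0// ?(ltW t0)//.
  by rewrite ler_pdivlMr// mulrC mulrA -exprS exprn_expRN_le// ltW.
have ip m := integrable_on_exprn_expRN m x0.
elim: n => [|n IHn].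
  rewrite fact0 expr1.
  have dF t : 0 < t -> is_derive t 1 (fun t => t ^+ 0 * expR (- (x * t)))
      (- x * (t ^+ 0 * expR (- (x * t)))).
    by move=> _; der; rewrite !expr0 /=; ring.
  have cf t : 0 < t -> {for t, continuous (fun t => - x * (t ^+ 0 * expR (- (x * t))))}.
    by move=> _; der_cont; reflexivity.
  have := half_line_FTC dF cf (cFy 0) (cF0 0) (integrable_onZ _ (ip 0)).
  rewrite int_onZ// => H.
  apply: (@mulfI _ (- x)); first by rewrite oppr_eq0.
  by rewrite H expr0; field.
pose f t := n.+1%:R * (t ^+ n * expR (- (x * t))) - x * (t ^+ n.+1 * expR (- (x * t))).
have dF t : 0 < t -> is_derive t 1 (fun t => t ^+ n.+1 * expR (- (x * t))) (f t).
  by move=> _; rewrite /f; der; rewrite /= exprS; ring.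
have cf t : 0 < t -> {for t, continuous f}.
  by move=> _; rewrite /f; der_cont; reflexivity.
have fi : integrable_on hline f by apply: integrable_onB; apply: integrable_onZ.
have := half_line_FTC dF cf (cFy _) (cF0 _) fi.
rewrite int_onB ?int_onZ ?IHn//; try exact: integrable_onZ.
rewrite expr0n subr0 => /eqP; rewrite subr_eq0 => /eqP H.
apply: (@mulfI _ x) => //; rewrite -H.
rewrite factS natrM [x ^+ n.+2]exprS.
by field; rewrite xn0 expf_neq0.
Qed.

End ExponentialMoments.

(** * The Fourier cosine integral of 1 / (x^2 + y^2) *)

Section CauchyKernel.
Context {R : realType}.
Variable x : R.
Hypothesis x0 : 0 < x.
Implicit Types (s t y : R).

Let k y : R := (x ^+ 2 + y ^+ 2)^-1.

Let d0 y : 0 < x ^+ 2 + y ^+ 2.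
Proof. by rewrite ltr_pwDl ?exprn_gt0 ?sqr_ge0. Qed.

Let dn0 y : x ^+ 2 + y ^+ 2 != 0. Proof. by rewrite gt_eqF. Qed.

Let xn0 : x != 0. Proof. by rewrite gt_eqF. Qed.

Let k0 y : 0 < k y. Proof. by rewrite invr_gt0. Qed.

Lemma cauchy_kernel_int : integrable_on hline (fun y => (x ^+ 2 + y ^+ 2)^-1) /\
  int_on hline (fun y => (x ^+ 2 + y ^+ 2)^-1) = pi / (2 * x).
Proof.
rewrite (_ : pi / (2 * x) = x^-1 * (pi / 2) - x^-1 * atan 0); last by rewrite atan0; field.
apply: (@half_line_FTC_ge0 _ (fun y => x^-1 * atan (x^-1 * y))).
- move=> y _; der; field.
  have := dn0 y; rewrite xn0 /= => H.
  by rewrite andbT; apply: contra_neq H; lra.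
- by move=> y _; der_cont; [exact: dn0|reflexivity].
- apply: cvgMr; apply: (cvg_comp (fun y => x^-1 * y) (@atan R) _ (@cvgy_atan R)).
  apply/cvgryPge => A.
  apply: filterS (nbhs_pinfty_ge (num_real (A * x))) => y.
  by rewrite -ler_pdivlMr// mulrC.
- notypeclasses refine (cvg_at_right_is_derive _ _); first by der; reflexivity.
  by rewrite mulr0.
- by move=> y _; exact: ltW (k0 y).
Qed.

Lemma integrable_on_cauchy : integrable_on hline k.
Proof. exact: cauchy_kernel_int.1. Qed.

Let mk : measurable_fun setT k. Proof. by rewrite /k; meas. Qed.

Let kle y : k y <= (x ^+ 2)^-1.
Proof. by rewrite lef_pV2 ?posrE ?exprn_gt0// lerDl sqr_ge0. Qed.

Let kle2 y : `|y * k y| <= (2 * x)^-1.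
Proof.
rewrite normrM (gtr0_norm (k0 y)) ler_pdivrMr ?d0// [leRHS]mulrC ler_pdivlMr ?mulr_gt0//.
rewrite -(real_normK (num_real y)) -subr_ge0.
by apply: le_trans (sqr_ge0 (x - `|y|)) _; rewrite le_eqVlt; apply/orP; left; apply/eqP; ring.
Qed.

Let kle3 y : y ^+ 2 * k y <= 1.
Proof. by rewrite ler_pdivrMr ?d0// mul1r lerDr sqr_ge0. Qed.

Let k_deriv y : is_derive y 1 k (- (2 * y * k y ^+ 2)).
Proof. by rewrite /k; der; [exact: dn0|field; exact: dn0]. Qed.

(** [phi] should satisfy phi'' = x^2 phi, but differentiating under its integral sign already
    destroys absolute convergence. The squared kernel decays faster: with H' = - H1, H1' = phi - x^2
    H and, by parts, s phi = 2 H1, the functions [H] and [H1] satisfy a closed linear system. *)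
Let phi s := int_on hline (fun y => cos (s * y) * k y).
Let H s := int_on hline (fun y => cos (s * y) * k y ^+ 2).
Let H1 s := int_on hline (fun y => sin (s * y) * (y * k y ^+ 2)).

Let norm_cos (a : R) : `|cos a| <= 1. Proof. by rewrite ler_norml cos_geN1 cos_le1. Qed.
Let norm_sin (a : R) : `|sin a| <= 1. Proof. by rewrite ler_norml sin_geN1 sin_le1. Qed.

Let phi_i s : integrable_on hline (fun y => cos (s * y) * k y).
Proof.
apply: (integrable_onW _ integrable_on_cauchy); first by apply: measurable_onT; meas.
by move=> y _; rewrite normrM (gtr0_norm (k0 y)) ler_piMl// ltW.
Qed.

Let H_i s : integrable_on hline (fun y => cos (s * y) * k y ^+ 2).
Proof.
apply: (integrable_onW _ (integrable_onZ (x ^+ 2)^-1 integrable_on_cauchy)).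
  by apply: measurable_onT; meas.
move=> y _; rewrite normrM normrX (gtr0_norm (k0 y)) expr2.
apply: le_trans (_ : k y * k y <= _); first by rewrite ler_piMl// mulr_ge0// ltW.
by rewrite ler_wpM2r ?kle// ltW.
Qed.

Let H1_dom s y : `|sin (s * y) * (y * k y ^+ 2)| <= (2 * x)^-1 * k y.
Proof.
have -> : sin (s * y) * (y * k y ^+ 2) = sin (s * y) * (y * k y) * k y by ring.
rewrite normrM (gtr0_norm (k0 y)) ler_wpM2r ?(ltW (k0 y))// normrM.
by rewrite (le_trans _ (kle2 y))// ler_piMl.
Qed.

Let H1_i s : integrable_on hline (fun y => sin (s * y) * (y * k y ^+ 2)).
Proof.
apply: (integrable_onW _ (integrable_onZ (2 * x)^-1 integrable_on_cauchy)).
  by apply: measurable_onT; meas.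
by move=> y _; exact: H1_dom.
Qed.

Let dH s : is_derive s 1 H (- H1 s).
Proof.
rewrite (_ : - H1 s = int_on hline (fun y => - (sin (s * y) * (y * k y ^+ 2)))); last first.
  by under [in RHS]eq_fun do rewrite -mulN1r; rewrite int_onZ// mulN1r.
apply: (@int_on_derive _ _ _ (fun s y => - (sin (s * y) * (y * k y ^+ 2)))
  (fun y => (2 * x)^-1 * k y) s (s - 1) (s + 1)).
- by rewrite ltrBlDr ltrDl ltr01.
- by move=> u _; exact: H_i.
- by move=> u y _ _; der; ring.
- exact: integrable_onZ integrable_on_cauchy.
- by move=> u y _ _; rewrite normrN; exact: H1_dom.
Qed.

Let dH1 s : is_derive s 1 H1 (phi s - x ^+ 2 * H s).
Proof.
rewrite (_ : phi s - _ = int_on hline (fun y => cos (s * y) * (y ^+ 2 * k y ^+ 2))); last first.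
  rewrite -int_onZ// -int_onB//; last exact: integrable_onZ.
  by apply: eq_int_on => y _; rewrite /k; field; exact: dn0.
apply: (@int_on_derive _ _ _ (fun s y => cos (s * y) * (y ^+ 2 * k y ^+ 2)) k s (s - 1) (s + 1)).
- by rewrite ltrBlDr ltrDl ltr01.
- by move=> u _; exact: H1_i.
- by move=> u y _ _; der; ring.
- exact: integrable_on_cauchy.
- move=> u y _ _; have yk0 : 0 <= y ^+ 2 * k y ^+ 2 by apply: mulr_ge0; exact: sqr_ge0.
  rewrite normrM [X in _ * X]ger0_norm//.
  apply: le_trans (_ : y ^+ 2 * k y ^+ 2 <= _); first by rewrite ler_piMl.
  have -> : y ^+ 2 * k y ^+ 2 = y ^+ 2 * k y * k y by ring.
  by rewrite ler_piMl ?kle3// ltW.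
Qed.

Let parts s : s * phi s = 2 * H1 s.
Proof.
pose f y := s * (cos (s * y) * k y) - 2 * (sin (s * y) * (y * k y ^+ 2)).
have dF y : 0 < y -> is_derive y 1 (fun y => sin (s * y) * k y) (f y).
  by move=> _; rewrite /f; der; [exact: k_deriv|ring].
have cf y : 0 < y -> {for y, continuous f}.
  by move=> _; rewrite /f; der_cont; [exact: k_deriv|exact: k_deriv|reflexivity].
have fi : integrable_on hline f by apply: integrable_onB; apply: integrable_onZ.
have := half_line_FTC dF cf _ _ fi; rewrite int_onB ?int_onZ//; try exact: integrable_onZ.
move=> /(_ 0 0); rewrite subrr -/(phi s) -/(H1 s) => E.
apply/eqP; rewrite -subr_eq0; apply/eqP; apply: E.
  apply: (@cvg_pinfty_le _ _ _ 1) => y y1; have y0 : 0 < y by apply: lt_le_trans y1.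
  rewrite subr0 normrM (gtr0_norm (k0 y)).
  apply: le_trans (_ : k y <= _); first by rewrite ler_piMl// ltW.
  rewrite /k mul1r lef_pV2 ?posrE// (le_trans (ler_peMl (ltW y0) y1))//.
  by rewrite expr2 lerDr mulr_ge0// ltW.
notypeclasses refine (cvg_at_right_is_derive _ _); first by der; [exact: k_deriv|reflexivity].
by rewrite mulr0 sin0 mul0r.
Qed.

Let phiE s : 0 < s -> phi s = 2 * H1 s / s.
Proof. by move=> s0; rewrite -parts mulrAC divff ?mul1r// gt_eqF. Qed.

(** The combination of [H] and [H1] that vanishes on the decaying solution of the system; on any
    solution it is a constant multiple of s^2 e^(x s). *)
Let E s := H1 s * (1 + x * s) - x ^+ 2 * s * H s.

Let E_quot a b : 0 < a -> a <= b ->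
  E a * (a ^+ 2)^-1 * expR (- (x * a)) = E b * (b ^+ 2)^-1 * expR (- (x * b)).
Proof.
move=> a0 ab; apply: (@eq_of_derive0 _ (fun s => E s * (s ^+ 2)^-1 * expR (- (x * s)))) => //.
move=> s /andP[a_s _]; have s0 : 0 < s by apply: lt_le_trans a_s.
have sn0 : s != 0 by rewrite gt_eqF.
rewrite /E; der; [exact: dH1|exact: dH|by rewrite expf_neq0|].
by rewrite phiE//; field; rewrite sn0.
Qed.

Let P := int_on hline k.

Let P_ge0 : 0 <= P. Proof. by apply: int_on_ge0 => y _; rewrite ltW. Qed.

Let H_le s : `|H s| <= (x ^+ 2)^-1 * P.
Proof.
rewrite /P -int_onZ; last exact: integrable_on_cauchy.
apply: normr_int_on_le; first exact: integrable_on_measurable.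
  exact: integrable_onZ integrable_on_cauchy.
move=> y _; rewrite normrM normrX (gtr0_norm (k0 y)) expr2.
apply: le_trans (_ : k y * k y <= _); first by rewrite ler_piMl// mulr_ge0// ltW.
by rewrite ler_wpM2r ?kle// ltW.
Qed.

Let H1_le s : `|H1 s| <= (2 * x)^-1 * P.
Proof.
rewrite /P -int_onZ; last exact: integrable_on_cauchy.
apply: normr_int_on_le; first exact: integrable_on_measurable.
  exact: integrable_onZ integrable_on_cauchy.
by move=> y _; exact: H1_dom.
Qed.

Let M := (2 * x)^-1 * P * (1 + x) + P.

Let M_ge0 : 0 <= M.
Proof. by rewrite /M addr_ge0// !mulr_ge0// ?invr_ge0 ?addr_ge0 ?mulr_ge0// ltW. Qed.

Let E_le s : 1 <= s -> `|E s| <= M * s.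
Proof.
move=> s1; have s0 : 0 <= s by apply: le_trans s1.
apply: le_trans (ler_normB _ _) _; rewrite /M mulrDl lerD//.
  have xs0 : 0 <= 1 + x * s by rewrite addr_ge0// mulr_ge0// ltW.
  rewrite normrM (ger0_norm xs0) -mulrA ler_pM//.
  by rewrite mulrDl mul1r lerD.
have x2s : 0 <= x ^+ 2 * s by apply: mulr_ge0 => //; exact: sqr_ge0.
rewrite normrM ger0_norm//; apply: le_trans (ler_wpM2l x2s (H_le s)) _.
by rewrite le_eqVlt; apply/orP; left; apply/eqP; field.
Qed.

(** [E] grows at most linearly, whereas a nonzero multiple of s^2 e^(x s) does not. *)
Let E0 a : 0 < a -> E a = 0.
Proof.
move=> a0; apply/eqP; rewrite -normr_le0.
have an0 : a != 0 by rewrite gt_eqF.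
suff q0 : `|E a * (a ^+ 2)^-1 * expR (- (x * a))| <= 0.
  move: q0; rewrite !normr_le0 => /eqP /(congr1 (fun q => q * expR (x * a) * a ^+ 2)).
  rewrite !mul0r expRN => qE; apply/eqP; rewrite -[RHS]qE.
  by field; rewrite an0 gt_eqF ?expR_gt0.
apply/ler_addgt0Pr => e e0; rewrite add0r.
(* Beyond [a], beyond 1 where [E_le] applies, and so large that M / S <= e. *)
pose S := 1 + a + M / e.
have S1 : 1 <= S by rewrite /S -addrA lerDl addr_ge0 ?(ltW a0)// divr_ge0// ltW.
have S0 : 0 < S by apply: lt_le_trans S1.
have aS : a <= S by rewrite /S addrAC lerDr addr_ge0// divr_ge0// ltW.
rewrite (E_quot a0 aS) !normrM (ger0_norm (expR_ge0 _)).
apply: le_trans (_ : `|E S| * `|(S ^+ 2)^-1| <= _).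
  rewrite ler_piMr ?mulr_ge0// -expR0 ler_expR oppr_le0 mulr_ge0// ltW//.
rewrite [X in _ * X]gtr0_norm ?invr_gt0 ?exprn_gt0//.
rewrite ler_pdivrMr ?exprn_gt0//; apply: le_trans (E_le S1) _.
rewrite expr2 mulrA ler_wpM2r ?(ltW S0)// mulrC -ler_pdivrMr//.
by rewrite /S lerDr addr_ge0// ltW.
Qed.

Let g s := phi s * expR (x * s).

Let g_const a b : 0 < a -> a <= b -> g a = g b.
Proof.
move=> a0 ab; have b0 : 0 < b by apply: lt_le_trans ab.
rewrite /g !phiE//.
apply: (@eq_of_derive0 _ (fun s => 2 * H1 s / s * expR (x * s))) => //.
move=> s /andP[a_s _]; have s0 : 0 < s by apply: lt_le_trans a_s.
have sn0 : s != 0 by rewrite gt_eqF.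
der; [exact: dH1|by []|].
rewrite phiE//; have := E0 s0; rewrite /E => E0s.
transitivity (2 * expR (x * s) / s ^+ 2 * (H1 s * (1 + x * s) - x ^+ 2 * s * H s)).
  by field.
by rewrite E0s mulr0.
Qed.

Lemma cauchy_cos s : 0 <= s ->
  int_on hline (fun y => cos (s * y) / (x ^+ 2 + y ^+ 2)) = pi / (2 * x) * expR (- (x * s)).
Proof.
rewrite le_eqVlt => /predU1P[<-|s0].
  rewrite mulr0 oppr0 expR0 mulr1 -cauchy_kernel_int.2.
  by apply: eq_int_on => y _; rewrite mul0r cos0 mul1r.
have cphi : continuous phi.
  apply: (int_on_continuous (g := k)); last 2 first.
  - exact: integrable_on_cauchy.
  - by move=> u y _; rewrite normrM (gtr0_norm (k0 y)) ler_piMl// ltW.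
  - by move=> u; apply: measurable_onT; meas.
  - by move=> y _ u; der_cont; reflexivity.
(* Constancy of [g] is known for positive arguments only; continuity at 0 extends it to the point
   where the integral is [pi / (2 * x)]. *)
have cg : {for 0, continuous g}.
  have ce : {for 0, continuous (fun t => expR (x * t))} by der_cont; reflexivity.
  exact: cvgM (cphi 0) ce.
have E1 : g 0 = g s.
  have C1 : g t @[t --> 0^'+] --> g 0 by exact: cvg_at_right_filter.
  have C2 : g t @[t --> 0^'+] --> g s.
    apply: cvg_near_cst; near=> t; apply: g_const => //.
    by near: t; exact: nbhs_right_le.
  exact: (cvg_unique _ C1 C2).
have phi0 : g 0 = pi / (2 * x).
  rewrite /g mulr0 expR0 mulr1 -cauchy_kernel_int.2.
  by apply: eq_int_on => y _; rewrite mul0r cos0 mul1r.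
by rewrite -phi0 E1 /g -mulrA -expRD subrr expR0 mulr1.
Unshelve. all: by end_near. Qed.

Lemma integrable_on_cos_cauchy s :
  integrable_on hline (fun y => cos (s * y) / (x ^+ 2 + y ^+ 2)).
Proof. exact: phi_i. Qed.

End CauchyKernel.

(** * Fourier sine integrals of differences of Cauchy kernels *)

Section CauchySine.
Context {R : realType}.
Variables x x' : R.
Hypotheses (x0 : 0 < x) (x'0 : 0 < x').
Implicit Types (s y : R).

Let k y : R := (x ^+ 2 + y ^+ 2)^-1.
Let k' y : R := (x' ^+ 2 + y ^+ 2)^-1.

Let d0 y : 0 < x ^+ 2 + y ^+ 2.
Proof. by rewrite ltr_pwDl ?exprn_gt0 ?sqr_ge0. Qed.

Let d'0 y : 0 < x' ^+ 2 + y ^+ 2.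
Proof. by rewrite ltr_pwDl ?exprn_gt0 ?sqr_ge0. Qed.

Let dn0 y : x ^+ 2 + y ^+ 2 != 0. Proof. by rewrite gt_eqF. Qed.

Let dn'0 y : x' ^+ 2 + y ^+ 2 != 0. Proof. by rewrite gt_eqF. Qed.

Let k0 y : 0 < k y. Proof. by rewrite invr_gt0 ltr_pwDl ?exprn_gt0 ?sqr_ge0. Qed.

Let c := `|x' ^+ 2 - x ^+ 2| * (2 * x')^-1.

(** A single kernel y / (x^2 + y^2) is not integrable, but the difference is (x'^2 - x^2) (y k') k,
    and the absolute value of y k' is at most 1 / (2 x'). *)
Lemma cauchy_diff_le y : `|y * (k y - k' y)| <= c * k y.
Proof.
have -> : y * (k y - k' y) = (x' ^+ 2 - x ^+ 2) * (y / (x' ^+ 2 + y ^+ 2)) * k y.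
  by rewrite /k /k'; field; rewrite dn0 dn'0.
rewrite normrM (gtr0_norm (k0 y)) ler_wpM2r ?(ltW (k0 y))// normrM ler_wpM2l//.
rewrite normrM normfV (gtr0_norm (d'0 y)).
rewrite ler_pdivrMr// [leRHS]mulrC ler_pdivlMr ?mulr_gt0//.
rewrite -(real_normK (num_real y)) -subr_ge0.
by apply: le_trans (sqr_ge0 (x' - `|y|)) _; rewrite le_eqVlt; apply/orP; left; apply/eqP; ring.
Qed.

Let mk : measurable_fun setT k. Proof. by rewrite /k; meas. Qed.
Let mk' : measurable_fun setT k'. Proof. by rewrite /k'; meas. Qed.

Lemma integrable_on_cauchy_diff : integrable_on hline (fun y => y * (k y - k' y)).
Proof.
apply: (integrable_onW _ (integrable_onZ c (integrable_on_cauchy x0))).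
  by apply: measurable_onT; meas.
by move=> y _; exact: cauchy_diff_le.
Qed.

Let Phi s := int_on hline (fun y => cos (s * y) * k y - cos (s * y) * k' y).

Let dPhi s : is_derive s 1 Phi (int_on hline (fun y => - (sin (s * y) * (y * (k y - k' y))))).
Proof.
apply: (@int_on_derive _ _ _ (fun s y => - (sin (s * y) * (y * (k y - k' y))))
  (fun y => c * k y) s (s - 1) (s + 1)).
- by rewrite ltrBlDr ltrDl ltr01.
- by move=> u _; apply: integrable_onB; exact: integrable_on_cos_cauchy.
- by move=> u y _ _; der; ring.
- exact: integrable_onZ (integrable_on_cauchy x0).
- move=> u y _ _; rewrite normrN normrM (le_trans _ (cauchy_diff_le y))// ler_piMl//.
  by rewrite ler_norml sin_geN1 sin_le1.
Qed.

Let PhiE s : 0 <= s ->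
  Phi s = pi / (2 * x) * expR (- (x * s)) - pi / (2 * x') * expR (- (x' * s)).
Proof.
move=> s0; rewrite /Phi int_onB; try exact: integrable_on_cos_cauchy.
by rewrite !cauchy_cos.
Qed.

(** Minus the derivative in s of a difference of cosine integrals, computed once under the integral
    sign and once from [cauchy_cos]. *)
Lemma cauchy_sin s : 0 <= s ->
  int_on hline (fun y => sin (s * y) * (y * (k y - k' y))) =
  pi / 2 * (expR (- (x * s)) - expR (- (x' * s))).
Proof.
rewrite le_eqVlt => /predU1P[<-|s0].
  rewrite !mulr0 subrr mulr0 -[RHS](@int_on0 R hline); apply: eq_int_on => y _.
  by rewrite mul0r sin0 mul0r.
pose e s := pi / (2 * x) * expR (- (x * s)) - pi / (2 * x') * expR (- (x' * s)).
have de : is_derive s 1 e (- (pi / 2 * (expR (- (x * s)) - expR (- (x' * s))))).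
  by rewrite /e; der; field; rewrite !gt_eqF.
(* [PhiE] is available for nonnegative arguments, hence near [s], which is positive here; s = 0 was
   settled directly. *)
have dPhi' : is_derive s 1 Phi (- (pi / 2 * (expR (- (x * s)) - expR (- (x' * s))))).
  apply: near_eq_is_derive de; near=> u; rewrite /e -PhiE//.
  by near: u; exact: lt_le_nbhsr.
have [_ E] := dPhi'; have [_] := dPhi s; rewrite {}E => /eqP.
under [X in _ == int_on _ X]eq_fun do rewrite -mulN1r.
rewrite int_onZ ?mulN1r ?eqr_opp => [/eqP <-//|].
apply: (integrable_onW _ (integrable_on_norm integrable_on_cauchy_diff)).
  by apply: measurable_onT; meas.
move=> y _; rewrite normrM ler_piMl//.
by rewrite ler_norml sin_geN1 sin_le1.
Unshelve. all: by end_near. Qed.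

End CauchySine.

(** * Real and imaginary parts of the exponential series *)

Section ComplexExponential.
Context {R : realType}.

(* Real and imaginary parts of (A + iB)^n. *)
Fixpoint cpow (A B : R) (n : nat) : R * R :=
  if n is m.+1 then
    ((cpow A B m).1 * A - (cpow A B m).2 * B, (cpow A B m).1 * B + (cpow A B m).2 * A)
  else (1, 0).

Lemma cpow_le (A B : R) n :
  `|(cpow A B n).1| <= (`|A| + `|B|) ^+ n /\ `|(cpow A B n).2| <= (`|A| + `|B|) ^+ n.
Proof.
suff H : `|(cpow A B n).1| + `|(cpow A B n).2| <= (`|A| + `|B|) ^+ n.
  by split; apply: le_trans H; rewrite ?lerDl ?lerDr.
elim: n => [|n IHn] /=; first by rewrite normr1 normr0 addr0 expr0.
rewrite exprSr; apply: le_trans (ler_wpM2r _ IHn); last by rewrite addr_ge0.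
apply: le_trans (lerD (ler_normB _ _) (ler_normD _ _)) _.
by rewrite !normrM le_eqVlt; apply/orP; left; apply/eqP; ring.
Qed.

Lemma cpow_real (A : R) n : cpow A 0 n = (A ^+ n, 0).
Proof. by elim: n => //= n ->; rewrite /= !mulr0 mul0r subr0 addr0 exprSr. Qed.

Lemma factr_neq0 n : n`!%:R != 0 :> R.
Proof. by rewrite pnatr_eq0 -lt0n fact_gt0. Qed.

Let cos_sum A B m l := \sum_(n < m) ((cpow A B n).1 / n`!%:R) * l ^+ n.
Let sin_sum A B m l := \sum_(n < m) ((cpow A B n).2 / n`!%:R) * l ^+ n.

Let dsum (a : nat -> R) m (l : R) :
  is_derive l 1 (fun l => \sum_(n < m.+1) (a n / n`!%:R) * l ^+ n)
    (\sum_(n < m) (a n.+1 / n`!%:R) * l ^+ n).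
Proof.
have -> : \sum_(n < m) (a n.+1 / n`!%:R) * l ^+ n =
    \sum_(n < m.+1) (a n / n`!%:R) * (n%:R * l ^+ n.-1 * 1).
  rewrite big_ord_recl /= !mul0r mulr0 add0r; apply: eq_bigr => n _.
  rewrite /bump /= add1n factS natrM.
  by field; rewrite factr_neq0 nat1r pnatr_eq0.
apply: (@is_derive_fsum R m.+1 (fun n l => (a n / n`!%:R) * l ^+ n)
  (fun n => (a n / n`!%:R) * (n%:R * l ^+ n.-1 * 1))) => n _.
by der; ring.
Qed.

Let pow_bound (f df : R -> R) (C : R) m (l : R) : 0 <= l -> f 0 = 0 ->
  (forall u : R, is_derive u 1 f (df u)) ->
  (forall u, 0 <= u <= l -> `|df u| <= C * (u ^+ m / m`!%:R)) ->
  `|f l| <= C * (l ^+ m.+1 / m.+1`!%:R).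
Proof.
move=> l0 f0 fd fC; rewrite ler_norml; apply/andP.
pose h u := C * (u ^+ m.+1 / m.+1`!%:R).
have h0 : h 0 = 0 by rewrite /h expr0n mul0r mulr0.
have dh (u : R) : is_derive u 1 h (C * (u ^+ m / m`!%:R)).
  rewrite /h; der.
  by rewrite factS natrM /=; field; rewrite factr_neq0 nat1r pnatr_eq0.
split.
- rewrite lerNl -subr_ge0.
  have {1}-> : 0 = h 0 - - f 0 by rewrite h0 f0 !oppr0 addr0.
  have D (u : R) : is_derive u 1 (fun u => h u - - f u) (C * (u ^+ m / m`!%:R) - - df u).
    by der; [exact: dh|exact: fd|].
  apply: (le_of_derive_ge0 l0 (fun u _ => D u)).
  move=> u /andP[/ltW u0 /ltW ul]; have := fC u; rewrite u0 ul ler_norml => /(_ erefl)/andP[]; lra.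
- rewrite -subr_ge0.
  have {1}-> : 0 = h 0 - f 0 by rewrite h0 f0 subrr.
  have D (u : R) : is_derive u 1 (fun u => h u - f u) (C * (u ^+ m / m`!%:R) - df u).
    by der; [exact: dh|exact: fd|].
  apply: (le_of_derive_ge0 l0 (fun u _ => D u)).
  move=> u /andP[/ltW u0 /ltW ul]; have := fC u; rewrite u0 ul ler_norml => /(_ erefl)/andP[]; lra.
Qed.

(** Taylor remainder of e^(l (A + i B)) in l, by induction on m: the derivative of remainder m + 1
    is A + i B times remainder m, so [pow_bound] integrates the estimate. The series is used at l =
    1. *)
Let cexp_bound (A B : R) m (l : R) : 0 <= l <= 1 ->
  `|expR (l * A) * cos (l * B) - cos_sum A B m l| <=
    expR `|A| * (`|A| + `|B|) ^+ m * (l ^+ m / m`!%:R) /\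
  `|expR (l * A) * sin (l * B) - sin_sum A B m l| <=
    expR `|A| * (`|A| + `|B|) ^+ m * (l ^+ m / m`!%:R).
Proof.
elim: m l => [|m IHm] l /andP[l0 l1].
  rewrite /cos_sum /sin_sum !big_ord0 !subr0 !expr0 fact0 divr1 !mulr1 !normrM.
  have lA : `|expR (l * A)| <= expR `|A|.
    rewrite ger0_norm ?expR_ge0// ler_expR (le_trans (ler_norm _))// normrM ger0_norm//.
    by rewrite ler_piMl.
  by split; rewrite -[leRHS]mulr1 ler_pM// ler_norml ?cos_geN1 ?cos_le1 ?sin_geN1 ?sin_le1.
pose D := `|A| + `|B|.
have D0 : 0 <= D by rewrite addr_ge0.
pose e u := expR (u * A) * cos (u * B) - cos_sum A B m u.
pose f u := expR (u * A) * sin (u * B) - sin_sum A B m u.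
(* Covers both parts of (A + i B) (e + i f): the coefficients are A and - B for the real part, B and
   A for the imaginary part. *)
have key u (a b : R) : 0 <= u <= l -> `|a| + `|b| = D ->
    `|a * e u + b * f u| <= expR `|A| * D ^+ m.+1 * (u ^+ m / m`!%:R).
  move=> /andP[u0 ul] abD.
  have [|eu fu] := IHm u; first by rewrite u0 (le_trans ul).
  apply: le_trans (ler_normD _ _) _; rewrite !normrM.
  have -> : expR `|A| * D ^+ m.+1 * (u ^+ m / m`!%:R) =
    `|a| * (expR `|A| * D ^+ m * (u ^+ m / m`!%:R)) +
    `|b| * (expR `|A| * D ^+ m * (u ^+ m / m`!%:R)) by rewrite -mulrDl abD exprS; ring.
  by rewrite lerD// ler_wpM2l.
have sum0 (a : nat -> R) : \sum_(n < m.+1) (a n / n`!%:R) * 0 ^+ n = a 0%N.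
  rewrite big_ord_recl /= big1 ?addr0 ?expr0 ?fact0 ?divr1 ?mulr1// => n _.
  by rewrite expr0n /= mulr0.
split.
- apply: (@pow_bound (fun u => expR (u * A) * cos (u * B) - cos_sum A B m.+1 u)
    (fun u => A * e u + (- B) * f u)) => //.
  + by rewrite /cos_sum (sum0 (fun n => (cpow A B n).1)) !mul0r expR0 cos0 mul1r subrr.
  + move=> u; der; first exact: (dsum (fun n => (cpow A B n).1)).
    rewrite /e /f /cos_sum /sin_sum [X in _ - X](_ : _ =
      A * (\sum_(n < m) ((cpow A B n).1 / n`!%:R) * u ^+ n) -
      B * (\sum_(n < m) ((cpow A B n).2 / n`!%:R) * u ^+ n)); first by ring.
    by rewrite !mulr_sumr -sumrB; apply: eq_bigr => n _ /=; ring.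
  + by move=> u ul; apply: key => //; rewrite normrN.
- apply: (@pow_bound (fun u => expR (u * A) * sin (u * B) - sin_sum A B m.+1 u)
    (fun u => B * e u + A * f u)) => //.
  + by rewrite /sin_sum (sum0 (fun n => (cpow A B n).2)) !mul0r expR0 sin0 mulr0 subrr.
  + move=> u; der; first exact: (dsum (fun n => (cpow A B n).2)).
    rewrite /e /f /cos_sum /sin_sum [X in _ - X](_ : _ =
      B * (\sum_(n < m) ((cpow A B n).1 / n`!%:R) * u ^+ n) +
      A * (\sum_(n < m) ((cpow A B n).2 / n`!%:R) * u ^+ n)); first by ring.
    by rewrite !mulr_sumr -big_split; apply: eq_bigr => n _ /=; ring.
  + by move=> u ul; apply: key => //; rewrite addrC.
Qed.

Let cexp_cvg (u : nat -> R) (A B c : R) :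
  (forall m, `|c - u m| <= expR `|A| * (`|A| + `|B|) ^+ m * (1 ^+ m / m`!%:R)) ->
  u m @[m --> \oo] --> c.
Proof.
move=> uc; apply/cvgrPdist_le => e e0.
have : exp_coeff (`|A| + `|B|) m @[m --> \oo] --> (0 : R).
  exact: (cvg_series_cvg_0 (@is_cvg_series_exp_coeff R (`|A| + `|B|))).
move/cvgrPdist_le => /(_ (e / expR `|A|)); rewrite divr_gt0 ?expR_gt0// => /(_ isT).
apply: filterS => m; rewrite sub0r normrN ler_pdivlMr ?expR_gt0// => H.
apply: le_trans (uc m) (le_trans _ H); rewrite /exp_coeff /= [X in _ <= X * _]ger0_norm.
  by rewrite expr1n le_eqVlt; apply/orP; left; apply/eqP; field; exact: factr_neq0.
by rewrite divr_ge0// exprn_ge0// addr_ge0.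
Qed.

Lemma cexp_cos_cvg (A B : R) :
  \sum_(n < m) (cpow A B n).1 / n`!%:R @[m --> \oo] --> expR A * cos B.
Proof.
apply: (@cexp_cvg _ A B) => m; have [|H _] := @cexp_bound A B m 1; first by rewrite ler01 lexx.
rewrite !mul1r /cos_sum in H; apply: le_trans H; rewrite le_eqVlt; apply/orP; left; apply/eqP.
by congr (`|_ - _| : R); apply: eq_bigr => n _; rewrite expr1n mulr1.
Qed.

Lemma cexp_sin_cvg (A B : R) :
  \sum_(n < m) (cpow A B n).2 / n`!%:R @[m --> \oo] --> expR A * sin B.
Proof.
apply: (@cexp_cvg _ A B) => m; have [|_ H] := @cexp_bound A B m 1; first by rewrite ler01 lexx.
rewrite !mul1r /sin_sum in H; apply: le_trans H; rewrite le_eqVlt; apply/orP; left; apply/eqP.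
by congr (`|_ - _| : R); apply: eq_bigr => n _; rewrite expr1n mulr1.
Qed.

End ComplexExponential.

(** * Exponentials of Laplace transforms *)

Section ExpLaplace.
Context {R : realType}.
Implicit Types (b k : R -> R) (s t x y : R).

Definition laplace b x := int_on hline (fun t => expR (- (x * t)) * b t).
Definition cos_transform b y := int_on hline (fun t => cos (y * t) * b t).
Definition sin_transform b y := int_on hline (fun t => sin (y * t) * b t).

Section Transforms.
Variable b : R -> R.
Hypotheses (mb : measurable_fun setT b) (ib : integrable_on hline b).

Let norm_cos (a : R) : `|cos a| <= 1. Proof. by rewrite ler_norml cos_geN1 cos_le1. Qed.
Let norm_sin (a : R) : `|sin a| <= 1. Proof. by rewrite ler_norml sin_geN1 sin_le1. Qed.

Lemma integrable_on_cosM y : integrable_on hline (fun t => cos (y * t) * b t).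
Proof.
apply: (integrable_onW _ (integrable_on_norm ib)); first by apply: measurable_onT; meas.
by move=> t _; rewrite normrM ler_piMl.
Qed.

Lemma integrable_on_sinM y : integrable_on hline (fun t => sin (y * t) * b t).
Proof.
apply: (integrable_onW _ (integrable_on_norm ib)); first by apply: measurable_onT; meas.
by move=> t _; rewrite normrM ler_piMl.
Qed.

Lemma integrable_on_expRM x : 0 < x -> integrable_on hline (fun t => expR (- (x * t)) * b t).
Proof.
move=> x0; apply: (integrable_onW _ (integrable_on_norm ib)); first by apply: measurable_onT; meas.
move=> t; rewrite in_hline => t0; rewrite normrM ler_piMl// ger0_norm ?expR_ge0//.
by rewrite -expR0 ler_expR oppr_le0 mulr_ge0// ltW.
Qed.

Let D := int_on hline (fun t => `|b t|).

Lemma cos_transform_le y : `|cos_transform b y| <= D.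
Proof.
apply: normr_int_on_le; first exact: integrable_on_measurable (integrable_on_cosM y).
  exact: integrable_on_norm.
by move=> t _; rewrite normrM ler_piMl.
Qed.

Lemma sin_transform_le y : `|sin_transform b y| <= D.
Proof.
apply: normr_int_on_le; first exact: integrable_on_measurable (integrable_on_sinM y).
  exact: integrable_on_norm.
by move=> t _; rewrite normrM ler_piMl.
Qed.

Lemma measurable_cos_transform : measurable_fun setT (cos_transform b).
Proof.
apply: continuous_measurable_fun; apply: (int_on_continuous (g := fun t => `|b t|)).
- by move=> y; apply: measurable_onT; meas.
- by move=> t _ y; der_cont; reflexivity.
- exact: integrable_on_norm.
- by move=> y t _; rewrite normrM ler_piMl.
Qed.

Lemma measurable_sin_transform : measurable_fun setT (sin_transform b).
Proof.
apply: continuous_measurable_fun; apply: (int_on_continuous (g := fun t => `|b t|)).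
- by move=> y; apply: measurable_onT; meas.
- by move=> t _ y; der_cont; reflexivity.
- exact: integrable_on_norm.
- by move=> y t _; rewrite normrM ler_piMl.
Qed.

Variables (a a' x x' : R) (k1 k2 : R -> R).
Hypotheses (x0 : 0 < x) (x'0 : 0 < x').
Hypotheses (mk1 : measurable_fun setT k1) (mk2 : measurable_fun setT k2).
Hypotheses (ik1 : integrable_on hline k1) (ik2 : integrable_on hline k2).
(** The kernels are abstract because two choices occur: a' = 0 with a cosine kernel, leading to
    sinh, and a' = -1 with a difference of two sine kernels, leading to cosh. *)
Hypothesis base : forall s, 0 <= s -> a * expR (- (x * s)) + a' * expR (- (x' * s)) =
  int_on hline (fun y => k1 y * cos (s * y) + k2 y * sin (s * y)).

Let A := cos_transform b.
Let B := sin_transform b.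
Let mA : measurable_fun setT A := measurable_cos_transform.
Let mB : measurable_fun setT B := measurable_sin_transform.
Let U n y := (cpow (A y) (B y) n).1.
Let V n y := (cpow (A y) (B y) n).2.
(** In complex form p - i q = (k1 - i k2) (A + i B)^n, and p cos (s y) + q sin (s y) is the real
    part of (p - i q) e^(i s y). *)
Let p n y := k1 y * U n y + k2 y * V n y.
Let q n y := k2 y * U n y - k1 y * V n y.
Let N y := `|k1 y| + `|k2 y|.

Let mUV n : measurable_fun setT (U n) /\ measurable_fun setT (V n).
Proof.
elim: n => [|n [mU mV]]; first by split; exact: measurable_cst.
split; rewrite /U /V /=.
  by apply: measurable_funB; apply: measurable_funM.
by apply: measurable_funD; apply: measurable_funM.
Qed.

Let mp n : measurable_fun setT (p n).
Proof. by have [? ?] := mUV n; apply: measurable_funD; apply: measurable_funM. Qed.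

Let mq n : measurable_fun setT (q n).
Proof. by have [? ?] := mUV n; apply: measurable_funB; apply: measurable_funM. Qed.

Let UV_le n y : `|U n y| <= (D + D) ^+ n /\ `|V n y| <= (D + D) ^+ n.
Proof.
have [u v] := cpow_le (A y) (B y) n.
have H : (`|A y| + `|B y|) ^+ n <= (D + D) ^+ n.
  by rewrite lerXn2r// ?nnegrE ?addr_ge0 ?lerD// ?cos_transform_le ?sin_transform_le//;
    apply: le_trans (cos_transform_le 0).
by split; apply: le_trans H.
Qed.

Let pq_le n y : `|p n y| <= (D + D) ^+ n * N y /\ `|q n y| <= (D + D) ^+ n * N y.
Proof.
have [u v] := UV_le n y; split.
  rewrite /p /N mulrDr; apply: le_trans (ler_normD _ _) _.
  by rewrite !normrM lerD// mulrC ler_wpM2r.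
rewrite /q /N mulrDr addrC; apply: le_trans (ler_normD _ _) _.
by rewrite normrN !normrM lerD// mulrC ler_wpM2r.
Qed.

Let iN : integrable_on hline N.
Proof. by apply: integrable_onD; exact: integrable_on_norm. Qed.

(** Replacing s by s + t multiplies by e^(i t y); integration against [b t] turns this into the
    factor A + i B. *)
Let step n y s : int_on hline (fun t => b t * (p n y * cos ((s + t) * y) + q n y * sin ((s + t) * y)))
  = p n.+1 y * cos (s * y) + q n.+1 y * sin (s * y).
Proof.
transitivity (int_on hline (fun t =>
  (p n y * cos (s * y) + q n y * sin (s * y)) * (cos (y * t) * b t) +
  (q n y * cos (s * y) - p n y * sin (s * y)) * (sin (y * t) * b t))).
  apply: eq_int_on => t _; have -> : (s + t) * y = s * y + y * t by ring.
  by rewrite cosD sinD; ring.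
rewrite int_onD; try by apply: integrable_onZ; [exact: integrable_on_cosM|exact: integrable_on_sinM].
- rewrite !int_onZ; [|exact: integrable_on_sinM|exact: integrable_on_cosM].
  rewrite -/(cos_transform b y) -/(sin_transform b y) -/(A y) -/(B y).
  by rewrite /p /q /U /V /=; ring.
- exact/integrable_onZ/integrable_on_cosM.
- exact/integrable_onZ/integrable_on_sinM.
Qed.

(** Induction on n: the left side at s + t, integrated against [b t], gains one factor of each
    Laplace transform, and on the right [step] applies once Fubini has exchanged the integrals. A
    free s is what carries the induction; afterwards s = 0 is used. *)
Let pow_repr n s : 0 <= s ->
  a * (laplace b x ^+ n * expR (- (x * s))) + a' * (laplace b x' ^+ n * expR (- (x' * s))) =
  int_on hline (fun y => p n y * cos (s * y) + q n y * sin (s * y)).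
Proof.
elim: n s => [|n IHn] s s0.
  rewrite !expr0 !mul1r base//; apply: eq_int_on => y _.
  by rewrite /p /q /U /V /=; ring.
transitivity (int_on hline (fun t => b t *
    int_on hline (fun y => p n y * cos ((s + t) * y) + q n y * sin ((s + t) * y)))).
  transitivity (int_on hline (fun t =>
    (a * (laplace b x ^+ n * expR (- (x * s)))) * (expR (- (x * t)) * b t) +
    (a' * (laplace b x' ^+ n * expR (- (x' * s)))) * (expR (- (x' * t)) * b t))).
    rewrite int_onD; try exact/integrable_onZ/integrable_on_expRM.
    rewrite !int_onZ; try exact: integrable_on_expRM.
    by rewrite -/(laplace b x) -/(laplace b x') !exprS; ring.
  apply: eq_int_on => t; rewrite in_hline => t0.
  rewrite -IHn ?addr_ge0// ?(ltW t0)//.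
  by rewrite !mulrDr !opprD !expRD; ring.
transitivity (int_on hline (fun t => int_on hline (fun y =>
    b t * (p n y * cos ((s + t) * y) + q n y * sin ((s + t) * y))))).
  apply: eq_int_on => t _; rewrite int_onZ//.
  apply: (integrable_onW _ (integrable_onZ ((D + D) ^+ n * 2) iN)).
    by apply: measurable_onT; meas.
  move=> y _; have [pl ql] := pq_le n y.
  apply: le_trans (ler_normD _ _) _; rewrite !normrM.
  have -> : (D + D) ^+ n * 2 * N y = (D + D) ^+ n * N y * 1 + (D + D) ^+ n * N y * 1 by ring.
  by rewrite lerD// ler_pM.
rewrite (@int_on_Fubini _ hline hline (fun t y =>
    b t * (p n y * cos ((s + t) * y) + q n y * sin ((s + t) * y)))
    (fun t => `|b t|) (fun y => (D + D) ^+ n * 2 * N y)).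
- by apply: eq_int_on => y _; exact: step.
- by meas.
- exact: integrable_on_norm.
- exact: integrable_onZ.
- move=> t y _ _; rewrite normrM ler_wpM2l//; have [pl ql] := pq_le n y.
  apply: le_trans (ler_normD _ _) _; rewrite !normrM.
  have -> : (D + D) ^+ n * 2 * N y = (D + D) ^+ n * N y * 1 + (D + D) ^+ n * N y * 1 by ring.
  by rewrite lerD// ler_pM.
Qed.

Let ip n : integrable_on hline (p n).
Proof.
apply: (integrable_onW _ (integrable_onZ ((D + D) ^+ n) iN)); first exact: measurable_onT.
by move=> y _; have [] := pq_le n y.
Qed.

(** The representations of the powers at s = 0 are divided by n! and summed. All partial sums are
    dominated by e^(2 D) [N], where [D] is the L1 norm of [b]. *)
Lemma exp_laplace : a * expR (laplace b x) + a' * expR (laplace b x') =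
  int_on hline (fun y => expR (A y) * (k1 y * cos (B y) + k2 y * sin (B y))).
Proof.
have D0 : 0 <= D by apply: le_trans (cos_transform_le 0).
pose F m y := \sum_(n < m) (n`!%:R)^-1 * p n y.
have FE m : int_on hline (F m) =
    a * (\sum_(n < m) laplace b x ^+ n / n`!%:R) + a' * (\sum_(n < m) laplace b x' ^+ n / n`!%:R).
  rewrite /F (@int_on_sum _ _ _ (fun n y => (n`!%:R)^-1 * p n y)); last first.
    by move=> n _; exact: integrable_onZ.
  rewrite !mulr_sumr -big_split; apply: eq_bigr => n _ /=.
  rewrite int_onZ//; have := @pow_repr n 0 (lexx _).
  rewrite !mulr0 oppr0 expR0 !mulr1 => E.
  rewrite (_ : int_on hline (p n) = a * laplace b x ^+ n + a' * laplace b x' ^+ n); first by ring.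
  by rewrite E; apply: eq_int_on => y _; rewrite mul0r cos0 sin0 mulr1 mulr0 addr0.
have exp_cvg (z : R) : \sum_(n < m) z ^+ n / n`!%:R @[m --> \oo] --> expR z.
  have := @cexp_cos_cvg R z 0; rewrite cos0 mulr1.
  by under eq_fun do under eq_bigr do rewrite cpow_real.
have C1 : int_on hline (F m) @[m --> \oo] --> a * expR (laplace b x) + a' * expR (laplace b x').
  under eq_fun do rewrite FE.
  by apply: cvgD; apply: cvgMr; exact: exp_cvg.
apply: (cvg_unique _ C1) => //.
apply: (@int_on_dct _ _ F _ (fun y => expR (D + D) * N y) _ _ _ _).2.
- by move=> m; apply: measurable_onT; rewrite /F; meas.
- move=> y _; rewrite /F.
  rewrite (_ : (fun m => _) = (fun m => k1 y * (\sum_(n < m) U n y / n`!%:R) +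
      k2 y * (\sum_(n < m) V n y / n`!%:R))); last first.
    apply/funext => m; rewrite !mulr_sumr -big_split; apply: eq_bigr => n _ /=.
    by rewrite /p; ring.
  have -> : expR (A y) * (k1 y * cos (B y) + k2 y * sin (B y)) =
    k1 y * (expR (A y) * cos (B y)) + k2 y * (expR (A y) * sin (B y)) by ring.
  by apply: cvgD; apply: cvgMr; [exact: cexp_cos_cvg|exact: cexp_sin_cvg].
- exact: integrable_onZ.
- move=> m y _; rewrite /F; apply: le_trans (ler_norm_sum _ _ _) _.
  apply: (@le_trans _ _ (\sum_(n < m) (D + D) ^+ n / n`!%:R * N y)).
    apply: ler_sum => n _; rewrite normrM ger0_norm ?invr_ge0//.
    rewrite mulrAC [leRHS]mulrC ler_wpM2l ?invr_ge0//.
    by have [] := pq_le n y.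
  rewrite -mulr_suml ler_wpM2r ?addr_ge0//.
  have C2 : (fun m => \sum_(n < m) (D + D) ^+ n / n`!%:R) m @[m --> \oo] --> expR (D + D).
    exact: exp_cvg.
  rewrite -(cvg_lim _ C2)//; apply: nondecreasing_cvgn_le; last by apply/cvg_ex; eexists; exact: C2.
  apply/nondecreasing_seqP => i; rewrite big_ord_recr lerDl /=.
  by rewrite divr_ge0// exprn_ge0// addr_ge0.
Qed.

End Transforms.
End ExpLaplace.

(** * Hyperbolic functions *)

Section Hyperbolic.
Context {R : realType}.
Implicit Types (x y : R).

Definition sinh x : R := (expR x - expR (- x)) / 2.
Definition cosh x : R := (expR x + expR (- x)) / 2.

Lemma cosh_sinh_add x : cosh x + sinh x = expR x.
Proof. by rewrite /cosh /sinh; field. Qed.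

Lemma cosh_sinh_sub x : cosh x - sinh x = expR (- x).
Proof. by rewrite /cosh /sinh; field. Qed.

Lemma sinh0 : sinh 0 = 0. Proof. by rewrite /sinh oppr0 subrr mul0r. Qed.

Lemma cosh0 : cosh 0 = 1. Proof. by rewrite /cosh oppr0 expR0; field. Qed.

Lemma cosh_gt0 x : 0 < cosh x.
Proof. by rewrite divr_gt0// addr_gt0 ?expR_gt0. Qed.

Lemma is_derive_fsinh (f : R -> R) x df : is_derive x 1 f df ->
  is_derive x 1 (fun y => sinh (f y)) (cosh (f x) * df).
Proof. by move=> hf; rewrite /sinh /cosh; der; [exact: hf|exact: hf|field]. Qed.

Lemma is_derive_fcosh (f : R -> R) x df : is_derive x 1 f df ->
  is_derive x 1 (fun y => cosh (f y)) (sinh (f x) * df).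
Proof. by move=> hf; rewrite /sinh /cosh; der; [exact: hf|exact: hf|field]. Qed.

Lemma measurable_sinh : measurable_fun setT sinh.
Proof. by rewrite /sinh; meas. Qed.

Lemma sinh_ge x : 0 <= x -> x <= sinh x.
Proof.
move=> x0; rewrite -subr_ge0 -[X in X <= _](_ : sinh 0 - 0 = 0); last by rewrite sinh0 subrr.
have D y : is_derive y 1 (fun y => sinh y - y) (cosh y - 1).
  by der; [apply: is_derive_fsinh; exact: is_derive_fid|ring].
apply: (le_of_derive_ge0 x0 (fun u _ => D u)) => u /andP[/ltW u0 _].
rewrite subr_ge0 /cosh ler_pdivlMr// mul1r -subr_ge0 expRN.
have e0 := expR_gt0 u; have en0 : expR u != 0 by rewrite gt_eqF.
have -> : expR u + (expR u)^-1 - 2 = (expR u - 1) ^+ 2 / expR u by field.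
by rewrite divr_ge0 ?sqr_ge0 ?ltW.
Qed.

Lemma sinh_ge0 x : 0 <= x -> 0 <= sinh x.
Proof. by move=> x0; apply: le_trans (sinh_ge x0). Qed.

Lemma sinh_gt0 x : 0 < x -> 0 < sinh x.
Proof. by move=> x0; apply: lt_le_trans (sinh_ge (ltW x0)). Qed.

Lemma sinh_le x : 0 <= x -> sinh x <= x * cosh x.
Proof.
move=> x0; rewrite -subr_ge0 -[X in X <= _](_ : 0 * cosh 0 - sinh 0 = 0); last first.
  by rewrite sinh0 mul0r subrr.
have D y : is_derive y 1 (fun y => y * cosh y - sinh y) (y * sinh y).
  by der; [apply: is_derive_fcosh; exact: is_derive_fid|apply: is_derive_fsinh; exact: is_derive_fid|ring].
apply: (le_of_derive_ge0 x0 (fun u _ => D u)) => u /andP[/ltW u0 _].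
by rewrite mulr_ge0// sinh_ge0.
Qed.

End Hyperbolic.

Ltac der_hyp := repeat (der_rule ||
  lazymatch goal with
  | |- is_derive _ _ (fun t => sinh (@?f t)) _ => notypeclasses refine (@is_derive_fsinh _ f _ _ _)
  | |- is_derive _ _ (fun t => cosh (@?f t)) _ => notypeclasses refine (@is_derive_fcosh _ f _ _ _)
  end).
Ltac derh := notypeclasses refine (is_derive_eq _ _); [der_hyp|]; cbv beta.
Ltac derh_cont := notypeclasses refine (is_derive_continuous _); derh.

(** * Integral formulas for sinh and cosh of a Laplace transform *)

Section HyperbolicLaplace.
Context {R : realType}.
Variable b : R -> R.
Hypotheses (mb : measurable_fun setT b) (ib : integrable_on hline b).
Implicit Types (x y : R).

Let A := cos_transform b.
Let B := sin_transform b.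

Let b' t := - b t.

Let mb' : measurable_fun setT b'. Proof. by rewrite /b'; meas. Qed.

Let ib' : integrable_on hline b'.
Proof.
by apply: eq_integrable_on (integrable_onZ (-1) ib) => t _; rewrite mulN1r.
Qed.

Let A' y : cos_transform b' y = - A y.
Proof.
rewrite -mulN1r /A /cos_transform -int_onZ; last exact: integrable_on_cosM.
by apply: eq_int_on => t _; rewrite /b'; ring.
Qed.

Let B' y : sin_transform b' y = - B y.
Proof.
rewrite -mulN1r /B /sin_transform -int_onZ; last exact: integrable_on_sinM.
by apply: eq_int_on => t _; rewrite /b'; ring.
Qed.

Let L' x : 0 < x -> laplace b' x = - laplace b x.
Proof.
move=> x0; rewrite -mulN1r /laplace -int_onZ; last exact: integrable_on_expRM.
by apply: eq_int_on => t _; rewrite /b'; ring.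
Qed.

Let mA : measurable_fun setT A. Proof. exact: measurable_cos_transform. Qed.
Let mB : measurable_fun setT B. Proof. exact: measurable_sin_transform. Qed.
Let D := int_on hline (fun t => `|b t|).

Let expA_le y : expR (A y) <= expR D /\ expR (- A y) <= expR D.
Proof.
have := cos_transform_le mb ib y; rewrite ler_norml => /andP[H1 H2].
by rewrite !ler_expR; split; [exact: H2|rewrite lerNl; exact: H1].
Qed.

Let half_sub_le (p q r : R) : 0 <= p <= r -> 0 <= q <= r -> `|(p - q) / 2| <= r.
Proof. by move=> /andP[? ?] /andP[? ?]; rewrite ler_norml; apply/andP; split; lra. Qed.

Let half_sub (p q r s : R) : (p + q) / 2 - (r + s) / 2 = 2^-1 * (p - r) - 2^-1 * - (q - s).
Proof. by field. Qed.

Let sinhA_le y : `|sinh (A y)| <= expR D.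
Proof. by have [H1 H2] := expA_le y; apply: half_sub_le; rewrite expR_ge0. Qed.

Let cosB_le y : `|cos (B y)| <= 1. Proof. by rewrite ler_norml cos_geN1 cos_le1. Qed.
Let sinB_le y : `|sin (B y)| <= 1. Proof. by rewrite ler_norml sin_geN1 sin_le1. Qed.

Let expM_i (e f k : R -> R) C : measurable_fun setT e -> measurable_fun setT f ->
  (forall y, `|e y| <= C) -> (forall y, `|f y| <= 1) -> integrable_on hline k ->
  integrable_on hline (fun y => e y * (k y * f y)).
Proof.
move=> me mf eC f1 ik.
apply: (integrable_onW _ (integrable_onZ C (integrable_on_norm ik))).
  apply: measurable_funM; first exact: measurable_onT.
  by apply: measurable_funM; [exact: integrable_on_measurable|exact: measurable_onT].
by move=> y _; rewrite !normrM ler_pM// ler_piMr.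
Qed.

(** Changing the sign of [b] turns e^A cos B into e^(-A) cos B, so half the difference of the two
    exponential formulas carries sinh A cos B. *)
Lemma sinh_laplace x : 0 < x -> sinh (laplace b x) =
  2 * x / pi * int_on hline (fun y => sinh (A y) * cos (B y) / (x ^+ 2 + y ^+ 2)).
Proof.
move=> x0; pose k y := 2 * x / pi * (x ^+ 2 + y ^+ 2)^-1.
have pi0 := pi_gt0 R.
have ik : integrable_on hline k by apply: integrable_onZ; exact: integrable_on_cauchy.
have mk : measurable_fun setT k by rewrite /k; meas.
have base s : 0 <= s -> 1 * expR (- (x * s)) + 0 * expR (- (x * s)) =
    int_on hline (fun y => k y * cos (s * y) + 0 * sin (s * y)).
  move=> s0; rewrite mul0r addr0 mul1r.
  have F (p e : R) : p != 0 -> 2 * x / p * (p / (2 * x) * e) = e.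
    by move=> p0; field; rewrite p0 gt_eqF.
  rewrite -[LHS](F pi) ?gt_eqF// -cauchy_cos// -int_onZ; last exact: integrable_on_cos_cauchy.
  by apply: eq_int_on => y _; rewrite /k; ring.
have m0 : measurable_fun setT (fun _ : R => 0 : R) by exact: measurable_cst.
have E1 := exp_laplace mb ib x0 x0 mk m0 ik (integrable_on0 _) base.
have E2 := exp_laplace mb' ib' x0 x0 mk m0 ik (integrable_on0 _) base.
rewrite !mul0r !addr0 !mul1r L'// in E1 E2.
have I1 : integrable_on hline (fun y => expR (A y) * (k y * cos (B y))).
  by apply: (expM_i (C := expR D)) => //; [meas|meas|move=> y; rewrite ger0_norm ?expR_ge0//; have [] := expA_le y].
have I2 : integrable_on hline (fun y => expR (- A y) * (k y * cos (B y))).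
  by apply: (expM_i (C := expR D)) => //; [meas|meas|move=> y; rewrite ger0_norm ?expR_ge0//; have [] := expA_le y].
transitivity (int_on hline (fun y => 2^-1 * (expR (A y) * (k y * cos (B y))) - 2^-1 * (expR (- A y) * (k y * cos (B y))))).
  rewrite int_onB; try exact: integrable_onZ.
  rewrite !int_onZ// /sinh E1 E2 mulrC mulrBr; congr (2^-1 * _ - 2^-1 * _).
    by apply: eq_int_on => y _; ring.
  by apply: eq_int_on => y _; rewrite A' B' cosN; ring.
rewrite -int_onZ; first by apply: eq_int_on => y _; rewrite /k /sinh; ring.
have ic := integrable_on_cauchy x0.
apply: eq_integrable_on (expM_i (C := expR D) _ _ sinhA_le cosB_le ic); last 2 first.
- by apply: measurable_fcomp => //; exact: measurable_sinh.
- by meas.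
by move=> y _; ring.
Qed.

Let k x y : R := (x ^+ 2 + y ^+ 2)^-1.

(** With a sine kernel, changing the sign of [b] also changes that of sin B; the half-sum of the two
    exponentials, instead of their difference, now produces sinh A. *)
Lemma cosh_laplace_sub x x' : 0 < x -> 0 < x' ->
  cosh (laplace b x) - cosh (laplace b x') =
  2 / pi * int_on hline (fun y => sinh (A y) * (y * (k x y - k x' y) * sin (B y))).
Proof.
move=> x0 x'0; pose k2 y := 2 / pi * (y * (k x y - k x' y)).
have pi0 := pi_gt0 R.
have id := integrable_on_cauchy_diff x0 x'0.
have ik : integrable_on hline k2 by exact: integrable_onZ.
have mk : measurable_fun setT k2 by rewrite /k2 /k; meas.
have base s : 0 <= s -> 1 * expR (- (x * s)) + (- 1) * expR (- (x' * s)) =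
    int_on hline (fun y => 0 * cos (s * y) + k2 y * sin (s * y)).
  move=> s0; rewrite mul1r mulN1r.
  have F (p e : R) : p != 0 -> 2 / p * (p / 2 * e) = e by move=> p0; field.
  rewrite -[LHS](F pi) ?gt_eqF// -cauchy_sin// -int_onZ; last first.
    apply: (integrable_onW _ (integrable_on_norm id)).
      by apply: measurable_onT; meas.
    by move=> y _; rewrite normrM ler_piMl// ler_norml sin_geN1 sin_le1.
  by apply: eq_int_on => y _; rewrite /k2 /k; ring.
have m0 : measurable_fun setT (fun _ : R => 0 : R) by exact: measurable_cst.
have E1 := exp_laplace mb ib x0 x'0 m0 mk (integrable_on0 _) ik base.
have E2 := exp_laplace mb' ib' x0 x'0 m0 mk (integrable_on0 _) ik base.
rewrite !L'// in E2.
have I1 : integrable_on hline (fun y => expR (A y) * (k2 y * sin (B y))).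
  by apply: (expM_i (C := expR D)) => //; [meas|meas|move=> y; rewrite ger0_norm ?expR_ge0//; have [] := expA_le y].
have I2 : integrable_on hline (fun y => expR (- A y) * (k2 y * sin (B y))).
  by apply: (expM_i (C := expR D)) => //; [meas|meas|move=> y; rewrite ger0_norm ?expR_ge0//; have [] := expA_le y].
transitivity (int_on hline (fun y => 2^-1 * (expR (A y) * (k2 y * sin (B y))) - 2^-1 * (expR (- A y) * (k2 y * sin (B y))))).
  rewrite int_onB; try exact: integrable_onZ.
  rewrite !int_onZ//.
  have -> : int_on hline (fun y => expR (A y) * (k2 y * sin (B y))) =
      expR (laplace b x) - expR (laplace b x').
    rewrite -mulN1r -[X in X + _]mul1r E1.
    by apply: eq_int_on => y _; rewrite -/(A y) -/(B y); ring.
  have -> : int_on hline (fun y => expR (- A y) * (k2 y * sin (B y))) =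
      - (expR (- laplace b x) - expR (- laplace b x')).
    rewrite -[X in - (_ + X)]mulN1r -[X in - (X + _)]mul1r E2 -mulN1r -int_onZ.
      by apply: eq_int_on => y _; rewrite A' B' sinN; ring.
    apply: eq_integrable_on (integrable_onZ (-1) I2) => y _.
    by rewrite A' B' sinN; ring.
  exact: half_sub.
rewrite -int_onZ; first by apply: eq_int_on => y _; rewrite /k2 /sinh; ring.
apply: (expM_i (C := expR D)) => //; last 2 first.
- by apply: measurable_fcomp => //; exact: measurable_sinh.
- by meas.
Qed.

Lemma laplace_cvg0 : laplace b n.+1%:R @[n --> \oo] --> (0 : R).
Proof.
rewrite -[X in _ --> X](@int_on0 R hline).
apply: (@int_on_dct _ _ (fun n t => expR (- (n.+1%:R * t)) * b t) _ (fun t => `|b t|) _ _ _ _).2.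
- by move=> n; apply: measurable_onT; meas.
- move=> t; rewrite in_hline => t0.
  rewrite -[X in _ --> X](mul0r (b t)); apply: cvgMl.
  apply/cvgrPdist_le => e e0; near=> n.
  rewrite sub0r normrN ger0_norm ?expR_ge0//.
  have n0 : 0 < n.+1%:R :> R by rewrite ltr0n.
  rewrite -(ler_pM2l t0).
  apply: le_trans (_ : n.+1%:R^-1 <= _).
    by have := @exprn_expRN_le R 1 n.+1%:R t n0 (ltW t0); rewrite !expr1 factS fact0 muln1 mul1r.
  rewrite invf_ple ?posrE ?mulr_gt0//; apply: (@le_trans _ _ n%:R); last by rewrite ler_nat.
  by near: n; exact: nbhs_infty_ger.
- exact: integrable_on_norm.
- move=> n t; rewrite in_hline => t0; rewrite normrM ler_piMl// ger0_norm ?expR_ge0//.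
  by rewrite -expR0 ler_expR oppr_le0 mulr_ge0// ltW.
Unshelve. all: by end_near. Qed.

(** x' tends to infinity in [cosh_laplace_sub], where the Laplace transform tends to 0 and its cosh
    to 1. Integrability of the limiting integrand is a premise because it rests on the decay of [A],
    which is special to the density. *)
Lemma cosh_laplace x : 0 < x ->
  integrable_on hline (fun y => y * (sinh (A y) * sin (B y)) / (x ^+ 2 + y ^+ 2)) ->
  cosh (laplace b x) - 1 =
  2 / pi * int_on hline (fun y => y * (sinh (A y) * sin (B y)) / (x ^+ 2 + y ^+ 2)).
Proof.
move=> x0 fi.
have C1 : cosh (laplace b x) - cosh (laplace b n.+1%:R) @[n --> \oo] --> cosh (laplace b x) - 1.
  apply: cvgB; first exact: cvg_cst.
  have cc : {for 0, continuous (fun x : R => cosh x)} by derh_cont; reflexivity.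
  have := cvg_comp (fun n => laplace b n.+1%:R) (fun x : R => cosh x) laplace_cvg0 cc.
  by rewrite cosh0.
apply: (cvg_unique _ C1) => //.
have -> : (fun n => cosh (laplace b x) - cosh (laplace b n.+1%:R)) =
   (fun n => 2 / pi * int_on hline (fun y => sinh (A y) * (y * (k x y - k n.+1%:R y) * sin (B y)))).
  by apply/funext => n; rewrite cosh_laplace_sub.
apply: cvgMr.
apply: (@int_on_dct _ _ (fun n y => sinh (A y) * (y * (k x y - k n.+1%:R y) * sin (B y))) _
  (fun y => (1 + x ^+ 2) * `|y * (sinh (A y) * sin (B y)) * k x y|) _ _ _ _).2.
- move=> n; apply: measurable_onT; rewrite /k.
  apply: measurable_funM; first by apply: measurable_fcomp => //; exact: measurable_sinh.
  by meas.
- move=> y _.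
  rewrite (_ : y * (sinh (A y) * sin (B y)) / (x ^+ 2 + y ^+ 2) =
     sinh (A y) * (y * (k x y - 0) * sin (B y))); last by rewrite /k; ring.
  apply: cvgMr; apply: cvgMl; apply: cvgMr; apply: cvgB; first exact: cvg_cst.
  apply/cvgrPdist_le => e e0; near=> n.
  have n0 : 0 < n.+1%:R :> R by rewrite ltr0n.
  have n1 : 1 <= n.+1%:R :> R by rewrite ler1n.
  have ny0 : 0 < n.+1%:R ^+ 2 + y ^+ 2 by rewrite ltr_pwDl ?exprn_gt0 ?sqr_ge0.
  rewrite sub0r normrN gtr0_norm ?invr_gt0//.
  apply: le_trans (_ : (n.+1%:R)^-1 <= _).
    rewrite lef_pV2 ?posrE// (le_trans (ler_peMl (ltW n0) n1))//.
    by rewrite -expr2 lerDl sqr_ge0.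
  rewrite invf_ple ?posrE//; apply: le_trans (_ : n%:R <= _); last by rewrite ler_nat.
  by near: n; exact: nbhs_infty_ger.
- exact/integrable_onZ/integrable_on_norm.
- move=> n y _.
  have n0 : 0 < n.+1%:R :> R by rewrite ltr0n.
  have n1 : 1 <= n.+1%:R :> R by rewrite ler1n.
  have ny0 : 0 < n.+1%:R ^+ 2 + y ^+ 2 by rewrite ltr_pwDl ?exprn_gt0 ?sqr_ge0.
  have xy0 : 0 < x ^+ 2 + y ^+ 2 by rewrite ltr_pwDl ?exprn_gt0 ?sqr_ge0.
  (* The difference of kernels is [k x y] times (x'^2 - x^2) / (x'^2 + y^2) with x' = n + 1, a
     factor bounded by 1 + x^2 since x' is at least 1. *)
  have -> : sinh (A y) * (y * (k x y - k n.+1%:R y) * sin (B y)) =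
     (n.+1%:R ^+ 2 - x ^+ 2) / (n.+1%:R ^+ 2 + y ^+ 2) * (y * (sinh (A y) * sin (B y)) * k x y).
    rewrite /k; move: (n.+1%:R) (sinh _) (sin _) ny0 => m p r m0.
    by field; rewrite !gt_eqF.
  rewrite normrM ler_wpM2r// normrM normfV (gtr0_norm ny0) ler_pdivrMr//.
  have := sqr_ge0 x; have := sqr_ge0 y; have : 1 <= n.+1%:R ^+ 2 :> R by rewrite exprn_ege1.
  move: (n.+1%:R ^+ 2) (x ^+ 2) (y ^+ 2) => n2 x2 y2 H1 H2 H3.
  rewrite ler_norml; apply/andP; split; nra.
Unshelve. all: by end_near. Qed.

End HyperbolicLaplace.

(** * Partial fractions of the hyperbolic cotangent *)

Section PartialFractions.
Context {R : realType}.
Implicit Types (t x : R) (n : nat).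

(** The integrals behind Euler's product for sinh. [sinh_cos_int] is the derivative of
    [cosh_cos_int] in t, so the quotient [q] below is a logarithmic derivative: each two-step
    recursion contributes a factor (n + 2)^2 + t^2 and hence one partial fraction to [q]. *)
Definition cosh_cos_int n t := int_on `[0, pi / 2] (fun x => cosh (t * x) * cos x ^+ n).
Definition sinh_cos_int n t := int_on `[0, pi / 2] (fun x => x * sinh (t * x) * cos x ^+ n).

Let I := cosh_cos_int.
Let J := sinh_cos_int.

Let pi2_gt0 : 0 < pi / 2 :> R. Proof. by rewrite divr_gt0// pi_gt0. Qed.

Let cI n t x : {for x, continuous (fun x => cosh (t * x) * cos x ^+ n)}.
Proof. by derh_cont; reflexivity. Qed.

Let cJ n t x : {for x, continuous (fun x => x * sinh (t * x) * cos x ^+ n)}.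
Proof. by derh_cont; reflexivity. Qed.

Let cIin (n : nat) t :
  {in `[0, pi / 2], forall x, {for x, continuous (fun x => cosh (t * x) * cos x ^+ n)}}.
Proof. by move=> x _; exact: cI. Qed.

Let cJin (n : nat) t :
  {in `[0, pi / 2], forall x, {for x, continuous (fun x => x * sinh (t * x) * cos x ^+ n)}}.
Proof. by move=> x _; exact: cJ. Qed.

Let iI n t : integrable_on `[0, pi / 2] (fun x => cosh (t * x) * cos x ^+ n).
Proof. by apply: integrable_on_continuous => x _; exact: cI. Qed.

Let iJ n t : integrable_on `[0, pi / 2] (fun x => x * sinh (t * x) * cos x ^+ n).
Proof. by apply: integrable_on_continuous => x _; exact: cJ. Qed.

Lemma cosh_cos_int_rec n t :
  (n.+2%:R ^+ 2 + t ^+ 2) * I n.+2 t = n.+2%:R * n.+1%:R * I n t.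
Proof.
pose f x := (n.+2%:R ^+ 2 + t ^+ 2) * (cosh (t * x) * cos x ^+ n.+2) -
  n.+2%:R * n.+1%:R * (cosh (t * x) * cos x ^+ n).
(* Antiderivative found by integrating by parts twice; it vanishes at both ends because sin 0 = sinh
   0 = 0 and cos (pi / 2) = 0. *)
pose F x := cosh (t * x) * (n.+2%:R * cos x ^+ n.+1 * sin x) + t * sinh (t * x) * cos x ^+ n.+2.
have F0 : F 0 = 0 by rewrite /F mulr0 sinh0 sin0; ring.
have Fpi : F (pi / 2) = 0 by rewrite /F cos_pihalf !exprS !mul0r; ring.
have dF x : 0 <= x <= pi / 2 -> is_derive x 1 F (f x).
  move=> _; rewrite /f /F; derh; rewrite /= !exprS.
  have -> : cosh (t * x) * (cos x * (cos x * cos x ^+ n)) = cosh (t * x) * (1 - sin x ^+ 2) * cos x ^+ n.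
    by rewrite -cos2sin2; ring.
  have := cos2sin2 x; move: (cos x) (sin x) => c s' cs.
  have s2 : s' * s' = 1 - c ^+ 2 by rewrite cs; ring.
  transitivity (cosh (t * x) * c ^+ n * ((n.+2%:R + t ^+ 2) * c ^+ 2 - n.+2%:R * n.+1%:R * (s' * s'))); first by ring.
  by rewrite -cs s2 -!natr1; ring.
have cf : {in `[0, pi / 2], forall x, {for x, continuous f}}.
  by move=> x _; rewrite /f; derh_cont; reflexivity.
have := int_on_FTC pi2_gt0 dF cf.
rewrite int_onB; try exact: integrable_onZ.
rewrite !int_onZ// F0 Fpi subr0.
by move/eqP; rewrite subr_eq0 => /eqP.
Qed.

(** The derivative in t of [cosh_cos_int_rec], obtained through an antiderivative of its own instead
    of differentiating the integrals. *)
Lemma sinh_cos_int_rec n t :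
  (n.+2%:R ^+ 2 + t ^+ 2) * J n.+2 t + 2 * t * I n.+2 t = n.+2%:R * n.+1%:R * J n t.
Proof.
pose f x := (n.+2%:R ^+ 2 + t ^+ 2) * (x * sinh (t * x) * cos x ^+ n.+2) +
  2 * t * (cosh (t * x) * cos x ^+ n.+2) - n.+2%:R * n.+1%:R * (x * sinh (t * x) * cos x ^+ n).
pose F x := (sinh (t * x) + t * x * cosh (t * x)) * cos x ^+ n.+2 +
  x * sinh (t * x) * (n.+2%:R * cos x ^+ n.+1 * sin x).
have F0 : F 0 = 0 by rewrite /F mulr0 sinh0; ring.
have Fpi : F (pi / 2) = 0 by rewrite /F cos_pihalf !exprS !mul0r; ring.
have dF x : 0 <= x <= pi / 2 -> is_derive x 1 F (f x).
  move=> _; rewrite /f /F; derh; rewrite /= !exprS.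
  have := cos2sin2 x; move: (cos x) (sin x) => c s' cs.
  have s2 : s' * s' = 1 - c ^+ 2 by rewrite cs; ring.
  transitivity (c ^+ n * (x * sinh (t * x) * ((n.+2%:R + t ^+ 2) * c ^+ 2 - n.+2%:R * n.+1%:R * (s' * s')) +
    2 * t * cosh (t * x) * c ^+ 2)); first by ring.
  by rewrite s2 -!natr1; ring.
have cf : {in `[0, pi / 2], forall x, {for x, continuous f}}.
  by move=> x _; rewrite /f; derh_cont; reflexivity.
have := int_on_FTC pi2_gt0 dF cf.
rewrite int_onB; [|by apply: integrable_onD; exact: integrable_onZ|exact: integrable_onZ].
rewrite int_onD; try exact: integrable_onZ.
rewrite !int_onZ// F0 Fpi subr0.
by move/eqP; rewrite subr_eq0 => /eqP.
Qed.

Let cos_ge0 x : x \in `[0, pi / 2] -> 0 <= cos x.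
Proof.
rewrite in_itv /= => /andP[x0 xp]; apply: cos_ge0_pihalf; rewrite xp andbT.
by rewrite (le_trans _ x0)// oppr_le0 ltW.
Qed.

Lemma cosh_cos_int_gt0 n t : 0 < I n t.
Proof.
apply: (@int_on_gt0 _ _ `]0, (pi / 2)[) => //.
- by rewrite /= lebesgue_measure_itv /= lte_fin pi2_gt0 -EFinB eqe subr0 gt_eqF.
- by move=> x; exact: subset_itv_oo_cc.
- by move=> x xI; rewrite mulr_ge0 ?exprn_ge0 ?cos_ge0// ltW// cosh_gt0.
- move=> x; rewrite in_itv /= => /andP[x0 xp].
  rewrite mulr_gt0 ?cosh_gt0// exprn_gt0// cos_gt0_pihalf// xp andbT.
  by rewrite (lt_trans _ x0)// oppr_lt0.
Qed.

Lemma sinh_cos_int_ge0 n t : 0 <= t -> 0 <= J n t.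
Proof.
move=> t0; apply: int_on_ge0 => x xI; rewrite mulr_ge0 ?exprn_ge0 ?cos_ge0//.
by move: xI; rewrite in_itv /= => /andP[x0 _]; rewrite mulr_ge0// sinh_ge0// mulr_ge0.
Qed.

Lemma x_cos_le_sin x : 0 <= x <= pi / 2 -> x * cos x <= sin x.
Proof.
move=> /andP[x0 xp]; rewrite -subr_ge0 -[X in X <= _](_ : sin 0 - 0 * cos 0 = 0 :> R); last first.
  by rewrite sin0 mul0r subrr.
have D (y : R) : is_derive y 1 (fun y : R => sin y - y * cos y) (y * sin y) by der; ring.
apply: (le_of_derive_ge0 x0 (fun u _ => D u)) => u /andP[u0 ux].
rewrite mulr_ge0 ?(ltW u0)// sin_ge0_pi// (ltW u0) /=.
by move: xp (pi_gt0 R); move: (pi : R) => p xp p0; lra.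
Qed.

(** The bounds sinh u <= u cosh u and x cos x <= sin x majorize the integrand of J at n + 2 by t
    cosh (t x) cos^n x sin^2 x, whose integral is t times a difference of two values of I; the
    recursion then eliminates I at n. *)
Lemma sinh_cos_int_le n t : 0 <= t ->
  n.+2%:R * n.+1%:R * J n.+2 t <= t * (n.+2%:R + t ^+ 2) * I n.+2 t.
Proof.
move=> t0.
have H : J n.+2 t <= t * (I n t - I n.+2 t).
  rewrite -int_onB// -int_onZ; last exact: integrable_onB.
  apply: le_int_on => //; first by apply: integrable_onZ; exact: integrable_onB.
  move=> x xI; have c0 := cos_ge0 xI; move: xI; rewrite in_itv /= => xI.
  have /andP[x0 _] := xI; have sc := x_cos_le_sin xI.
  have tx0 : 0 <= t * x by rewrite mulr_ge0.
  apply: (@le_trans _ _ (x * (t * x * cosh (t * x)) * cos x ^+ n.+2)).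
    by rewrite ler_wpM2r ?exprn_ge0// ler_wpM2l// sinh_le.
  have -> : x * (t * x * cosh (t * x)) * cos x ^+ n.+2 =
    t * (cosh (t * x) * cos x ^+ n * (x * cos x) ^+ 2) by rewrite !exprS; ring.
  rewrite ler_wpM2l//.
  have -> : cosh (t * x) * cos x ^+ n - cosh (t * x) * cos x ^+ n.+2 =
     cosh (t * x) * cos x ^+ n * sin x ^+ 2.
    transitivity (cosh (t * x) * cos x ^+ n * (1 - cos x ^+ 2)); first by rewrite !exprS; ring.
    by rewrite cos2sin2; ring.
  rewrite ler_wpM2l ?mulr_ge0 ?exprn_ge0// ?(ltW (cosh_gt0 _))//.
  by rewrite lerXn2r// ?nnegrE ?mulr_ge0// (le_trans _ sc)// mulr_ge0.
have E := cosh_cos_int_rec n t.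
apply: le_trans (ler_wpM2l _ H) _; first by rewrite mulr_ge0.
have -> : n.+2%:R * n.+1%:R * (t * (I n t - I n.+2 t)) =
    t * (n.+2%:R * n.+1%:R * I n t - n.+2%:R * n.+1%:R * I n.+2 t) by ring.
by rewrite -E le_eqVlt; apply/orP; left; apply/eqP; rewrite -!natr1; ring.
Qed.

Let q n t := J n t / I n t.

Let q_rec n t : 0 < t -> q n t = q n.+2 t + 2 * t / (n.+2%:R ^+ 2 + t ^+ 2).
Proof.
move=> t0; rewrite /q.
have I1 : I n t != 0 by rewrite gt_eqF// cosh_cos_int_gt0.
have I2 : I n.+2 t != 0 by rewrite gt_eqF// cosh_cos_int_gt0.
have d0 : n.+2%:R ^+ 2 + t ^+ 2 != 0 by rewrite gt_eqF// addr_gt0 ?exprn_gt0.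
have c0 : n.+2%:R * n.+1%:R != 0 :> R by rewrite mulf_neq0// pnatr_eq0.
have -> : J n t / I n t = (n.+2%:R * n.+1%:R * J n t) / (n.+2%:R * n.+1%:R * I n t).
  by rewrite -mulf_div divff ?mul1r.
rewrite -sinh_cos_int_rec -cosh_cos_int_rec.
move: (n.+2%:R ^+ 2 + t ^+ 2) d0 => d d0.
by field; rewrite I2 d0.
Qed.

Let q0 t : 0 < t -> q 0 t = pi / 2 * (cosh (t * (pi / 2)) / sinh (t * (pi / 2))) - t^-1.
Proof.
move=> t0; have tn0 : t != 0 by rewrite gt_eqF.
have I0 : I 0 t = sinh (t * (pi / 2)) / t.
  have dF x : 0 <= x <= pi / 2 -> is_derive x 1 (fun x => sinh (t * x) / t) (cosh (t * x) * cos x ^+ 0).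
    by move=> _; derh => //; rewrite expr0; field.
  have := int_on_FTC pi2_gt0 dF (@cIin 0%N t).
  by rewrite mulr0 sinh0 mul0r subr0.
have J0 : J 0 t = pi / 2 * cosh (t * (pi / 2)) / t - sinh (t * (pi / 2)) / t ^+ 2.
  have dF x : 0 <= x <= pi / 2 -> is_derive x 1
      (fun x => x * cosh (t * x) / t - sinh (t * x) / t ^+ 2) (x * sinh (t * x) * cos x ^+ 0).
    by move=> _; derh; rewrite ?expf_neq0//; rewrite expr0; field.
  have := int_on_FTC pi2_gt0 dF (@cJin 0%N t).
  by rewrite mulr0 sinh0 !mul0r !subr0.
have s0 : sinh (t * (pi / 2)) != 0 by rewrite gt_eqF// sinh_gt0// mulr_gt0.
rewrite /q I0 J0; move: (pi / 2) (cosh _) (sinh _) s0 => p c s s0.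
by field; rewrite s0 tn0.
Qed.

Lemma coth_sum K t : 0 < t ->
  pi / 2 * (cosh (t * (pi / 2)) / sinh (t * (pi / 2))) - t^-1 =
  \sum_(k < K) 2 * t / ((2 * k.+1)%:R ^+ 2 + t ^+ 2) + q (2 * K) t.
Proof.
move=> t0; rewrite -q0//; elim: K => [|K ->]; first by rewrite big_ord0 add0r muln0.
by rewrite big_ord_recr /= -addrA; congr (_ + _); rewrite q_rec// addrC mulnS.
Qed.

(** The rate 1 / K comes from [sinh_cos_int_le] with n = 2 K - 2; it makes the sums of partial
    fractions converge. *)
Lemma coth_rem K t : 0 < t -> (0 < K)%N ->
  0 <= q (2 * K) t <= t * (1 + t ^+ 2) / K%:R.
Proof.
case: K => // K t0 _; rewrite mulnS add2n /q.
have I0 := cosh_cos_int_gt0 (2 * K).+2 t.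
rewrite divr_ge0 ?sinh_cos_int_ge0 ?(ltW t0) ?(ltW I0)//=.
have K0 : 0 < (2 * K).+2%:R * (2 * K).+1%:R :> R by rewrite mulr_gt0.
rewrite ler_pdivrMr// -(ler_pM2l K0).
apply: le_trans (sinh_cos_int_le (2 * K) (ltW t0)) _.
have -> : (2 * K).+2%:R * (2 * K).+1%:R * (t * (1 + t ^+ 2) / K.+1%:R * I (2 * K).+2 t) =
    t * ((2 * K).+2%:R * (2 * K).+1%:R * (1 + t ^+ 2) / K.+1%:R) * I (2 * K).+2 t by ring.
rewrite ler_wpM2r ?(ltW I0)// ler_wpM2l ?(ltW t0)// ler_pdivlMr//.
have e1 : (2 * K).+2%:R = 2 * K.+1%:R :> R by rewrite -natrM mulnS.
have e2 : (2 * K).+1%:R = 2 * K.+1%:R - 1 :> R by rewrite -e1 -[(2 * K).+2%:R]natr1 addrK.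
rewrite e1 e2; have : 1 <= K.+1%:R :> R by rewrite ler1n.
move: (K.+1%:R) => k k1; have := sqr_ge0 t; move: (t ^+ 2) => u u0.
have p1 : 0 <= k * (k - 1) by rewrite mulr_ge0; lra.
have p2 : 0 <= u * (k * (4 * k - 3)) by rewrite mulr_ge0// mulr_ge0; lra.
rewrite -subr_ge0; suff -> : 2 * k * (2 * k - 1) * (1 + u) - (2 * k + u) * k =
  2 * (k * (k - 1)) + u * (k * (4 * k - 3)) by apply: addr_ge0 => //; apply: mulr_ge0.
by ring.
Qed.

End PartialFractions.

(** * Binet's function *)

Section Binet.
Context {R : realType}.
Implicit Types (t y : R) (k K : nat).

Definition binet_freq k : R := 2 * pi * k.+1%:R.

Definition binet_term k t : R := 2 / (binet_freq k ^+ 2 + t ^+ 2).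

Definition binet_sum K t : R := \sum_(k < K) binet_term k t.

(* The function of Binet's first formula log Gamma* (z) = laplace binet z. *)
Definition binet t : R := ((expR t - 1)^-1 - t^-1 + 2^-1) / t.

Let c := binet_freq.

Lemma binet_freq_gt0 k : 0 < c k.
Proof. by rewrite mulr_gt0// mulr_gt0// pi_gt0. Qed.

Let d0 k t : 0 < c k ^+ 2 + t ^+ 2.
Proof. by rewrite ltr_pwDl ?exprn_gt0 ?sqr_ge0// binet_freq_gt0. Qed.

Lemma binet_term_gt0 k t : 0 < binet_term k t.
Proof. by rewrite divr_gt0. Qed.

Lemma binet_sum_ge0 K t : 0 <= binet_sum K t.
Proof. by apply: sumr_ge0 => k _; rewrite ltW// binet_term_gt0. Qed.

(** [coth_sum] at t / pi, where the frequencies 2 (k + 1) become 2 pi (k + 1), combined with coth (t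
    / 2) / 2 = 1 / (e^t - 1) + 1 / 2. *)
Lemma binet_sum_approx K t : 0 < t -> (0 < K)%N ->
  0 <= binet t - binet_sum K t <= (1 + t ^+ 2) / K%:R.
Proof.
move=> t0 K0; have p0 := pi_gt0 R.
have tp0 : 0 < t / pi by rewrite divr_gt0.
pose q := sinh_cos_int (2 * K) (t / pi) / cosh_cos_int (2 * K) (t / pi).
have S := coth_sum K tp0; have := coth_rem tp0 K0; rewrite -/q => /andP[q0 q1].
rewrite -/q in S.
have e0 : 1 < expR t by rewrite -expR0 ltr_expR.
have -> : binet t - binet_sum K t = q / (pi * t).
  (* Pure algebra, to be read with p = pi, s = t, e = e^(t / 2), S' the partial sum and r the
     remainder [q]. *)
  have F (p s e r S' : R) : p != 0 -> s != 0 -> e != 0 -> e ^+ 2 - 1 != 0 ->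
      p / 2 * ((e + e^-1) / 2 / ((e - e^-1) / 2)) - (s / p)^-1 = p * s * S' + r ->
      ((e ^+ 2 - 1)^-1 - s^-1 + 2^-1) / s - S' = r / (p * s).
    move=> pn0 sn0 en0 e1 E.
    have -> : r = p / 2 * ((e + e^-1) / 2 / ((e - e^-1) / 2)) - (s / p)^-1 - p * s * S'.
      by rewrite E; ring.
    by field; rewrite pn0 sn0 en0 e1.
  have E2 : expR (t / pi * (pi / 2)) ^+ 2 = expR t.
    have G (p : R) : p != 0 -> t / p * (p / 2) + t / p * (p / 2) = t by move=> pn0; field.
    by rewrite expr2 -expRD G// gt_eqF.
  rewrite /binet -E2; apply: F.
  - by rewrite gt_eqF.
  - by rewrite gt_eqF.
  - by rewrite gt_eqF// expR_gt0.
  - by rewrite E2 gt_eqF// subr_gt0.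
  move: S; rewrite /sinh /cosh expRN => ->; congr (_ + _).
  rewrite /binet_sum mulr_sumr; apply: eq_bigr => k _.
  rewrite /binet_term /binet_freq; have := d0 k t; rewrite /c /binet_freq.
  rewrite natrM; move: (pi : R) p0 => p p0 H.
  have := gt_eqF H; move: (k.+1%:R) => m {}H.
  have H2 : (2 * m) ^+ 2 * p ^+ 2 + t ^+ 2 != 0.
    have E : (2 * p * m) ^+ 2 + t ^+ 2 = (2 * m) ^+ 2 * p ^+ 2 + t ^+ 2 by ring.
    by rewrite -E; exact: negbT H.
  have pn0 : p != 0 by rewrite gt_eqF.
  have -> : (2 * p * m) ^+ 2 + t ^+ 2 = (2 * m) ^+ 2 * p ^+ 2 + t ^+ 2 by ring.
  have -> : (2 * m) ^+ 2 + (t / p) ^+ 2 = ((2 * m) ^+ 2 * p ^+ 2 + t ^+ 2) / p ^+ 2 by field.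
  by move: (_ * p ^+ 2 + _) H2 => u u0; field; rewrite u0 pn0.
rewrite divr_ge0 ?(mulr_ge0 (ltW p0) (ltW t0))//=.
have p2 : 2 <= pi :> R by exact: pi_ge2.
rewrite ler_pdivrMr ?mulr_gt0//; apply: le_trans q1 _.
rewrite [leRHS]mulrAC ler_wpM2r ?invr_ge0//.
have tpt : t / pi <= t by rewrite ler_pdivrMr// ler_peMr ?(ltW t0)//; lra.
have tp2 : (t / pi) ^+ 2 <= t ^+ 2 by rewrite lerXn2r// nnegrE ltW.
have := sqr_ge0 (t / pi); have := sqr_ge0 t; have := ltW tp0; move: tpt tp2 t0.
move: (t / pi) (t ^+ 2) ((t / pi) ^+ 2) => a b d H1 H2 H3 H4 H5 H6.
apply: (@le_trans _ _ (t * (1 + b))); first by rewrite ler_pM//; lra.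
rewrite [leLHS]mulrC ler_wpM2l ?addr_ge0// ler_peMl ?(ltW H3)//; lra.
Qed.

(** e^t - 1 >= t gives t binet t <= 1 / 2, and the partial sums stay below [binet]. Passing to K + 1
    terms covers K = 0, where [binet_sum_approx] says nothing. *)
Lemma binet_sum_le K t : 0 < t -> t * binet_sum K t <= 2^-1.
Proof.
move=> t0; apply: (@le_trans _ _ (t * binet_sum K.+1 t)).
  rewrite ler_wpM2l ?(ltW t0)// /binet_sum big_ord_recr /= lerDl.
  by rewrite ltW// binet_term_gt0.
have /andP[+ _] := binet_sum_approx t0 (ltn0Sn K).
rewrite subr_ge0 => H; apply: le_trans (ler_wpM2l (ltW t0) H) _.
rewrite /binet mulrC divfK ?gt_eqF//.
have e1 : t <= expR t - 1 by have := expR_ge1Dx t; lra.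
have : (expR t - 1)^-1 <= t^-1 by rewrite lef_pV2 ?posrE// (lt_le_trans t0).
lra.
Qed.

Lemma measurable_binet_term k : measurable_fun setT (binet_term k).
Proof. by rewrite /binet_term; meas. Qed.

Lemma measurable_binet_sum K : measurable_fun setT (binet_sum K).
Proof. by rewrite /binet_sum /binet_term; meas. Qed.

Lemma integrable_on_binet_term k : integrable_on hline (binet_term k).
Proof. by apply: integrable_onZ; exact: integrable_on_cauchy (binet_freq_gt0 k). Qed.

Lemma integrable_on_binet_sum K : integrable_on hline (binet_sum K).
Proof. by apply: (@integrable_on_sum _ _ _ binet_term) => k _; exact: integrable_on_binet_term. Qed.

(** Term by term from [cauchy_cos]. As K grows the sum tends to - log (1 - e^(-2 pi y)) / 2, which
    is unbounded near y = 0. *)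
Lemma cos_transform_binet_sum K y : 0 <= y ->
  cos_transform (binet_sum K) y = \sum_(k < K) expR (- (c k * y)) / (2 * k.+1%:R).
Proof.
move=> y0; rewrite /cos_transform /binet_sum.
under eq_fun do rewrite mulr_sumr.
rewrite (@int_on_sum _ _ _ (fun k t => cos (y * t) * binet_term k t)); last first.
  move=> k _; apply: integrable_on_cosM; first exact: measurable_binet_term.
  exact: integrable_on_binet_term.
apply: eq_bigr => k _.
transitivity (2 * (pi / (2 * c k) * expR (- (c k * y)))).
  rewrite -(cauchy_cos (binet_freq_gt0 k) y0) -int_onZ; last first.
    exact: integrable_on_cos_cauchy (binet_freq_gt0 k) y.
  by apply: eq_int_on => t _; rewrite /binet_term; ring.
rewrite /c /binet_freq; move: (expR _) (pi_gt0 R) => e; move: (pi : R) => p /lt0r_neq0 p0.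
have : k.+1%:R != 0 :> R by rewrite pnatr_eq0.
by move: (k.+1%:R) => m m0; field; rewrite m0 p0.
Qed.

Lemma cos_transform_binet_sum_ge K y : 0 <= y ->
  expR (- (c 0 * y)) / 2 <= cos_transform (binet_sum K.+1) y.
Proof.
move=> y0; rewrite cos_transform_binet_sum// big_ord_recl /= mulr1 lerDl.
by apply: sumr_ge0 => k _; rewrite divr_ge0 ?expR_ge0// mulr_ge0.
Qed.

(** A bound growing with K is enough here: it only makes the moments converge for fixed K. The lower
    bound above is the one that is free of K. *)
Lemma cos_transform_binet_sum_le K y : 0 <= y ->
  cos_transform (binet_sum K) y <= K%:R * expR (- (c 0 * y)).
Proof.
move=> y0; rewrite cos_transform_binet_sum//.
have -> : K%:R * expR (- (c 0 * y)) = \sum_(k < K) expR (- (c 0 * y)).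
  by rewrite sumr_const card_ord mulr_natl.
apply: ler_sum => k _; rewrite ler_pdivrMr ?mulr_gt0//.
have k1 : 1 <= 2 * k.+1%:R :> R by rewrite -natrM ler1n.
apply: le_trans (ler_peMr (expR_ge0 _) k1); rewrite ler_expR lerN2 ler_wpM2r//.
by rewrite /c /binet_freq ler_wpM2l ?mulr_ge0 ?pi_ge0// ler_nat.
Qed.

End Binet.

(** * A rational majorant of 1 - cos *)

Section CosineMajorant.
Context {R : realType}.
Implicit Types (u v : R).

Lemma sin_le_id v : 0 <= v -> sin v <= v.
Proof.
move=> v0; rewrite -subr_ge0 -[X in X <= _](_ : 0 - sin 0 = 0); last by rewrite sin0 subrr.
have D (u : R) : is_derive u 1 (fun u : R => u - sin u) (1 - cos u) by der; ring.
by apply: (le_of_derive_ge0 v0 (fun u _ => D u)) => u _; rewrite subr_ge0 cos_le1.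
Qed.

Lemma cos_ge_quadratic v : 0 <= v -> 1 - v ^+ 2 / 2 <= cos v.
Proof.
move=> v0; rewrite -subr_ge0 -[X in X <= _](_ : cos 0 - (1 - 0 ^+ 2 / 2) = 0); last first.
  by rewrite cos0; field.
have D (u : R) : is_derive u 1 (fun u : R => cos u - (1 - u ^+ 2 / 2)) (u - sin u) by der => //=; field.
apply: (le_of_derive_ge0 v0 (fun u _ => D u)) => u /andP[/ltW u0 _].
by rewrite subr_ge0 sin_le_id.
Qed.

(** For u^2 >= 16 / 3 the right side is at least 2. Below that, 1 - cos u = 2 - 2 cos^2 (u / 2) and
    cos v >= 1 - v^2 / 2 leave a polynomial inequality in s = u^2, with difference s ((s - 6)^2 +
    12) / 32. *)
Lemma one_sub_cos_le u : 0 <= u -> 1 - cos u <= 7 / 2 * (u ^+ 2 / (u ^+ 2 + 4)).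
Proof.
move=> u0; have u20 := sqr_ge0 u.
have d0 : 0 < u ^+ 2 + 4 by rewrite ltr_wpDl.
rewrite mulrA ler_pdivlMr//.
have [us|us] := lerP (16 / 3) (u ^+ 2).
  have c1 := cos_geN1 u; nra.
have v0 : 0 <= u / 2 by rewrite divr_ge0.
have cv := cos_ge_quadratic v0.
have e : (u / 2) ^+ 2 = u ^+ 2 / 4 by field.
rewrite e in cv.
have p0 : 0 <= 1 - u ^+ 2 / 4 / 2 by lra.
have cv2 : (1 - u ^+ 2 / 4 / 2) ^+ 2 <= cos (u / 2) ^+ 2 by rewrite lerXn2r// nnegrE (le_trans p0).
have cu : cos u = 2 * cos (u / 2) ^+ 2 - 1.
  have {1}-> : u = u / 2 + u / 2 by field.
  by rewrite cosD -[sin _ * sin _]expr2 sin2cos2; ring.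
rewrite cu; move: (cos (u / 2) ^+ 2) cv2 => C cv2.
move: (u ^+ 2) us u20 d0 p0 cv2 => s us s0 d0 p0 cv2.
apply: (@le_trans _ _ ((2 - 2 * (1 - s / 4 / 2) ^+ 2) * (s + 4))).
  by rewrite ler_wpM2r ?(ltW d0)//; lra.
rewrite -subr_ge0.
have -> : 7 / 2 * s - (2 - 2 * (1 - s / 4 / 2) ^+ 2) * (s + 4) =
   s / 32 * ((s - 6) ^+ 2 + 12) by field.
by rewrite mulr_ge0 ?divr_ge0// addr_ge0 ?sqr_ge0.
Qed.

End CosineMajorant.

(** * Positivity and boundedness of the sine transform *)

Section SineTransform.
Context {R : realType}.
Implicit Types (t y u : R) (k K : nat).
Let c := @binet_freq R.

Let d0 k t : 0 < c k ^+ 2 + t ^+ 2.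
Proof. by rewrite ltr_pwDl ?exprn_gt0 ?sqr_ge0// binet_freq_gt0. Qed.

Let dn0 k t : c k ^+ 2 + t ^+ 2 != 0. Proof. by rewrite gt_eqF. Qed.

(** Minus the derivative of [binet_term k]. *)
Let g k t : R := 4 * t / (c k ^+ 2 + t ^+ 2) ^+ 2.

Let g_ge0 k t : 0 < t -> 0 < g k t.
Proof. by move=> t0; rewrite divr_gt0 ?mulr_gt0// exprn_gt0. Qed.

Let mg k : measurable_fun setT (g k). Proof. by rewrite /g; meas. Qed.

Let ig k : integrable_on hline (g k).
Proof.
have c0 : 0 < c k by exact: binet_freq_gt0.
apply: (integrable_onW _ (integrable_onZ (2 / c k) (integrable_on_cauchy c0))).
  exact: measurable_onT.
move=> t; rewrite in_hline => t0; rewrite gtr0_norm ?g_ge0// /g expr2 invfM.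
rewrite mulrA ler_wpM2r ?invr_ge0 ?(ltW (d0 _ _))// ler_pdivrMr// -mulrAC ler_pdivlMr//.
rewrite -subr_ge0; have -> : 2 * (c k ^+ 2 + t ^+ 2) - 4 * t * c k = 2 * (c k - t) ^+ 2 by ring.
by rewrite mulr_ge0// sqr_ge0.
Qed.

Section ByParts.
Variables (k : nat) (y : R) (P dP : R -> R) (M : R).
Hypothesis y0 : 0 < y.
Hypothesis dPE : forall u, is_derive u 1 P (dP u).
Hypothesis cdP : continuous dP.
Hypothesis P0 : P 0 = 0.
Hypothesis PM : forall u, `|P u| <= M.
Hypothesis dPM : forall u, `|dP u| <= M.

Let cy t : {for t, continuous (fun t => y * t)}. Proof. by der_cont; reflexivity. Qed.

Let mP : measurable_fun setT P.
Proof. by apply: continuous_measurable_fun => u; exact: is_derive_continuous. Qed.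

Let mdP : measurable_fun setT dP.
Proof. exact: continuous_measurable_fun. Qed.

Lemma integrable_on_byparts1 : integrable_on hline (fun t => y * dP (y * t) * binet_term k t).
Proof.
apply: (integrable_onW _ (integrable_onZ (y * M) (integrable_on_binet_term k))).
  by apply: measurable_onT; have mb := @measurable_binet_term R k; meas.
move=> t _; rewrite normrM (gtr0_norm (binet_term_gt0 _ _)) ler_wpM2r//.
  by rewrite ltW// binet_term_gt0.
by rewrite normrM gtr0_norm// ler_wpM2l// ltW.
Qed.

Lemma integrable_on_byparts2 : integrable_on hline (fun t => P (y * t) * g k t).
Proof.
apply: (integrable_onW _ (integrable_onZ M (ig k))).
  by apply: measurable_onT; meas.
by move=> t; rewrite in_hline => t0; rewrite normrM (gtr0_norm (g_ge0 k t0)) ler_wpM2r// ltW// g_ge0.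
Qed.

(** Serves in both directions: with P = 1 - cos it turns y times a sine transform into an integral
    against the positive [g], and with P the rational majorant [W] it undoes that step. *)
Lemma int_on_byparts : int_on hline (fun t => y * dP (y * t) * binet_term k t) =
  int_on hline (fun t => P (y * t) * g k t).
Proof.
pose f t := y * dP (y * t) * binet_term k t - P (y * t) * g k t.
have dPy t : is_derive t 1 (fun t => P (y * t)) (dP (y * t) * y).
  have dy : is_derive t 1 (fun t => y * t) y by der; ring.
  exact: (is_derive_fcomp (dPE (y * t)) dy).
have dF t : is_derive t 1 (fun t => P (y * t) * binet_term k t) (f t).
  rewrite /f /g /binet_term; der; [exact: dPy|exact: dn0|].
  by rewrite /c /=; field; exact: dn0.
have cf t : 0 < t -> {for t, continuous f}.
  move=> _; have c1 : {for t, continuous (fun t => P (y * t))} by exact: is_derive_continuous (dPy t).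
  have c2 : {for t, continuous (fun t => y * dP (y * t))}.
    have c0 : {for t, continuous (fun _ : R => y)} by exact: cst_continuous.
    have c1' : {for t, continuous (dP \o (fun t => y * t))}.
      by apply: continuous_comp; [exact: cy|exact: cdP].
    exact: cvgM c0 c1'.
  have c3 : {for t, continuous (binet_term k)}.
    by rewrite /binet_term; der_cont; [exact: dn0|reflexivity].
  have c4 : {for t, continuous (g k)}.
    by rewrite /g; der_cont; [rewrite expf_neq0 ?dn0|reflexivity].
  exact: cvgB (cvgM c2 c3) (cvgM c1 c4).
have fi : integrable_on hline f.
  by apply: integrable_onB; [exact: integrable_on_byparts1|exact: integrable_on_byparts2].
have := half_line_FTC (fun t _ => dF t) cf _ _ fi.
rewrite int_onB; [|exact: integrable_on_byparts1|exact: integrable_on_byparts2].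
move=> /(_ 0 0); rewrite subrr => E; apply/eqP; rewrite -subr_eq0; apply/eqP; apply: E.
  apply: (@cvg_pinfty_le _ _ _ (M * 2)) => t t1; have t0 : 0 < t by apply: lt_le_trans t1.
  rewrite subr0 normrM (gtr0_norm (binet_term_gt0 _ _)) -mulrA ler_pM// ?(ltW (binet_term_gt0 _ _))//.
  rewrite /binet_term ler_wpM2l// lef_pV2 ?posrE// -[leLHS]mulr1.
  apply: (@le_trans _ _ (t ^+ 2)); first by rewrite expr2 ler_wpM2l// ltW.
  by rewrite lerDr sqr_ge0.
by apply: (cvg_at_right_is_derive (dF 0)); rewrite mulr0 P0 mul0r.
Qed.

End ByParts.

Let P1 u : R := 1 - cos u.

Let dP1 u : is_derive u 1 P1 (sin u). Proof. by rewrite /P1; der; ring. Qed.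

Let P1_le u : `|P1 u| <= 4.
Proof.
have := cos_le1 u; have := cos_geN1 u; rewrite /P1 ler_norml => *; apply/andP; split; lra.
Qed.

Let sin_le4 u : `|sin u| <= 4.
Proof.
have := sin_le1 u; have := sin_geN1 u; rewrite ler_norml => *; apply/andP; split; lra.
Qed.

Let P10 : P1 0 = 0. Proof. by rewrite /P1 cos0 subrr. Qed.

Let csin : continuous (@sin R). Proof. exact: continuous_sin. Qed.

Let sin_transform_term k y : 0 < y ->
  y * sin_transform (binet_term k) y = int_on hline (fun t => P1 (y * t) * g k t).
Proof.
move=> y0; rewrite -(int_on_byparts (M := 4) k y0 dP1 csin P10 P1_le sin_le4).
rewrite -int_onZ; first by apply: eq_int_on => t _; ring.
by apply: integrable_on_sinM; [exact: measurable_binet_term|exact: integrable_on_binet_term].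
Qed.

Let iP1 k y : 0 < y -> integrable_on hline (fun t => P1 (y * t) * g k t).
Proof. by move=> y0; exact: (integrable_on_byparts2 (M := 4) k y dP1 P1_le). Qed.

(** After integration by parts the integrand is (1 - cos (y t)) [g k t], nonnegative everywhere and
    positive for t below pi / y. *)
Lemma sin_transform_binet_term_gt0 k y : 0 < y -> 0 < sin_transform (binet_term k) y.
Proof.
move=> y0; rewrite -(pmulr_rgt0 _ y0) sin_transform_term//.
have p0 : 0 < pi / y :> R by rewrite divr_gt0// pi_gt0.
apply: (@int_on_gt0 _ _ `]0, (pi / y)[).
- by rewrite /= lebesgue_measure_itv /= lte_fin p0 -EFinB eqe subr0 gt_eqF.
- by move=> t; rewrite in_hline in_itv /= => /andP[].
- exact: iP1.
- move=> t; rewrite in_hline => t0; rewrite mulr_ge0 ?(ltW (g_ge0 k t0))//.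
  by rewrite subr_ge0 cos_le1.
move=> t; rewrite in_itv /= => /andP[t0 tp]; rewrite mulr_gt0 ?g_ge0//.
have yt : 0 < y * t by rewrite mulr_gt0.
have ytp : y * t < pi by rewrite mulrC -ltr_pdivlMr.
rewrite subr_gt0 -(@cos0 R) ltr_cos// in_itv /=; first by rewrite lexx pi_ge0.
by rewrite !ltW.
Qed.

Let W u : R := 7 / 2 * (u ^+ 2 / (u ^+ 2 + 4)).
Let dW u : R := 28 * u / (u ^+ 2 + 4) ^+ 2.

Let w0 u : 0 < u ^+ 2 + 4. Proof. by rewrite ltr_wpDl ?sqr_ge0. Qed.

Let wn0 u : u ^+ 2 + 4 != 0. Proof. by rewrite gt_eqF. Qed.

Let dWE u : is_derive u 1 W (dW u).
Proof. by rewrite /W /dW; der; [exact: wn0|field; exact: wn0]. Qed.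

Let cdW : continuous dW.
Proof.
by move=> u; rewrite /dW; der_cont; [rewrite expf_neq0 ?wn0|reflexivity].
Qed.

Let W0 : W 0 = 0. Proof. by rewrite /W expr0n mul0r mulr0. Qed.

Let W_le u : `|W u| <= 4.
Proof.
rewrite ger0_norm; last by rewrite mulr_ge0// divr_ge0 ?sqr_ge0// ltW.
rewrite /W mulrA ler_pdivrMr//; have := sqr_ge0 u; lra.
Qed.

Let dW_le u : `|dW u| <= 4.
Proof.
rewrite normrM normfV [X in _ / X]gtr0_norm ?exprn_gt0// ler_pdivrMr ?exprn_gt0//.
rewrite normrM ger0_norm// -(real_normK (num_real u)).
have := normr_ge0 u; move: (`|u|) => v v0.
have h : 4 * v <= v ^+ 2 + 4 by rewrite -subr_ge0; have := sqr_ge0 (v - 2); rewrite sqrrB; lra.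
have h4 : 4 <= v ^+ 2 + 4 by rewrite lerDr sqr_ge0.
have h2 : 4 * v * 4 <= (v ^+ 2 + 4) ^+ 2 by rewrite expr2 ler_pM// mulr_ge0.
by lra.
Qed.

Lemma sin_transform_binet_sum K y :
  sin_transform (binet_sum K) y = \sum_(k < K) sin_transform (binet_term k) y.
Proof.
rewrite /sin_transform /binet_sum.
under eq_int_on do rewrite mulr_sumr.
rewrite (@int_on_sum _ _ _ (fun k t => sin (y * t) * binet_term k t))// => k _.
by apply: integrable_on_sinM; [exact: measurable_binet_term|exact: integrable_on_binet_term].
Qed.

Lemma sin_transform_binet_sum_ge K y : 0 < y ->
  sin_transform (binet_term 0) y <= sin_transform (binet_sum K.+1) y.
Proof.
move=> y0; rewrite sin_transform_binet_sum big_ord_recl /= lerDl.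
by apply: sumr_ge0 => k _; rewrite ltW// sin_transform_binet_term_gt0.
Qed.

(** The sine changes sign, so the comparison is made after integrating by parts, where 1 - cos <= W
    meets a positive weight; then the integration by parts is reversed. Now t binet_sum <= 1 / 2
    leaves y times half the integral of dW u / u = 28 / (u^2 + 4)^2, which is 7 pi / 16. *)
Lemma sin_transform_binet_sum_le K y : 0 < y ->
  sin_transform (binet_sum K) y <= 7 / 16 * pi.
Proof.
move=> y0; rewrite -(ler_pM2l y0).
apply: (@le_trans _ _ (int_on hline (fun t => y * dW (y * t) * binet_sum K t))).
  rewrite sin_transform_binet_sum mulr_sumr.
  rewrite (_ : int_on _ _ = \sum_(k < K) int_on hline (fun t => y * dW (y * t) * binet_term k t)).
    apply: ler_sum => k _; rewrite sin_transform_term//.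
    rewrite (int_on_byparts (M := 4) k y0 dWE cdW W0 W_le dW_le).
    apply: le_int_on; first exact: iP1.
      exact: (integrable_on_byparts2 (M := 4) k y dWE W_le).
    move=> t; rewrite in_hline => t0; rewrite ler_wpM2r ?(ltW (g_ge0 k t0))//.
    by apply: one_sub_cos_le; rewrite mulr_ge0// ltW.
  rewrite -(@int_on_sum _ _ _ (fun k t => y * dW (y * t) * binet_term k t)).
    by apply: eq_int_on => t _; rewrite /binet_sum mulr_sumr.
  by move=> k _; exact: (integrable_on_byparts1 (M := 4) k y0 cdW dW_le).
(* Antiderivative of [h], built on that of 1 / (u^2 + 4)^2, namely u / (8 (u^2 + 4)) + atan (u / 2)
   / 16. *)
pose G t := y * (14 * (y * t / (8 * ((y * t) ^+ 2 + 4)) + atan (y * t / 2) / 16)).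
pose h t := 14 * y ^+ 2 / ((y * t) ^+ 2 + 4) ^+ 2.
have Gy : G t @[t --> +oo] --> y * (7 / 16 * pi).
  have -> : y * (7 / 16 * pi) = y * (14 * (0 + pi / 2 / 16)) :> R by field.
  apply: cvgMr; apply: cvgMr; apply: cvgD.
    apply: (@cvg_pinfty_le _ _ _ y^-1) => t t1; have t0 : 0 < t by apply: lt_le_trans t1.
    have yt : 0 < y * t by rewrite mulr_gt0.
    rewrite subr0 gtr0_norm ?divr_gt0 ?mulr_gt0// ler_pdivrMr ?mulr_gt0//.
    rewrite -invfM [leRHS]mulrC ler_pdivlMr//.
    by have := sqr_ge0 (y * t); move: (y * t) yt => u u0; rewrite expr2; nra.
  apply: cvgMl; apply: (cvg_comp (fun t => y * t / 2) (@atan R) _ (@cvgy_atan R)).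
  apply/cvgryPge => A.
  apply: filterS (nbhs_pinfty_ge (num_real (A * 2 / y))) => t.
  by rewrite ler_pdivrMr// -ler_pdivlMr// [t * _]mulrC.
have dG t : is_derive t 1 G (h t).
  rewrite /G /h; der; first by rewrite mulf_neq0.
  have w := wn0 (y * t).
  have -> : 1 + (y * t / 2) ^+ 2 = ((y * t) ^+ 2 + 4) / 4 by field.
  by field; exact: w.
have ch t : 0 < t -> {for t, continuous h}.
  by move=> _; rewrite /h; der_cont; [rewrite expf_neq0 ?wn0|reflexivity].
have G0 : G t @[t --> 0^'+] --> 0.
  by apply: (cvg_at_right_is_derive (dG 0)); rewrite /G mulr0 !mul0r atan0; ring.
have h0 t : 0 < t -> 0 <= h t.
  by move=> _; rewrite divr_ge0 ?exprn_ge0 ?(ltW (w0 _))// mulr_ge0 ?sqr_ge0.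
have [ih hE] := half_line_FTC_ge0 (fun t _ => dG t) ch Gy G0 h0.
rewrite subr0 in hE; rewrite -hE.
apply: le_int_on => //.
  apply: (@eq_integrable_on _ _ (fun t => \sum_(k < K) y * dW (y * t) * binet_term k t)).
    by move=> t _; rewrite /binet_sum mulr_sumr.
  apply: (@integrable_on_sum _ _ _ (fun k t => y * dW (y * t) * binet_term k t)) => k _.
  exact: (integrable_on_byparts1 (M := 4) k y0 cdW dW_le).
move=> t; rewrite in_hline => t0.
have -> : y * dW (y * t) * binet_sum K t = (2 * h t) * (t * binet_sum K t).
  by rewrite /dW /h; field; exact: wn0.
apply: (@le_trans _ _ (2 * h t * 2^-1)).
  by rewrite ler_wpM2l ?binet_sum_le// mulr_ge0// h0.
by rewrite mulrAC divff// mul1r.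
Qed.

End SineTransform.

(** * Enveloping expansions *)

Section StieltjesExpansion.
Context {R : realType}.
Variables (w : R -> R) (C a : R).
Hypotheses (a0 : 0 < a) (mw : measurable_fun setT w).
Hypothesis w_le : forall y, 0 < y -> `|w y| <= C * expR (- (a * y)).

Lemma integrable_on_moment n : integrable_on hline (fun y => y ^+ n * w y).
Proof.
apply: (integrable_onW _ (integrable_onZ C (integrable_on_exprn_expRN n a0))).
  by apply: measurable_onT; meas.
move=> y; rewrite in_hline => y0; rewrite normrM normrX (gtr0_norm y0).
by rewrite mulrCA ler_wpM2l ?exprn_ge0 ?(ltW y0)// w_le.
Qed.

Variable x : R.
Hypothesis x0 : 0 < x.

Let d0 y : 0 < x ^+ 2 + y ^+ 2. Proof. by rewrite ltr_pwDl ?exprn_gt0 ?sqr_ge0. Qed.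

Lemma integrable_on_stieltjes n : integrable_on hline (fun y => y ^+ n * w y / (x ^+ 2 + y ^+ 2)).
Proof.
apply: (integrable_onW _ (integrable_onZ (x ^+ 2)^-1 (integrable_on_norm (integrable_on_moment n)))).
  by apply: measurable_onT; meas.
move=> y _; rewrite normrM mulrC ler_wpM2r// gtr0_norm ?invr_gt0//.
by rewrite lef_pV2 ?posrE ?exprn_gt0// lerDl sqr_ge0.
Qed.

(** One step of a geometric expansion, 1 / (x^2 + y^2) = (1 - y^2 / (x^2 + y^2)) / x^2: the
    remainder changes sign and its exponent rises by 2. *)
Lemma stieltjes_step n : int_on hline (fun y => y ^+ n * w y / (x ^+ 2 + y ^+ 2)) =
  (int_on hline (fun y => y ^+ n * w y) -
   int_on hline (fun y => y ^+ n.+2 * w y / (x ^+ 2 + y ^+ 2))) / x ^+ 2.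
Proof.
rewrite -int_onB; [|exact: integrable_on_moment|exact: integrable_on_stieltjes].
rewrite mulrC -int_onZ; last first.
  by apply: integrable_onB; [exact: integrable_on_moment|exact: integrable_on_stieltjes].
apply: eq_int_on => y _; rewrite [y ^+ n.+2]exprS [y ^+ n.+1]exprS; field.
by rewrite !gt_eqF.
Qed.

End StieltjesExpansion.

(** * Remainders with strict signs, uniformly in the truncation *)

Section Envelopes.
Context {R : realType}.
Implicit Types (x y : R) (K n N : nat).

(** With K + 1 terms the lowest frequency is always present; every lower bound that has to survive
    the limit comes from it. *)
Let A K := cos_transform (@binet_sum R K.+1).
Let B K := sin_transform (@binet_sum R K.+1).
Let a : R := binet_freq 0.

Let mb K : measurable_fun setT (@binet_sum R K). Proof. exact: measurable_binet_sum. Qed.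
Let ib K : integrable_on hline (@binet_sum R K). Proof. exact: integrable_on_binet_sum. Qed.

Definition sinh_weight K y : R := sinh (A K y) * cos (B K y).
Definition cosh_weight K y : R := sinh (A K y) * sin (B K y).

Let mA K : measurable_fun setT (A K). Proof. exact: measurable_cos_transform. Qed.
Let mB K : measurable_fun setT (B K). Proof. exact: measurable_sin_transform. Qed.

Let msinhA K : measurable_fun setT (fun y => sinh (A K y)).
Proof. by apply: measurable_fcomp; [exact: measurable_sinh|]. Qed.

Let mw K : measurable_fun setT (sinh_weight K).
Proof. by rewrite /sinh_weight; apply: measurable_funM => //; meas. Qed.

Let mv K : measurable_fun setT (cosh_weight K).
Proof. by rewrite /cosh_weight; apply: measurable_funM => //; meas. Qed.

Let a0 : 0 < a. Proof. exact: binet_freq_gt0. Qed.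

Let sinhA_ge K y : 0 < y -> expR (- (a * y)) / 2 <= sinh (A K y).
Proof.
move=> y0; have H := cos_transform_binet_sum_ge K (ltW y0).
apply: le_trans (H) (sinh_ge _); apply: le_trans H.
by rewrite divr_ge0// expR_ge0.
Qed.

Let C K : R := K.+1%:R * cosh K.+1%:R.

Let sinhA_le K y : 0 < y -> sinh (A K y) <= C K * expR (- (a * y)).
Proof.
move=> y0; have H1 := cos_transform_binet_sum_le K.+1 (ltW y0).
have A0 : 0 <= A K y.
  apply: le_trans (cos_transform_binet_sum_ge K (ltW y0)).
  by rewrite divr_ge0// expR_ge0.
have H2 : A K y <= K.+1%:R.
  apply: le_trans H1 _; rewrite ler_piMr// -expR0 ler_expR oppr_le0.
  by rewrite mulr_ge0// ltW// binet_freq_gt0.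
have cH : cosh (A K y) <= cosh K.+1%:R.
  have D (u : R) : is_derive u 1 (@cosh R) (sinh u).
    have := @is_derive_fcosh R (fun x => x) u 1 (is_derive_fid u).
    by rewrite mulr1.
  apply: (le_of_derive_ge0 H2 (fun u _ => D u)) => u /andP[/ltW uA _].
  by rewrite sinh_ge0// (le_trans A0).
apply: le_trans (sinh_le A0) _.
rewrite /C mulrAC ler_pM// ?(ltW (cosh_gt0 _))//.
Qed.

Let B_bounds K y : 0 < y -> 0 < B K y <= 7 / 16 * pi.
Proof.
move=> y0; rewrite sin_transform_binet_sum_le// andbT.
exact: lt_le_trans (sin_transform_binet_term_gt0 0 y0) (sin_transform_binet_sum_ge K y0).
Qed.

Let kappa : R := cos (7 / 16 * pi).

Let p0 : 0 < pi :> R. Proof. exact: pi_gt0. Qed.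

Let kappa_gt0 : 0 < kappa.
Proof. by apply: cos_gt0_pihalf; move: (pi : R) p0 => p pp; apply/andP; split; lra. Qed.

Let cosB_ge K y : 0 < y -> kappa <= cos (B K y).
Proof.
move=> y0; have /andP[B0 B1] := B_bounds K y0.
have D1 : B K y \in `[0, pi].
  by rewrite in_itv /= (ltW B0)/= (le_trans B1)//; move: (pi : R) p0 => p pp; lra.
have D2 : 7 / 16 * pi \in `[0 : R, pi].
  by rewrite in_itv /=; move: (pi : R) p0 => p pp; apply/andP; split; lra.
by rewrite /kappa leNgt (ltr_cos D2 D1) -leNgt.
Qed.

Let b1 y : R := sin (sin_transform (binet_term 0) y).

Let b1_gt0 y : 0 < y -> 0 < b1 y.
Proof.
move=> y0; have b0 := sin_transform_binet_term_gt0 0 y0.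
apply: sin_gt0_pi; rewrite b0 /=.
have := sin_transform_binet_sum_ge 0 y0; have := sin_transform_binet_sum_le 1 y0.
by move: (pi : R) p0 (sin_transform _ _) (sin_transform _ _) => p pp u v; lra.
Qed.

Let sinB_ge K y : 0 < y -> b1 y <= sin (B K y).
Proof.
move=> y0; have b0 := sin_transform_binet_term_gt0 0 y0.
have bB := sin_transform_binet_sum_ge K y0; have /andP[B0 B1] := B_bounds K y0.
have D1 : B K y \in `[- (pi / 2), pi / 2].
  rewrite in_itv /=; move: B0 B1; rewrite /B; move: (pi : R) p0 (sin_transform _ _) => p pp u ? ?.
  by apply/andP; split; lra.
have D2 : sin_transform (binet_term 0) y \in `[- (pi / 2), pi / 2].
  rewrite in_itv /=; move: B1 b0 bB; rewrite /B; move: (pi : R) p0 => p pp.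
  by move: (sin_transform _ _) (sin_transform _ _) => u v ? ? ?; apply/andP; split; lra.
by rewrite /b1 leNgt (ltr_sin D1 D2) -leNgt.
Qed.

Let sinhA_gt0 K y : 0 < y -> 0 < sinh (A K y).
Proof. by move=> y0; apply: lt_le_trans (sinhA_ge K y0); rewrite divr_gt0// expR_gt0. Qed.

Let w_le K y : 0 < y -> `|sinh_weight K y| <= C K * expR (- (a * y)).
Proof.
move=> y0; apply: le_trans (sinhA_le K y0); rewrite normrM gtr0_norm ?sinhA_gt0//.
by rewrite ler_piMr ?(ltW (sinhA_gt0 K y0))// ler_norml cos_geN1 cos_le1.
Qed.

Let v_le K y : 0 < y -> `|cosh_weight K y| <= C K * expR (- (a * y)).
Proof.
move=> y0; apply: le_trans (sinhA_le K y0); rewrite normrM gtr0_norm ?sinhA_gt0//.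
by rewrite ler_piMr ?(ltW (sinhA_gt0 K y0))// ler_norml sin_geN1 sin_le1.
Qed.

(** Minorants of the weights that do not involve K: sinh A >= A and A is at least its first term;
    cos B is at least its value at 7 pi / 16; sin B is at least its value at the sine transform of
    the first term, since B stays below pi / 2. *)
Let w1 y : R := kappa * (expR (- (a * y)) / 2).
Let v1 y : R := b1 y * (expR (- (a * y)) / 2).

Let w_ge K y : 0 < y -> 0 < w1 y <= sinh_weight K y.
Proof.
move=> y0; rewrite mulr_gt0 ?divr_gt0 ?expR_gt0//= /w1 /sinh_weight mulrC.
by rewrite ler_pM ?divr_ge0 ?expR_ge0 ?(ltW kappa_gt0) ?sinhA_ge ?cosB_ge.
Qed.

Let v_ge K y : 0 < y -> 0 < v1 y <= cosh_weight K y.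
Proof.
move=> y0; rewrite mulr_gt0 ?divr_gt0 ?expR_gt0 ?b1_gt0//= /v1 /cosh_weight mulrC.
by rewrite ler_pM ?divr_ge0 ?expR_ge0 ?(ltW (b1_gt0 _)) ?sinhA_ge ?sinB_ge.
Qed.

Definition sinh_moment K n : R := 2 / pi * int_on hline (fun y => y ^+ (2 * n) * sinh_weight K y).
Definition cosh_moment K n : R := 2 / pi * int_on hline (fun y => y ^+ (2 * n).+1 * cosh_weight K y).

Let mu K x := laplace (@binet_sum R K.+1) x.

Definition sinh_rem K N x :=
  sinh (mu K x) - \sum_(n < N) (-1) ^+ n * (sinh_moment K n / x ^+ (2 * n).+1).
Definition cosh_rem K N x :=
  cosh (mu K x) - 1 - \sum_(n < N) (-1) ^+ n * (cosh_moment K n / x ^+ (2 * n).+2).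

Lemma signMK N (q : R) : (-1) ^+ N * ((-1) ^+ N * q) = q.
Proof. by rewrite mulrA -expr2 sqrr_sign mul1r. Qed.

(** [stieltjes_step] is iterated: after N steps there remains an integral of the same positive
    weight, so the sign is known. *)
Let sinh_remE K N x : 0 < x -> (-1) ^+ N * sinh_rem K N x =
  2 * x / pi / x ^+ (2 * N) *
    int_on hline (fun y => y ^+ (2 * N) * sinh_weight K y / (x ^+ 2 + y ^+ 2)).
Proof.
move=> x0; elim: N => [|N IHN].
  rewrite /sinh_rem big_ord0 !expr0 mul1r subr0 divr1 /mu sinh_laplace//.
  by congr (_ * _); apply: eq_int_on => y _; rewrite muln0 expr0 mul1r.
have S : sinh_rem K N.+1 x = sinh_rem K N x - (-1) ^+ N * (sinh_moment K N / x ^+ (2 * N).+1).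
  by rewrite /sinh_rem big_ord_recr /= opprD addrA.
rewrite S mulrBr exprS !mulN1r !mulNr IHN opprK.
rewrite (stieltjes_step a0 (@mw K) (@w_le K) x0) signMK /sinh_moment.
have -> : (2 * N.+1)%N = (2 * N).+2 by rewrite mulnS.
rewrite !exprS; have xn : x ^+ (2 * N) != 0 by rewrite expf_neq0// gt_eqF.
have xn0 : x != 0 by rewrite gt_eqF.
move: (lt0r_neq0 p0) (int_on _ _) (int_on _ _) (x ^+ _) xn; move: (pi : R) => p pn0 u v q qn.
by field; rewrite qn xn0 pn0.
Qed.

Let cosh_remE K N x : 0 < x -> (-1) ^+ N * cosh_rem K N x =
  2 / pi / x ^+ (2 * N) *
    int_on hline (fun y => y ^+ (2 * N).+1 * cosh_weight K y / (x ^+ 2 + y ^+ 2)).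
Proof.
move=> x0; elim: N => [|N IHN].
  rewrite /cosh_rem big_ord0 muln0 !expr0 mul1r subr0 divr1 /mu cosh_laplace//.
  have := @integrable_on_stieltjes _ _ _ _ a0 (@mv K) (@v_le K) x x0 1.
  by apply: eq_integrable_on => y _; rewrite expr1.
have S : cosh_rem K N.+1 x = cosh_rem K N x - (-1) ^+ N * (cosh_moment K N / x ^+ (2 * N).+2).
  by rewrite /cosh_rem big_ord_recr /= opprD addrA.
rewrite S mulrBr exprS !mulN1r !mulNr IHN opprK.
rewrite (stieltjes_step a0 (@mv K) (@v_le K) x0) signMK /cosh_moment.
have -> : (2 * N.+1)%N = (2 * N).+2 by rewrite mulnS.
rewrite [x ^+ (2 * N).+2]exprS [x ^+ (2 * N).+1]exprS.
have xn : x ^+ (2 * N) != 0 by rewrite expf_neq0// gt_eqF.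
have xn0 : x != 0 by rewrite gt_eqF.
move: (lt0r_neq0 p0) (int_on _ _) (int_on _ _) (x ^+ _) xn; move: (pi : R) => p pn0 u v q qn.
by field; rewrite qn xn0 pn0.
Qed.

Let int_gt0_unif (w : nat -> R -> R) (l : R -> R) x n : 0 < x ->
  (forall K, measurable_fun setT (w K)) -> measurable_fun setT l ->
  (forall K y, 0 < y -> `|w K y| <= C K * expR (- (a * y))) ->
  (forall K y, 0 < y -> 0 < l y <= w K y) ->
  exists2 L : R, 0 < L & forall K, L <= int_on hline (fun y => y ^+ n * w K y / (x ^+ 2 + y ^+ 2)).
Proof.
move=> x0 mw' ml wle wge.
have d0 y : 0 < x ^+ 2 + y ^+ 2 by rewrite ltr_pwDl ?exprn_gt0 ?sqr_ge0.
have iw K := @integrable_on_stieltjes _ _ _ _ a0 (mw' K) (wle K) x x0 n.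
have le_w K y : 0 < y -> y ^+ n * l y / (x ^+ 2 + y ^+ 2) <= y ^+ n * w K y / (x ^+ 2 + y ^+ 2).
  move=> y0; rewrite ler_wpM2r ?invr_ge0 ?(ltW (d0 _))// ler_wpM2l ?exprn_ge0 ?(ltW y0)//.
  by have /andP[] := wge K y y0.
have l_gt0 y : 0 < y -> 0 < y ^+ n * l y / (x ^+ 2 + y ^+ 2).
  by move=> y0; rewrite divr_gt0// mulr_gt0 ?exprn_gt0//; have /andP[] := wge 0%N y y0.
have il : integrable_on hline (fun y => y ^+ n * l y / (x ^+ 2 + y ^+ 2)).
  apply: (integrable_onW _ (iw 0%N)); first by apply: measurable_onT; meas.
  by move=> y; rewrite in_hline => y0; rewrite gtr0_norm ?l_gt0// le_w.
exists (int_on hline (fun y => y ^+ n * l y / (x ^+ 2 + y ^+ 2))).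
  apply: (@int_on_gt0 _ _ hline) => //; first exact: hline_measure_neq0.
    by move=> y; rewrite in_hline => y0; rewrite ltW// l_gt0.
  by move=> y; rewrite in_hline => y0; exact: l_gt0.
by move=> K; apply: le_int_on => // y; rewrite in_hline; exact: le_w.
Qed.

(** [L] is chosen before [K]: bare positivity for each K would become a weak inequality in the
    limit. *)
Lemma sinh_rem_gt0 N x : 0 < x ->
  exists2 L : R, 0 < L & forall K, L <= (-1) ^+ N * sinh_rem K N x.
Proof.
move=> x0.
have mw1 : measurable_fun setT w1 by rewrite /w1; meas.
have [L L0 LK] := int_gt0_unif (2 * N) x0 mw mw1 w_le w_ge.
have c0 : 0 < 2 * x / pi / x ^+ (2 * N).
  by rewrite !divr_gt0 ?mulr_gt0 ?exprn_gt0.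
exists (2 * x / pi / x ^+ (2 * N) * L); first by rewrite mulr_gt0.
by move=> K; rewrite sinh_remE// ler_pM2l.
Qed.

Lemma cosh_rem_gt0 N x : 0 < x ->
  exists2 L : R, 0 < L & forall K, L <= (-1) ^+ N * cosh_rem K N x.
Proof.
move=> x0.
have mv1 : measurable_fun setT v1.
  rewrite /v1 /b1; have mt : measurable_fun setT (sin_transform (@binet_term R 0)).
    by apply: measurable_sin_transform; [exact: measurable_binet_term|exact: integrable_on_binet_term].
  by meas.
have [L L0 LK] := int_gt0_unif (2 * N).+1 x0 mv mv1 v_le v_ge.
have c0 : 0 < 2 / pi / x ^+ (2 * N) by rewrite !divr_gt0 ?exprn_gt0.
exists (2 / pi / x ^+ (2 * N) * L); first by rewrite mulr_gt0.
by move=> K; rewrite cosh_remE// ler_pM2l.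
Qed.

(** The signed remainders N and N + 1 are positive and add up to the term of index N. The resulting
    error of order x^-(2 N + 1) is what identifies the moments as asymptotic coefficients. *)
Lemma sinh_rem_le K N x : 0 < x -> `|sinh_rem K N x| <= sinh_moment K N / x ^+ (2 * N).+1.
Proof.
move=> x0.
have [L L0 LK] := sinh_rem_gt0 N x0; have [L' L'0 L'K] := sinh_rem_gt0 N.+1 x0.
have h1 := le_trans (ltW L0) (LK K); have h2 := le_trans (ltW L'0) (L'K K).
have -> : `|sinh_rem K N x| = (-1) ^+ N * sinh_rem K N x.
  by rewrite -(ger0_norm h1) normrM normrX normrN1 expr1n mul1r.
rewrite -subr_ge0; suff <- : (-1) ^+ N.+1 * sinh_rem K N.+1 x =
  sinh_moment K N / x ^+ (2 * N).+1 - (-1) ^+ N * sinh_rem K N x by [].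
rewrite -[X in _ = X - _](signMK N) /sinh_rem big_ord_recr /= exprS.
by ring.
Qed.

Lemma cosh_rem_le K N x : 0 < x -> `|cosh_rem K N x| <= cosh_moment K N / x ^+ (2 * N).+2.
Proof.
move=> x0.
have [L L0 LK] := cosh_rem_gt0 N x0; have [L' L'0 L'K] := cosh_rem_gt0 N.+1 x0.
have h1 := le_trans (ltW L0) (LK K); have h2 := le_trans (ltW L'0) (L'K K).
have -> : `|cosh_rem K N x| = (-1) ^+ N * cosh_rem K N x.
  by rewrite -(ger0_norm h1) normrM normrX normrN1 expr1n mul1r.
rewrite -subr_ge0; suff <- : (-1) ^+ N.+1 * cosh_rem K N.+1 x =
  cosh_moment K N / x ^+ (2 * N).+2 - (-1) ^+ N * cosh_rem K N x by [].
rewrite -[X in _ = X - _](signMK N) /cosh_rem big_ord_recr /= exprS.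
by ring.
Qed.

End Envelopes.

(** * The Laplace transform of Binet's function *)

Section BinetLaplace.
Context {R : realType}.
Implicit Types (t x : R) (K : nat).

Let mu x := laplace (@binet R) x.

Lemma measurable_binet : measurable_fun setT (@binet R).
Proof. by rewrite /binet; meas. Qed.

(** Read off from the approximation by a single term; polynomial growth is harmless under a Laplace
    transform. *)
Lemma binet_bounds t : 0 < t -> 0 <= binet t <= 3 + t ^+ 2.
Proof.
move=> t0; have /andP[h1 h2] := @binet_sum_approx R 1 t t0 isT.
have s0 := @binet_sum_ge0 R 1 t.
have s2 : binet_sum 1 t <= 2.
  rewrite /binet_sum big_ord1 /binet_term ler_pdivrMr; last first.
    by rewrite ltr_pwDl ?exprn_gt0 ?sqr_ge0// binet_freq_gt0.
  rewrite ler_peMr// -[leLHS]addr0 lerD ?sqr_ge0// exprn_ege1// /binet_freq mulr1.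
  have p2 : 2 <= pi :> R by exact: pi_ge2.
  by move: (pi : R) p2 => p; lra.
by move: h1 h2 s0 s2; rewrite divr1; move: (binet _) (binet_sum _ _) (t ^+ 2) => a b c; lra.
Qed.

Lemma integrable_on_sqr1 (c x : R) : 0 < x -> integrable_on hline (fun t => (c + t ^+ 2) * expR (- (x * t))).
Proof.
move=> x0; apply: (@eq_integrable_on _ _ (fun t => c * (t ^+ 0 * expR (- (x * t))) + t ^+ 2 * expR (- (x * t)))).
  by move=> t _; ring.
by apply: integrable_onD; [apply: integrable_onZ|]; exact: integrable_on_exprn_expRN.
Qed.

Lemma int_on_sqr1 (c x : R) : 0 < x ->
  int_on hline (fun t => (c + t ^+ 2) * expR (- (x * t))) = c / x + 2 / x ^+ 3.
Proof.
move=> x0; transitivity (int_on hline (fun t => c * (t ^+ 0 * expR (- (x * t))) + t ^+ 2 * expR (- (x * t)))).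
  by apply: eq_int_on => t _; ring.
rewrite int_onD; [|apply: integrable_onZ|]; try exact: integrable_on_exprn_expRN.
rewrite int_onZ; last exact: integrable_on_exprn_expRN.
by rewrite !int_on_exprn_expRN// fact0 expr1 mul1r.
Qed.

Lemma integrable_on_laplace_binet x : 0 < x ->
  integrable_on hline (fun t => expR (- (x * t)) * binet t).
Proof.
move=> x0; apply: (integrable_onW _ (integrable_on_sqr1 3 x0)).
  by apply: measurable_onT; have mb := measurable_binet; meas.
move=> t; rewrite in_hline => t0; have /andP[b0 b1] := binet_bounds t0.
by rewrite (ger0_norm (mulr_ge0 (expR_ge0 _) b0)) [leLHS]mulrC ler_wpM2r ?expR_ge0.
Qed.

Lemma laplace_binet_bounds x : 0 < x -> 0 <= mu x <= 3 / x + 2 / x ^+ 3.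
Proof.
move=> x0; apply/andP; split.
  apply: int_on_ge0 => t; rewrite in_hline => t0; have /andP[b0 b1] := binet_bounds t0.
  exact: mulr_ge0 (expR_ge0 _) b0.
rewrite -int_on_sqr1//; apply: le_int_on; first exact: integrable_on_laplace_binet.
  exact: integrable_on_sqr1.
move=> t; rewrite in_hline => t0; have /andP[b0 b1] := binet_bounds t0.
by rewrite [leLHS]mulrC ler_wpM2r ?expR_ge0.
Qed.

Lemma laplace_binet_sum_cvg x : 0 < x ->
  laplace (binet_sum K.+1) x @[K --> \oo] --> mu x.
Proof.
move=> x0; pose C := 1 / x + 2 / x ^+ 3.
have C0 : 0 < C by rewrite addr_gt0 ?divr_gt0 ?exprn_gt0.
have bound K : `|mu x - laplace (binet_sum K.+1) x| <= K.+1%:R^-1 * C.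
  have ib : integrable_on hline (fun t => expR (- (x * t)) * binet_sum K.+1 t).
    by apply: integrable_on_expRM => //; [exact: measurable_binet_sum|exact: integrable_on_binet_sum].
  rewrite /mu /laplace -int_onB//; last exact: integrable_on_laplace_binet.
  rewrite /C -int_on_sqr1// -int_onZ; last exact: integrable_on_sqr1.
  apply: normr_int_on_le.
  - by apply: measurable_onT; have mb := measurable_binet; have mb' := @measurable_binet_sum R K.+1; meas.
  - exact/integrable_onZ/integrable_on_sqr1.
  move=> t; rewrite in_hline => t0; have /andP[h1 h2] := @binet_sum_approx R K.+1 t t0 isT.
  rewrite -mulrBr normrM !ger0_norm ?expR_ge0//.
  have -> : K.+1%:R^-1 * ((1 + t ^+ 2) * expR (- (x * t))) =
    expR (- (x * t)) * ((1 + t ^+ 2) / K.+1%:R) by ring.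
  by rewrite ler_wpM2l ?expR_ge0.
apply/cvgrPdist_le => e e0; near=> K; apply: le_trans (bound K) _.
rewrite ler_pdivrMl// -ler_pdivrMr//; apply: (@le_trans _ _ K%:R); last by rewrite ler_nat.
by near: K; exact: nbhs_infty_ger.
Unshelve. all: by end_near. Qed.

(** The factor 1 - e^(-t), which appears in the difference of [mu] at x and x + 1, removes the
    denominator e^t - 1 from [binet]. *)
Let kernel1 t : 0 < t ->
  int_on `[0, 1] (fun v => (2^-1 - v) * expR (- (t * v))) = (1 - expR (- t)) * binet t.
Proof.
move=> t0; have tn0 : t != 0 by rewrite gt_eqF.
pose F v := expR (- (t * v)) * ((v - 2^-1) / t + (t ^+ 2)^-1).
have dF (v : R) : 0 <= v <= 1 -> is_derive v 1 F ((2^-1 - v) * expR (- (t * v))).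
  by move=> _; rewrite /F; der => //; field.
have cf : {in `[0, 1], forall v, {for v, continuous (fun v : R => (2^-1 - v) * expR (- (t * v)))}}.
  by move=> v _; der_cont; reflexivity.
rewrite (int_on_FTC ltr01 dF cf) /F mulr1 mulr0 oppr0 expR0 /binet expRN.
have e1 : expR t - 1 != 0 by rewrite gt_eqF// subr_gt0 -expR0 ltr_expR.
have := expR_gt0 t; move: (expR t) e1 => e e1 /lt0r_neq0 e0.
by field; rewrite e0 tn0 e1.
Qed.

(** By [kernel1] and Fubini the difference is the integral of (1 / 2 - v) / (x + v) over [0, 1]. It
    is the counterpart for [mu] of the functional equation of Gamma. *)
Lemma laplace_binet_sub x : 0 < x ->
  mu x - mu (x + 1) = (x + 2^-1) * (ln (x + 1) - ln x) - 1.
Proof.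
move=> x0; have x1 : 0 < x + 1 by rewrite addr_gt0.
transitivity (int_on hline (fun t => int_on `[0, 1] (fun v => expR (- (x * t)) * ((2^-1 - v) * expR (- (t * v)))))).
  rewrite /mu /laplace -int_onB; try exact: integrable_on_laplace_binet.
  apply: eq_int_on => t; rewrite in_hline => t0.
  rewrite int_onZ; last first.
    by apply: integrable_on_continuous => v _; der_cont; reflexivity.
  rewrite kernel1//; have -> : - ((x + 1) * t) = - (x * t) + - t by ring.
  by rewrite expRD; ring.
rewrite (@int_on_Fubini _ hline `[0, 1] (fun t v => expR (- (x * t)) * ((2^-1 - v) * expR (- (t * v))))
   (fun t => expR (- (x * t))) (fun=> 1)).
- transitivity (int_on `[0, 1] (fun v => (2^-1 - v) / (x + v))).
    apply: eq_int_on => v; rewrite in_itv /= => /andP[v0 v1].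
    have xv : 0 < x + v by rewrite ltr_pwDl.
    transitivity (int_on hline (fun t => (2^-1 - v) * (t ^+ 0 * expR (- ((x + v) * t))))).
      apply: eq_int_on => t _; have -> : - ((x + v) * t) = - (x * t) + - (t * v) by ring.
      by rewrite expRD; ring.
    rewrite int_onZ; last exact: integrable_on_exprn_expRN.
    by rewrite int_on_exprn_expRN// fact0 expr1 mul1r.
  pose F v := (x + 2^-1) * ln (x + v) - v.
  have xv (v : R) : 0 <= v <= 1 -> 0 < x + v by move=> /andP[v0 _]; rewrite ltr_pwDl.
  have dF (v : R) : 0 <= v <= 1 -> is_derive v 1 F ((2^-1 - v) / (x + v)).
    by move=> v01; rewrite /F; der; [exact: xv|field; rewrite gt_eqF// xv].
  have cf : {in `[0, 1], forall v, {for v, continuous (fun v : R => (2^-1 - v) / (x + v))}}.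
    by move=> v; rewrite in_itv /= => v01; der_cont; [rewrite gt_eqF// xv|reflexivity].
  by rewrite (int_on_FTC ltr01 dF cf) /F addr0; ring.
- by meas.
- exact: integrable_on_expRN.
- by apply: integrable_on_continuous => v _; der_cont; reflexivity.
move=> t v; rewrite in_hline in_itv /= => t0 /andP[v0 v1].
rewrite normrM ger0_norm ?expR_ge0// ler_wpM2l ?expR_ge0// normrM.
rewrite -[leRHS]mulr1 ler_pM//; first by rewrite ler_norml; lra.
by rewrite ger0_norm ?expR_ge0// -expR0 ler_expR oppr_le0 mulr_ge0// ltW.
Qed.

End BinetLaplace.

(** * The Gamma function *)

Section GammaFunction.
Context {R : realType}.
Implicit Types (t x z : R).

Lemma GammaE z : Gamma z = int_on hline (fun t => t `^ (z - 1) * expR (- t)).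
Proof. by []. Qed.

Let expRN_exprn (n : nat) t : 0 <= t -> t ^+ n * expR (- t) <= n`!%:R.
Proof. by move=> t0; have := @exprn_expRN_le R n 1 t ltr01 t0; rewrite mul1r expr1n divr1. Qed.

(** One majorant serves at both ends: q = t / (1 + t) behaves like t at 0 and tends to 1 at
    infinity, and q^z / z is bounded with derivative [g]. The integrand equals g (1 + t)^(z + 1)
    e^(-t), at most a constant times [g]. *)
Lemma integrable_on_Gamma z : 0 < z ->
  integrable_on hline (fun t => t `^ (z - 1) * expR (- t)).
Proof.
move=> z0; have zn0 : z != 0 by rewrite gt_eqF.
pose q t := t / (1 + t).
have q_gt0 t : 0 < t -> 0 < q t by move=> t0; rewrite divr_gt0// addr_gt0.
have dq t : 0 < t -> is_derive t 1 q ((1 + t)^-1 ^+ 2).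
  by move=> t0; rewrite /q; der; [rewrite gt_eqF// addr_gt0|field; rewrite gt_eqF// addr_gt0].
pose g t := q t `^ (z - 1) * (1 + t)^-1 ^+ 2.
have dF t : 0 < t -> is_derive t 1 (fun t => z^-1 * q t `^ z) (g t).
  move=> t0; rewrite /g; der; [exact: q_gt0|exact: dq|].
  by rewrite mul0r add0r mulrA [z^-1 * _]mulrA mulVf// mul1r.
have cg t : 0 < t -> {for t, continuous g}.
  move=> t0; rewrite /g; der_cont; [exact: q_gt0|exact: dq| |reflexivity].
  by rewrite gt_eqF// addr_gt0.
have cy : z^-1 * q t `^ z @[t --> +oo] --> z^-1 * 1.
  apply: cvgMr.
  have q1 : q t @[t --> +oo] --> (1 : R).
    apply: (@cvg_pinfty_le _ _ _ 1) => t t1; have t0 : 0 < t by apply: lt_le_trans t1.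
    have -> : q t - 1 = - (1 + t)^-1 by rewrite /q; field; rewrite gt_eqF// addr_gt0.
    by rewrite normrN gtr0_norm ?invr_gt0 ?addr_gt0// mul1r lef_pV2 ?posrE ?addr_gt0// lerDr.
  have cp : {for 1, continuous (fun u : R => u `^ z)} by der_cont; [exact: ltr01|reflexivity].
  have := cvg_comp q (fun u : R => u `^ z) q1 cp.
  by rewrite powR1.
have c0 : z^-1 * q t `^ z @[t --> 0^'+] --> z^-1 * 0.
  apply: cvgMr.
  apply: (@squeeze_cvgr _ _ _ _ (cst 0) (fun t => t `^ z)); last 2 first.
  - exact: cvg_cst.
  - exact: powR_cvg0.
  near=> t; have t0 : 0 < t by [].
  rewrite powR_ge0 /=; apply: ge0_ler_powR; rewrite ?nnegrE ?(ltW z0) ?(ltW t0) ?(ltW (q_gt0 _ t0))//.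
  by rewrite /q ler_pdivrMr ?addr_gt0// mulrDr mulr1 lerDl mulr_ge0// ltW.
have g0 t : 0 < t -> 0 <= g t by move=> _; rewrite mulr_ge0 ?powR_ge0 ?sqr_ge0.
have [ig _] := half_line_FTC_ge0 dF cg cy c0 g0.
(* An integer above z + 1, so that (1 + t)^(z + 1) e^(-t) <= e (1 + t)^m e^(-1 - t) <= e m!. *)
pose m := (Num.truncn (z + 1)).+1.
have zm : z + 1 <= m%:R by rewrite ltW// truncnS_gt.
apply: (integrable_onW _ (integrable_onZ (m`!%:R * expR 1) ig)).
  by apply: measurable_onT; meas.
move=> t; rewrite in_hline => t0; have t1 : 0 < 1 + t by rewrite addr_gt0.
rewrite ger0_norm ?mulr_ge0 ?powR_ge0 ?expR_ge0//.
have -> : t `^ (z - 1) = q t `^ (z - 1) * (1 + t)^-1 ^+ 2 * (1 + t) `^ (z + 1).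
  rewrite -[in LHS](divfK (lt0r_neq0 t1) t) powRM ?divr_ge0 ?(ltW t0) ?(ltW t1)//.
  rewrite -mulrA; congr (_ * _).
  have -> : z + 1 = z - 1 + 2%:R by ring.
  rewrite [(1 + t) `^ (z - 1 + _)]powRD; last by rewrite (lt0r_neq0 t1) implybT.
  by rewrite powR_mulrn ?(ltW t1)//; field; rewrite gt_eqF.
rewrite -/(g t) -mulrA mulrC ler_wpM2r ?g0//.
apply: (@le_trans _ _ ((1 + t) ^+ m * expR (- t))).
  rewrite ler_wpM2r ?expR_ge0// -powR_mulrn ?(ltW t1)//.
  by apply: ler_powR => //; rewrite lerDl ltW.
have -> : expR (- t) = expR 1 * expR (- (1 + t)) by rewrite -expRD; congr expR; ring.
by rewrite mulrCA [leRHS]mulrC ler_wpM2l ?expR_ge0// expRN_exprn// ltW.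
Unshelve. all: by end_near. Qed.

Lemma Gamma_gt0 z : 0 < z -> 0 < Gamma z.
Proof.
move=> z0; rewrite GammaE; apply: (@int_on_gt0 _ _ hline) => //.
- exact: hline_measure_neq0.
- exact: integrable_on_Gamma.
- by move=> t _; rewrite mulr_ge0 ?powR_ge0 ?expR_ge0.
by move=> t; rewrite in_hline => t0; rewrite mulr_gt0 ?expR_gt0 ?powR_gt0.
Qed.

Lemma Gamma1 : Gamma (1 : R) = 1.
Proof.
have E := @int_on_exprn_expRN R 0 1 ltr01.
transitivity (0`!%:R / 1 ^+ 1 : R); last by rewrite fact0 expr1 divr1.
rewrite GammaE -E.
by apply: eq_int_on => t _; rewrite subrr powRr0 expr0 !mul1r.
Qed.

Lemma GammaS z : 0 < z -> Gamma (z + 1) = z * Gamma z.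
Proof.
move=> z0; have z1 : 0 < z + 1 by rewrite addr_gt0.
pose f t := z * (t `^ (z - 1) * expR (- t)) - t `^ (z + 1 - 1) * expR (- t).
have dF t : 0 < t -> is_derive t 1 (fun t => t `^ z * expR (- t)) (f t).
  by move=> t0; rewrite /f; der => //; rewrite addrK; ring.
have cf t : 0 < t -> {for t, continuous f}.
  by move=> t0; rewrite /f; der_cont => //; reflexivity.
have fi : integrable_on hline f.
  by apply: integrable_onB; [apply: integrable_onZ|]; exact: integrable_on_Gamma.
have Fy : t `^ z * expR (- t) @[t --> +oo] --> (0 : R).
  pose m := (Num.truncn z).+1.
  have zm : z <= m%:R by rewrite ltW// truncnS_gt.
  apply: (@cvg_pinfty_le _ _ _ m.+1`!%:R) => t t1; have t0 : 0 < t by apply: lt_le_trans t1.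
  rewrite subr0 ger0_norm ?mulr_ge0 ?powR_ge0 ?expR_ge0// ler_pdivlMr//.
  apply: le_trans (expRN_exprn m.+1 (ltW t0)).
  rewrite mulrAC exprSr ler_wpM2r ?expR_ge0// ler_wpM2r ?(ltW t0)//.
  by rewrite -powR_mulrn ?(ltW t0)//; exact: ler_powR.
have F0 : t `^ z * expR (- t) @[t --> 0^'+] --> (0 : R) * 1.
  apply: cvgM; first exact: powR_cvg0.
  notypeclasses refine (cvg_at_right_is_derive _ _); first by der; reflexivity.
  by rewrite oppr0 expR0.
have := half_line_FTC dF cf Fy F0 fi.
rewrite /f int_onB; [|by apply: integrable_onZ; exact: integrable_on_Gamma|exact: integrable_on_Gamma].
rewrite int_onZ; last exact: integrable_on_Gamma.
by rewrite mul0r subrr -!GammaE => /eqP; rewrite subr_eq0 => /eqP.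
Qed.

Lemma Gamma_nat n : Gamma n.+1%:R = n`!%:R :> R.
Proof.
elim: n => [|n IHn]; first by rewrite Gamma1 fact0.
by rewrite -natr1 GammaS// IHn factS natrM.
Qed.

(** The inequality 1 + u <= e^u at u = - th ln s and at u = (1 - th) ln s, averaged with weights 1 -
    th and th so that the logarithms cancel. *)
Lemma powR_le_affine (s th : R) : 0 < s -> 0 <= th <= 1 -> s `^ th <= 1 - th + th * s.
Proof.
move=> s0 /andP[th0 th1]; rewrite /powR gt_eqF//.
have E1 : 1 = expR (th * ln s) * expR (- (th * ln s)) by rewrite -expRD subrr expR0.
have E2 : s = expR (th * ln s) * expR ((1 - th) * ln s).
  by rewrite -expRD -[LHS]lnK ?posrE//; congr expR; ring.
have h1 := expR_ge1Dx (- (th * ln s)); have h2 := expR_ge1Dx ((1 - th) * ln s).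
have e0 := expR_gt0 (th * ln s); set e := expR (th * ln s) in E1 E2 e0 *.
have h1' := ler_wpM2l (ltW e0) h1; have h2' := ler_wpM2l (ltW e0) h2.
have k1 : (1 - th) * (e * (1 + - (th * ln s))) <= (1 - th) * (e * expR (- (th * ln s))).
  by rewrite ler_wpM2l// subr_ge0.
have k2 : th * (e * (1 + (1 - th) * ln s)) <= th * (e * expR ((1 - th) * ln s)).
  by rewrite ler_wpM2l.
have k3 : e = (1 - th) * (e * (1 + - (th * ln s))) + th * (e * (1 + (1 - th) * ln s)) by ring.
rewrite [leLHS]k3; apply: le_trans (lerD k1 k2) _.
by rewrite -E1 -E2 mulr1.
Qed.

(* Young's inequality applied to (t / x) `^ th. *)
Lemma Gamma_add_le x th : 0 < x -> 0 <= th <= 1 -> Gamma (x + th) <= x `^ th * Gamma x.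
Proof.
move=> x0 th01; have /andP[th0 th1] := th01.
have xt0 : 0 < x + th by rewrite ltr_wpDr.
have x1 : 0 < x + 1 by rewrite addr_gt0.
have -> : x `^ th * Gamma x = x `^ th * ((1 - th) * Gamma x + th / x * Gamma (x + 1)).
  by rewrite GammaS//; congr (_ * _); field; rewrite gt_eqF.
rewrite !GammaE -!int_onZ; try exact: integrable_on_Gamma.
rewrite -int_onD; try by apply: integrable_onZ; exact: integrable_on_Gamma.
rewrite -int_onZ; last by apply: integrable_onD; apply: integrable_onZ; exact: integrable_on_Gamma.
apply: le_int_on.
- exact: integrable_on_Gamma.
- by apply: integrable_onZ; apply: integrable_onD; apply: integrable_onZ; exact: integrable_on_Gamma.
move=> t; rewrite in_hline => t0.
have tx : 0 < t / x by rewrite divr_gt0.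
have -> : t `^ (x + th - 1) = t `^ (x - 1) * (x `^ th * (t / x) `^ th).
  rewrite -powRM ?(ltW x0) ?(ltW tx)//.
  have -> : x * (t / x) = t by field; rewrite gt_eqF.
  rewrite -powRD; last by rewrite (lt0r_neq0 t0) implybT.
  by congr (_ `^ _); ring.
have -> : x + 1 - 1 = x - 1 + 1 by ring.
rewrite [t `^ (x - 1 + 1)]powRD; last by rewrite (lt0r_neq0 t0) implybT.
rewrite powRr1 ?(ltW t0)//.
have -> : x `^ th * ((1 - th) * (t `^ (x - 1) * expR (- t)) + th / x * (t `^ (x - 1) * t * expR (- t))) =
  t `^ (x - 1) * (x `^ th * (1 - th + th * (t / x))) * expR (- t) by ring.
rewrite ler_wpM2r ?expR_ge0// ler_wpM2l ?powR_ge0// ler_wpM2l ?powR_ge0//.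
exact: powR_le_affine.
Qed.

End GammaFunction.

(** * Wallis's product *)

Section Wallis.
Context {R : realType}.

(** At t = 0 the integrals of the partial fraction argument are Wallis's integrals, and their
    recursion is inherited. *)
Let I n : R := cosh_cos_int n 0.

Let IE n : I n = int_on `[0, pi / 2] (fun x => cos x ^+ n).
Proof. by apply: eq_int_on => x _; rewrite mul0r cosh0 mul1r. Qed.

Let pi2_gt0 : 0 < pi / 2 :> R. Proof. by rewrite divr_gt0// pi_gt0. Qed.

Let ccos n : {in `[0, pi / 2 : R], forall x, {for x, continuous (fun x : R => cos x ^+ n)}}.
Proof. by move=> x _; der_cont; reflexivity. Qed.

Let I0 : I 0 = pi / 2.
Proof.
have dF (x : R) : 0 <= x <= pi / 2 -> is_derive x 1 (fun x : R => x) (cos x ^+ 0).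
  by move=> _; rewrite expr0; exact: is_derive_fid.
by rewrite IE (int_on_FTC pi2_gt0 dF (@ccos 0)) subr0.
Qed.

Let I1 : I 1 = 1.
Proof.
have dF (x : R) : 0 <= x <= pi / 2 -> is_derive x 1 (fun x : R => sin x) (cos x ^+ 1).
  by move=> _; der; ring.
by rewrite IE (int_on_FTC pi2_gt0 dF (@ccos 1)) sin0 subr0 sin_pihalf.
Qed.

Let Irec n : n.+2%:R * I n.+2 = n.+1%:R * I n.
Proof.
have := @cosh_cos_int_rec R n 0; rewrite expr0n addr0 -/(I n.+2) -/(I n) expr2 -!mulrA.
by move/mulfI; apply; rewrite pnatr_eq0.
Qed.

Let I_gt0 n : 0 < I n. Proof. exact: cosh_cos_int_gt0. Qed.

Let Idecr n : I n.+1 <= I n.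
Proof.
rewrite !IE; apply: le_int_on; try by apply: integrable_on_continuous; exact: ccos.
move=> x; rewrite in_itv /= => /andP[x0 xp].
have c0 : 0 <= cos x.
  by apply: cos_ge0_pihalf; rewrite xp andbT (le_trans _ x0)// oppr_le0 ltW.
by rewrite exprSr ler_piMr ?exprn_ge0// cos_le1.
Qed.

Let Iprod n : n.+1%:R * I n.+1 * I n = pi / 2.
Proof.
elim: n => [|n IHn]; first by rewrite I0 I1 !mul1r.
by rewrite Irec -IHn mulrAC.
Qed.

(** The central binomial coefficient divided by 4^n. *)
Definition wallis n : R := (2 * n)`!%:R / (4 ^+ n * n`!%:R ^+ 2).

Lemma wallis_gt0 n : 0 < wallis n.
Proof. by rewrite divr_gt0 ?mulr_gt0 ?exprn_gt0 ?ltr0n ?fact_gt0. Qed.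

Let I_wallis n : I (2 * n) = pi / 2 * wallis n.
Proof.
elim: n => [|n IHn]; first by rewrite I0 /wallis muln0 fact0 expr0 expr1n; field.
have h := Irec (2 * n); rewrite IHn in h.
have -> : (2 * n.+1 = (2 * n).+2)%N by rewrite mulnS.
apply: (@mulfI _ (2 * n).+2%:R); first by rewrite pnatr_eq0.
rewrite h /wallis mulnS add2n !factS !natrM [4 ^+ n.+1]exprS.
have e2 : (2 * n).+2%:R = 2 * n.+1%:R :> R by rewrite -natrM mulnS.
rewrite e2; have f0 := @factr_neq0 R n; have n0 : n.+1%:R != 0 :> R by rewrite pnatr_eq0.
have q0 : (4 : R) ^+ n != 0 by rewrite expf_neq0.
move: (pi : R) (n`!%:R) (n.+1%:R) ((2 * n).+1%:R) ((2 * n)`!%:R) (4 ^+ n) f0 n0 q0 => p f m k g q f0 n0 q0.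
by field; rewrite f0 n0 q0.
Qed.

(** The product (n + 1) I (n + 1) I n is always pi / 2 and I decreases, so the square of I (2 n) is
    squeezed between two neighbouring products. *)
Lemma wallis_bounds n : (0 < n)%N ->
  n%:R / (n%:R + 2^-1) / pi <= n%:R * wallis n ^+ 2 <= pi^-1.
Proof.
case: n => // n _; have p0 := pi_gt0 R.
have W0 := wallis_gt0 n.+1; have Iw := I_wallis n.+1.
have hi : 2 * n.+1%:R * I (2 * n.+1) ^+ 2 <= pi / 2.
  have -> : 2 * n.+1%:R = (2 * n).+2%:R :> R by rewrite -natrM mulnS.
  have -> : (2 * n.+1 = (2 * n).+2)%N by rewrite mulnS.
  by rewrite -(Iprod (2 * n).+1) expr2 mulrA ler_wpM2l ?Idecr// mulr_ge0// ltW.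
have lo : pi / 2 <= (2 * n.+1%:R + 1) * I (2 * n.+1) ^+ 2.
  have -> : 2 * n.+1%:R + 1 = (2 * n.+1).+1%:R :> R by rewrite -natrM natr1.
  by rewrite -(Iprod (2 * n.+1)) expr2 mulrA ler_wpM2r ?ler_wpM2l ?Idecr// ltW.
move: hi lo; rewrite Iw exprMn.
have n0 : 0 < n.+1%:R :> R by rewrite ltr0n.
move: (wallis n.+1 ^+ 2) (n.+1%:R) n0 (pi : R) p0 => w m m0 p p0 hi lo.
have pn0 : p != 0 by rewrite gt_eqF.
have hi' : m * w * p <= 1.
  rewrite -(ler_pM2l (_ : 0 < p / 2)) ?divr_gt0// mulr1; apply: le_trans hi.
  by rewrite le_eqVlt; apply/orP; left; apply/eqP; field.
have lo' : 1 <= (m + 2^-1) * w * p.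
  rewrite -(ler_pM2l (_ : 0 < p / 2)) ?divr_gt0// mulr1; apply: le_trans lo _.
  by rewrite le_eqVlt; apply/orP; left; apply/eqP; field.
have m2 : 0 < m + 2^-1 by rewrite addr_gt0.
apply/andP; split; last by rewrite -div1r ler_pdivlMr.
rewrite ler_pdivrMr// ler_pdivrMr//.
have -> : m * w * p * (m + 2^-1) = m * ((m + 2^-1) * w * p) by ring.
by rewrite -[leLHS]mulr1 ler_wpM2l// ltW.
Qed.

Lemma wallis_cvg : n.+1%:R * wallis n.+1 ^+ 2 @[n --> \oo] --> (pi^-1 : R).
Proof.
have p0 := pi_gt0 R.
apply/cvgrPdist_le => e e0; near=> n.
have /andP[lo hi] := @wallis_bounds n.+1 isT.
rewrite ger0_norm ?subr_ge0//.
have n0 : 0 < n.+1%:R :> R by rewrite ltr0n.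
have m2 : 0 < n.+1%:R + 2^-1 :> R by rewrite addr_gt0.
apply: (@le_trans _ _ (n.+1%:R^-1 / pi)).
  rewrite lerBlDl; apply: le_trans (lerD lo (lexx _)).
  rewrite -mulrDl -[leLHS]mul1r ler_wpM2r ?invr_ge0 ?(ltW p0)//.
  have {1}-> : 1 = n.+1%:R / (n.+1%:R + 2^-1) + 2^-1 / (n.+1%:R + 2^-1) :> R.
    by rewrite -mulrDl divff// gt_eqF.
  rewrite lerD2l ler_pdivrMr// mulrDr mulVf ?gt_eqF//.
  rewrite -[leLHS]addr0 lerD// ?invf_le1 ?ler1n// mulr_ge0.
apply: (@le_trans _ _ (n.+1%:R^-1)).
  rewrite ler_piMr ?invr_ge0// invf_le1// (le_trans _ (pi_ge2 R))// ler1n//.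
rewrite invf_ple ?posrE//; apply: (@le_trans _ _ n%:R); last by rewrite ler_nat.
by near: n; exact: nbhs_infty_ger.
Unshelve. all: by end_near. Qed.

End Wallis.

(** * A rigidity criterion for functions of period 1 *)

Section Periodic.
Context {R : realType}.
Variables s e : R -> R.
Hypothesis sS : forall x, 0 < x -> s (x + 1) = s x.
Hypothesis s_step : forall x th, 0 < x -> 0 <= th <= 1 -> s (x + th) <= s x * expR (e x).
Hypothesis e_cvg : forall x, 0 < x -> e (x + n.+1%:R) @[n --> \oo] --> (0 : R).

Let sDn x n : 0 < x -> s (x + n%:R) = s x.
Proof.
move=> x0; elim: n => [|n IHn]; first by rewrite addr0.
have xn : 0 < x + n%:R by rewrite ltr_wpDr.
by rewrite -natr1 addrA (sS xn).
Qed.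

(** Integer shifts change neither side, and far out the error factor tends to 1. *)
Let s_le x th : 0 < x -> 0 <= th <= 1 -> s (x + th) <= s x.
Proof.
move=> x0 th01; have /andP[th0 th1] := th01.
have C : s x * expR (e (x + n.+1%:R)) @[n --> \oo] --> s x * expR 0.
  by apply: cvgMr; apply: continuous_cvg; [exact: continuous_expR|exact: e_cvg].
rewrite expR0 mulr1 in C; rewrite -(cvg_lim _ C)//.
apply: limr_ge; first by apply/cvg_ex; eexists; exact: C.
near=> n; have xn : 0 < x + n.+1%:R by rewrite ltr_wpDr.
have xt0 : 0 < x + th by rewrite ltr_wpDr.
by rewrite -(sDn n.+1 xt0) addrAC (le_trans (s_step xn th01))// sDn.
Unshelve. all: by end_near. Qed.

(** The reverse inequality is [s_le] from x + th with step 1 - th, which arrives at x + 1. *)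
Let s_eq x th : 0 < x -> 0 <= th <= 1 -> s (x + th) = s x.
Proof.
move=> x0 th01; have /andP[th0 th1] := th01.
have xt0 : 0 < x + th by rewrite ltr_wpDr.
have c01 : 0 <= 1 - th <= 1 by apply/andP; split; lra.
have h := s_le xt0 c01.
rewrite (_ : x + th + (1 - th) = x + 1) ?(sS x0) in h; last by ring.
by apply: le_anti; rewrite h s_le.
Qed.

Lemma constant_of_periodic x : 0 < x -> s x = s 1.
Proof.
move=> x0; rewrite -(sS x0).
have x1 : 0 <= x by rewrite ltW.
have /andP[h1 h2] := truncn_itv x1.
pose n := Num.truncn x; rewrite -/n in h1 h2.
have -> : x + 1 = 1 + n%:R + (x - n%:R) by ring.
have n1 : 0 < 1 + n%:R :> R by rewrite ltr_wpDr.
have d01 : 0 <= x - n%:R <= 1 by rewrite subr_ge0 h1 lerBlDl natr1 ltW.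
by rewrite (s_eq n1 d01) (sDn n ltr01).
Qed.

End Periodic.

(** * Binet's first formula and Stirling's constant *)

Section Stirling.
Context {R : realType}.
Implicit Types (x y z : R).
Local Opaque Gamma laplace.

Let mu x := laplace (@binet R) x.

(** The quotient of Gamma x by x^(x - 1/2) e^(-x) e^(mu x); Binet's formula says that it is
    constantly sqrt (2 pi). *)
Definition stirling_ratio x := Gamma x * expR (x - (x - 2^-1) * ln x - mu x).

Local Notation sigma := stirling_ratio.

Let sigma_gt0 x : 0 < x -> 0 < sigma x.
Proof. by move=> x0; apply: mulr_gt0; [exact: Gamma_gt0|exact: expR_gt0]. Qed.

Let sigmaS x : 0 < x -> sigma (x + 1) = sigma x.
Proof.
move=> x0; rewrite /stirling_ratio (GammaS x0).
have -> : x * Gamma x = Gamma x * expR (ln x) by rewrite lnK ?posrE// mulrC.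
rewrite -mulrA -expRD; congr (_ * expR _).
have := laplace_binet_sub x0; rewrite -/(mu x) -/(mu (x + 1)).
by move: (mu x) (mu (x + 1)) (ln x) (ln (x + 1)) => a b c d E; lra.
Qed.

Let ln_lower y : 0 < y -> forall th, 0 <= th -> th / (y + th) <= ln (y + th) - ln y.
Proof.
move=> y0 th th0; have yt : 0 < y + th by rewrite ltr_wpDr.
have := expR_ge1Dx (ln y - ln (y + th)); rewrite expRB !lnK ?posrE// => h.
have -> : th / (y + th) = 1 - y / (y + th) by field; rewrite gt_eqF.
lra.
Qed.

(** [Gamma_add_le] bounds Gamma (y + th) by y^th Gamma y; the remaining logarithms are compared
    through 1 + u <= e^u, and [mu (y + th)] is dropped as nonnegative. The error y^-1 + mu y tends
    to 0 at infinity. *)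
Let sigma_step y th : 0 < y -> 0 <= th <= 1 ->
  sigma (y + th) <= sigma y * expR (y^-1 + mu y).
Proof.
move=> y0 th01; have /andP[th0 th1] := th01; have yt : 0 < y + th by rewrite ltr_wpDr.
rewrite /stirling_ratio -mulrA -expRD.
apply: le_trans (ler_wpM2r (expR_ge0 _) (Gamma_add_le y0 th01)) _.
rewrite mulrAC mulrC ler_wpM2l ?(ltW (Gamma_gt0 y0))//.
rewrite /powR gt_eqF// -expRD ler_expR.
have h := ln_lower y0 th0.
have /andP[m0 _] := laplace_binet_bounds yt; rewrite -/(mu (y + th)) in m0.
have k : (y + th) * (th / (y + th)) <= (y + th) * (ln (y + th) - ln y) by rewrite ler_wpM2l// ltW.
have e : (y + th) * (th / (y + th)) = th by field; rewrite gt_eqF.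
have l : ln (y + th) - ln y <= th / y.
  have := expR_ge1Dx (ln (y + th) - ln y); rewrite expRB !lnK ?posrE// => h2.
  have e2 : (y + th) / y = 1 + th / y by field; rewrite gt_eqF.
  lra.
have l2 : th / y <= y^-1 by rewrite ler_piMl ?invr_ge0// ltW.
have i0 : 0 <= y^-1 by rewrite invr_ge0 ltW.
move: k; rewrite e; move: (mu y) (mu (y + th)) (ln y) (ln (y + th)) (y^-1) m0 l l2 i0 h.
move: (th / y) (th / (y + th)) => q1 q2 a b c d i m0 l l2 i0 h k.
have -> : th * c + (y + th - (y + th - 2^-1) * d - b) =
  y - (y - 2^-1) * c + (th - (y + th) * (d - c)) + (d - c) / 2 - b by field.
move: k; move: ((y + th) * (d - c)) ((y - 2^-1) * c) => kk cc k.
lra.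
Qed.

Let sigma_const x : 0 < x -> sigma x = sigma 1.
Proof.
move: x; apply: (constant_of_periodic (e := fun y => y^-1 + mu y) sigmaS sigma_step) => x x0.
have C : (x + n.+1%:R)^-1 + (3 / n.+1%:R + 2 / n.+1%:R) @[n --> \oo] --> (0 : R).
  rewrite (_ : 0 = 0 + (3 * 0 + 2 * 0)); last by ring.
  apply: cvgD; last by apply: cvgD; apply: cvgMr; exact: cvg_harmonic.
  apply: (@squeeze_cvgr _ _ _ _ (cst 0) (fun n => n.+1%:R^-1)); last 2 first.
  - exact: cvg_cst.
  - exact: cvg_harmonic.
  near=> n; have n0 : 0 < n.+1%:R :> R by rewrite ltr0n.
  rewrite invr_ge0 addr_ge0 ?(ltW x0)//=.
  by rewrite lef_pV2 ?posrE ?addr_gt0// lerDr ltW.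
apply: (@squeeze_cvgr _ _ _ _ (cst 0) (fun n => (x + n.+1%:R)^-1 + (3 / n.+1%:R + 2 / n.+1%:R))) => //.
  near=> n; have n0 : 0 < n.+1%:R :> R by rewrite ltr0n.
  have xn : 0 < x + n.+1%:R by rewrite addr_gt0.
  have /andP[h0 h] := laplace_binet_bounds xn.
  rewrite /cst addr_ge0 ?invr_ge0 ?(ltW xn)//= lerD2l; apply: le_trans h _.
  have nx : n.+1%:R <= x + n.+1%:R by rewrite lerDr ltW.
  rewrite lerD// ler_wpM2l// lef_pV2 ?posrE ?exprn_gt0//.
  apply: (le_trans nx); rewrite exprS ler_peMr ?(ltW xn)// exprn_ege1//.
  by rewrite (le_trans _ nx)// ler1n.
exact: cvg_cst.
Unshelve. all: by end_near. Qed.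

Let s := sigma 1.

Let fact_sigma n : (0 < n)%N ->
  n`!%:R = s * expR ((n%:R + 2^-1) * ln n%:R - n%:R + mu n%:R) :> R.
Proof.
case: n => // n _; have n0 : 0 < n.+1%:R :> R by rewrite ltr0n.
rewrite factS natrM -Gamma_nat /s -(sigma_const n0) /stirling_ratio -mulrA -expRD mulrC; congr (_ * _).
rewrite -[LHS]lnK ?posrE//; congr expR.
by move: (mu _) (ln _) => a b; field.
Qed.

(** Each factorial is replaced by the exact formula [fact_sigma]; powers of n and exponentials
    cancel, leaving only [s] and values of [mu] that tend to 0. The limit 2 / s^2 is then compared
    with [wallis_cvg]. *)
Let wallis_sigma n : (0 < n)%N ->
  n%:R * @wallis R n ^+ 2 = 2 / s ^+ 2 * expR (2 * mu (2 * n)%:R - 4 * mu n%:R).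
Proof.
move=> n0; have n0' : 0 < n%:R :> R by rewrite ltr0n.
have s0 : s != 0 by rewrite gt_eqF// sigma_gt0.
rewrite /wallis fact_sigma ?muln_gt0// fact_sigma// natrM lnM ?posrE//.
have e4 : (4 : R) ^+ n = expR (n%:R * (ln 2 + ln 2)).
  by rewrite expRM_natl expRD !lnK ?posrE//; congr (_ ^+ _); ring.
have e1 : n%:R = expR (ln n%:R) :> R by rewrite lnK.
have e2 : 2 = expR (ln 2) :> R by rewrite lnK ?posrE.
have -> : 2 / s ^+ 2 * expR (2 * mu (2 * n%:R) - 4 * mu n%:R) =
  (s ^+ 2)^-1 * expR (ln 2 + (2 * mu (2 * n%:R) - 4 * mu n%:R)).
  by rewrite expRD -e2; ring.
rewrite [X in X * _ = _]e1 e4.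
move: (n%:R) (ln n%:R) (ln (2 : R)) (mu n%:R) (mu (2 * n%:R)) => k ln' l2 m m2.
have E (a b c' d : R) : expR a * (s * expR b / (expR c' * (s * expR d) ^+ 2)) ^+ 2 =
    (s ^+ 2)^-1 * expR (a + (b - c' - d - d) * 2).
  rewrite mulrDr mulr1 !expRD !expRN.
  have := lt0r_neq0 (expR_gt0 b); have := lt0r_neq0 (expR_gt0 c'); have := lt0r_neq0 (expR_gt0 d).
  move: (expR a) (expR b) (expR c') (expR d) => ea eb ec ed d0 c0 b0.
  by field; rewrite s0 d0 c0.
rewrite E; congr (_ * expR _).
by field.
Qed.

Let mu_le x : 1 <= x -> 0 <= mu x <= 5 / x.
Proof.
move=> x1; have x0 : 0 < x by apply: lt_le_trans x1.
have /andP[-> h] := laplace_binet_bounds x0; apply: le_trans h _.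
have -> : 5 / x = 3 / x + 2 / x by ring.
rewrite lerD2l ler_wpM2l// lef_pV2 ?posrE ?exprn_gt0//.
by rewrite exprS ler_peMr ?(ltW x0)// exprn_ege1.
Qed.

Let s_sqr : s ^+ 2 = 2 * pi.
Proof.
have s0 : 0 < s by exact: sigma_gt0.
have p0 := pi_gt0 R.
have C1 : n.+1%:R * @wallis R n.+1 ^+ 2 @[n --> \oo] --> 2 / s ^+ 2 * expR 0.
  under eq_fun do rewrite wallis_sigma//.
  apply: cvgMr; apply: continuous_cvg; first exact: continuous_expR.
  apply/cvgrPdist_le => e e0; near=> n; rewrite sub0r normrN.
  have n0 : 0 < n.+1%:R :> R by rewrite ltr0n.
  have n1 : 1 <= n.+1%:R :> R by rewrite ler1n.
  have m1 : 1 <= (2 * n.+1)%:R :> R by rewrite ler1n muln_gt0.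
  have nm : n.+1%:R <= (2 * n.+1)%:R :> R by rewrite ler_nat leq_pmull.
  have /andP[a1 a2] := mu_le n1; have /andP[b1 b2] := mu_le m1.
  have h : 5 / (2 * n.+1)%:R <= 5 / n.+1%:R :> R.
    by rewrite ler_wpM2l// lef_pV2 ?posrE// (lt_le_trans n0).
  apply: (@le_trans _ _ (20 / n.+1%:R)).
    have -> : 20 / n.+1%:R = 4 * (5 / n.+1%:R) :> R by ring.
    have G (p q r r' : R) : 0 <= p -> p <= r -> 0 <= q -> q <= r' -> r' <= r ->
      `|2 * q - 4 * p| <= 4 * r by move=> *; rewrite ler_norml; apply/andP; split; lra.
    exact: G a1 a2 b1 b2 h.
  rewrite ler_pdivrMr// mulrC -ler_pdivrMr//; apply: (@le_trans _ _ n%:R); last by rewrite ler_nat.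
  by near: n; exact: nbhs_infty_ger.
have := cvg_unique _ C1 (@wallis_cvg R); rewrite expR0 mulr1 => E.
have s2 : s ^+ 2 != 0 by rewrite expf_neq0// gt_eqF.
have -> : s ^+ 2 = 2 / (2 / s ^+ 2) by move: (s ^+ 2) s2 => q q0; field.
by rewrite E // invrK.
Unshelve. all: by end_near. Qed.

Lemma scaled_Gamma_laplace z : 0 < z -> scaled_Gamma z = expR (laplace (@binet R) z).
Proof.
move=> z0; have s0 : s != 0 by rewrite gt_eqF// sigma_gt0.
have sE : Num.sqrt (2 * pi) = s.
  by rewrite -s_sqr sqrtr_sqr gtr0_norm// sigma_gt0.
have solve (g l m : R) : g * expR (z - (z - 2^-1) * l - m) = s ->
    g / (s * expR ((z - 2^-1) * l) * expR (- z)) = expR m.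
  rewrite !expRD !expRN => gE.
  have := lt0r_neq0 (expR_gt0 z); have := lt0r_neq0 (expR_gt0 ((z - 2^-1) * l)).
  have := lt0r_neq0 (expR_gt0 m); move: gE s0.
  move: (expR z) (expR _) (expR m) (s : R) => u v w t <- t0 w0 v0 u0.
  have g0 : g != 0 by apply: contra_neq t0 => ->; rewrite mul0r.
  by field; rewrite g0 u0 v0 w0.
have pE : z `^ (z - 2^-1) = expR ((z - 2^-1) * ln z) by rewrite /powR (gt_eqF z0).
by rewrite /scaled_Gamma sE pE; exact: solve (sigma_const z0).
Qed.

End Stirling.

(** * Asymptotic expansions at the origin *)

Section NearPoly.
Context {R : realType}.
Implicit Types (f g : R -> R) (P Q : {poly R}) (N : nat).

(* [f s = P.[s] + O(s ^+ N)] as [s] tends to 0 from the right. *)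
Definition near_poly N f P := exists2 C : R, 0 <= C &
  forall s, 0 < s <= 1 -> `|f s - P.[s]| <= C * s ^+ N.

Let normr_horner_bounded P : exists2 C : R, 0 <= C & forall s, 0 < s <= 1 -> `|P.[s]| <= C.
Proof.
exists (\sum_(i < size P) `|P`_i|); first by apply: sumr_ge0.
move=> s /andP[s0 s1]; rewrite horner_coef; apply: le_trans (ler_norm_sum _ _ _) _.
apply: ler_sum => i _; rewrite normrM normrX (gtr0_norm s0) ler_piMr// exprn_ile1//.
exact: ltW.
Qed.

Lemma near_polyW N M f P : (M <= N)%N -> near_poly N f P -> near_poly M f P.
Proof.
move=> MN [C C0 fP]; exists C => // s s01; apply: le_trans (fP s s01) _.
case/andP: s01 => s0 s1; rewrite ler_wpM2l// ler_wiXn2l// ltW//.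
Qed.

Lemma eq_near_poly N f g P : (forall s, 0 < s <= 1 -> f s = g s) -> near_poly N f P -> near_poly N g P.
Proof. by move=> fg [C C0 fP]; exists C => // s s01; rewrite -fg// fP. Qed.

Lemma near_poly_horner N P : near_poly N (fun s => P.[s]) P.
Proof. by exists 0 => // s _; rewrite subrr normr0 mul0r. Qed.

Lemma near_polyD N f g P Q : near_poly N f P -> near_poly N g Q ->
  near_poly N (fun s => f s + g s) (P + Q).
Proof.
move=> [C C0 fP] [D D0 gQ]; exists (C + D); first exact: addr_ge0.
move=> s s01; rewrite hornerD opprD addrACA mulrDl.
by apply: le_trans (ler_normD _ _) _; rewrite lerD ?fP ?gQ.
Qed.

Lemma near_polyM N f g P Q : near_poly N f P -> near_poly N g Q ->
  near_poly N (fun s => f s * g s) (P * Q).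
Proof.
move=> [C C0 fP] [D D0 gQ].
have [A A0 hA] := normr_horner_bounded P; have [B B0 hB] := normr_horner_bounded Q.
exists (C * (D + B) + A * D); first by rewrite addr_ge0 ?mulr_ge0// addr_ge0.
move=> s s01; rewrite hornerM.
have -> : f s * g s - P.[s] * Q.[s] = (f s - P.[s]) * (g s - Q.[s] + Q.[s]) + P.[s] * (g s - Q.[s]).
  by ring.
have /andP[s0 s1] := s01; have sN : 0 <= s ^+ N by rewrite exprn_ge0// ltW.
have sN1 : s ^+ N <= 1 by rewrite exprn_ile1// ltW.
apply: le_trans (ler_normD _ _) _; rewrite !normrM mulrDl; apply: lerD.
  rewrite mulrAC; apply: ler_pM => //; first exact: fP.
  apply: le_trans (ler_normD _ _) _; apply: lerD; last exact: hB.
  by apply: le_trans (gQ s s01) _; rewrite ler_piMr.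
by rewrite -mulrA; apply: ler_pM => //; [exact: hA|exact: gQ].
Qed.

Lemma near_polyZ N (c : R) f P : near_poly N f P -> near_poly N (fun s => c * f s) (c *: P).
Proof.
move=> /(near_polyM (near_poly_horner N c%:P)); rewrite mul_polyC.
by apply: eq_near_poly => s _; rewrite hornerC.
Qed.

Lemma near_polyX N k f P : near_poly N f P -> near_poly N (fun s => f s ^+ k) (P ^+ k).
Proof.
move=> fP; elim: k => [|k IHk].
  by apply: eq_near_poly (near_poly_horner N _) => s _; rewrite !expr0 hornerC.
rewrite exprS; apply: eq_near_poly (near_polyM fP IHk) => s _.
by rewrite exprS.
Qed.

Lemma near_poly_sum N n (F : nat -> R -> R) (P : nat -> {poly R}) :
  (forall k, near_poly N (F k) (P k)) ->
  near_poly N (fun s => \sum_(k < n) F k s) (\sum_(k < n) P k).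
Proof.
move=> FP; elim: n => [|n IHn].
  rewrite big_ord0; apply: eq_near_poly (near_poly_horner N _) => s _.
  by rewrite big_ord0 horner0.
rewrite big_ord_recr; apply: eq_near_poly (near_polyD IHn (FP n)) => s _.
by rewrite big_ord_recr.
Qed.

(** The constant coefficient is split off, P = P_0 + X Q; once P_0 = 0, the polynomial Q satisfies
    the hypothesis with the exponent lowered by one. *)
Let near_poly0_coef N P : near_poly N (fun=> 0) P -> forall i, (i < N)%N -> P`_i = 0.
Proof.
elim: N P => // N IHN P [C C0 hP].
have P0 s : 0 < s <= 1 -> `|P.[s]| <= C * s ^+ N.+1.
  by move=> s01; have := hP s s01; rewrite sub0r normrN.
pose Q := \poly_(i < size P) P`_i.+1.
have QE i : Q`_i = P`_i.+1.
  rewrite coef_poly; case: ltnP => // h; rewrite nth_default//; exact: leq_trans (leqnSn _).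
have PE : P = (P`_0)%:P + 'X * Q.
  apply/polyP => -[|i]; rewrite coefD coefC coefXM /= ?addr0// QE add0r//.
have [M M0 hM] := normr_horner_bounded Q.
have p0 : P`_0 = 0.
  apply/eqP/negPn/negP => p0; have pn : 0 < `|P`_0| by rewrite normr_gt0.
  have D0 : 0 < C + M + `|P`_0| + 1 by rewrite ltr_wpDl// addr_ge0// addr_ge0.
  (* Small enough that (C + M) s is below the absolute value of P_0, contradicting the bound
     [h4]. *)
  pose s := `|P`_0| / (C + M + `|P`_0| + 1).
  have s0 : 0 < s by rewrite divr_gt0.
  have s1 : s <= 1 by rewrite ler_pdivrMr// mul1r; move: C0 M0; lra.
  have s01 : 0 < s <= 1 by rewrite s0.
  have h1 := P0 s s01; have h2 := hM s s01.
  have h3 : C * s ^+ N.+1 <= C * s.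
    by rewrite exprS ler_wpM2l// ler_piMr ?(ltW s0)// exprn_ile1// ltW.
  have h4 : `|P`_0| <= (C + M) * s.
    have -> : P`_0 = P.[s] - s * Q.[s] by rewrite {2}PE hornerD hornerC hornerM hornerX; ring.
    apply: le_trans (ler_normB _ _) _; rewrite normrM (gtr0_norm s0) mulrDl.
    by apply: lerD; [exact: le_trans h3|rewrite mulrC ler_wpM2r ?(ltW s0)].
  have h5 : (C + M + `|P`_0| + 1) * s = `|P`_0| by rewrite /s mulrC divfK// gt_eqF.
  have : 0 < (`|P`_0| + 1) * s by rewrite mulr_gt0// addr_gt0.
  by move: h4 h5; move: (`|P`_0|) (C) (M) (s) => p c m t; nra.
case=> [//|i]; rewrite ltnS => iN; rewrite -QE; apply: IHN i iN.
exists C => // s s01; have /andP[s0 s1] := s01; rewrite sub0r normrN.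
have := P0 s s01; rewrite {1}PE p0 hornerD hornerC add0r hornerM hornerX normrM (gtr0_norm s0).
by rewrite exprS mulrCA ler_pM2l.
Qed.

Lemma near_poly_uniq N f P Q : near_poly N f P -> near_poly N f Q ->
  forall i, (i < N)%N -> P`_i = Q`_i.
Proof.
move=> fP fQ i iN; apply/eqP; rewrite -subr_eq0 -coefB; apply/eqP.
apply: (@near_poly0_coef N) => //.
have := near_polyD fP (near_polyZ (-1) fQ); rewrite scaleN1r.
by apply: eq_near_poly => s _; rewrite mulN1r subrr.
Qed.

(** Induction on N: the derivative of the Taylor remainder of order N + 1 is the remainder of order
    N. *)
Let expR_sum_le N (u : R) : 0 <= u ->
  0 <= expR u - \sum_(k < N) u ^+ k / k`!%:R <= u ^+ N * expR u.
Proof.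
elim: N u => [|N IHN] u u0.
  by rewrite big_ord0 subr0 expr0 mul1r expR_ge0 lexx.
pose F M (v : R) := expR v - \sum_(k < M) v ^+ k / k`!%:R.
have F0 : F N.+1 0 = 0.
  rewrite /F big_ord_recl big1 ?addr0 => [|k _]; last by rewrite expr0n mul0r.
  by rewrite expr0 fact0 divr1 expR0 subrr.
have dF (v : R) : is_derive v 1 (F N.+1) (F N v).
  have dS M : is_derive v 1 (fun v : R => \sum_(k < M.+1) v ^+ k / k`!%:R)
      (\sum_(k < M) v ^+ k / k`!%:R).
    elim: M => [|M IHM].
      rewrite big_ord0 (_ : (fun v : R => _) = fun=> 1); first exact: is_derive_cst.
      by apply/funext => w; rewrite big_ord_recr big_ord0 /= add0r expr0 fact0 divr1.
    have dX : is_derive v 1 (fun v : R => v ^+ M.+1 / (M.+1)`!%:R) (v ^+ M / M`!%:R).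
      der; have := lt0r_neq0 (_ : 0 < M`!%:R :> R); rewrite ltr0n fact_gt0 => /(_ isT) h.
      rewrite factS natrM /=; move: (M`!%:R : R) h => q h; field; rewrite h; exact: lt0r_neq0.
    rewrite [X in is_derive _ _ _ X]big_ord_recr (_ : (fun v : R => _) =
      (fun v => \sum_(k < M.+1) v ^+ k / k`!%:R) \+ (fun v => v ^+ M.+1 / (M.+1)`!%:R)).
      exact: is_deriveD.
    by apply/funext => w; rewrite big_ord_recr.
  by apply: is_deriveB; exact: dS.
have FN v : 0 <= v -> 0 <= F N v <= v ^+ N * expR v by exact: IHN.
rewrite -/(F N.+1 u); apply/andP; split.
  rewrite -F0; apply: (le_of_derive_ge0 u0 (fun v _ => dF v)) => v /andP[/ltW v0 _].
  by have /andP[] := FN v v0.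
have dG (v : R) : is_derive v 1 (fun v => v ^+ N.+1 * expR v - F N.+1 v)
   (N.+1%:R * v ^+ N * expR v + v ^+ N.+1 * expR v - F N v).
  apply: is_deriveB.
  by der; rewrite /=; ring.
have G0 : 0 ^+ N.+1 * expR 0 - F N.+1 0 = 0 by rewrite F0 exprS !mul0r subrr.
rewrite -subr_ge0 -G0.
apply: (le_of_derive_ge0 u0 (fun v _ => dG v)) => v /andP[/ltW v0 _].
have /andP[_ h] := FN v v0.
have h1 : 0 <= v ^+ N.+1 * expR v by rewrite mulr_ge0 ?exprn_ge0 ?expR_ge0.
have h2 : 0 <= N%:R * (v ^+ N * expR v) by rewrite !mulr_ge0 ?exprn_ge0 ?expR_ge0.
rewrite -natr1; move: h h1 h2; move: (v ^+ N.+1 * _) (F N v) => p q.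
have -> : (N%:R + 1) * v ^+ N * expR v = N%:R * (v ^+ N * expR v) + v ^+ N * expR v by ring.
by move: (v ^+ N * _) => r; move: (N%:R * r) => t; lra.
Qed.

(** Because f = O(s) is nonnegative, cutting the exponential series after N terms costs at most f^N
    e^f = O(s^N). *)
Lemma near_poly_expR N f P : (forall s, 0 < s <= 1 -> 0 <= f s) ->
  near_poly 1 f 0 -> near_poly N f P ->
  near_poly N (fun s => expR (f s)) (\sum_(k < N) (k`!%:R)^-1 *: P ^+ k).
Proof.
move=> f0 [A A0 fA] fP.
have := near_poly_sum N (fun k => near_polyZ (k`!%:R)^-1 (near_polyX k fP)).
move=> [C C0 hC]; exists (C + A ^+ N * expR A).
  by rewrite addr_ge0// mulr_ge0 ?exprn_ge0 ?expR_ge0.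
move=> s s01; have /andP[s0 s1] := s01.
have fs : f s <= A * s.
  by have := fA s s01; rewrite horner0 subr0 expr1; apply: le_trans; exact: ler_norm.
have fsA : f s <= A by apply: (le_trans fs); rewrite ler_piMr.
have /andP[e0 e1] := expR_sum_le N (f0 s s01).
have E : \sum_(k < N) (k`!%:R)^-1 * f s ^+ k = \sum_(k < N) f s ^+ k / k`!%:R.
  by apply: eq_bigr => k _; rewrite mulrC.
have := hC s s01; rewrite E => h; rewrite mulrDl.
move: h e0 e1; set S := \sum_(k < N) _; set Q := (\sum_(k < N) _).[s] => h e0 e1.
have -> : expR (f s) - Q = (S - Q) + (expR (f s) - S) by ring.
apply: le_trans (ler_normD _ _) _; apply: lerD => //.
rewrite ger0_norm//; apply: (le_trans e1); rewrite mulrAC -exprMn.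
apply: ler_pM; rewrite ?exprn_ge0 ?expR_ge0 ?ler_expR ?f0//.
by rewrite lerXn2r ?nnegrE ?f0// mulr_ge0// ltW.
Qed.

End NearPoly.

(** * Coefficientwise limits of polynomials *)

Section CoefLimits.
Context {R : realType}.
Implicit Types (P Q : nat -> {poly R}) (p q : {poly R}).

Definition coef_cvg P p := forall i, (P K)`_i @[K --> \oo] --> p`_i.

Lemma coef_cvg_cst p : coef_cvg (fun=> p) p.
Proof. by move=> i; exact: cvg_cst. Qed.

Let cvg_sumr (I : Type) (r : seq I) (F : I -> nat -> R) (l : I -> R) :
  (forall i, F i K @[K --> \oo] --> l i) ->
  \sum_(i <- r) F i K @[K --> \oo] --> \sum_(i <- r) l i.
Proof.
move=> Fl; elim: r => [|i r IHr].
  by rewrite big_nil; under eq_fun do rewrite big_nil; exact: cvg_cst.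
rewrite big_cons; under eq_fun do rewrite big_cons.
exact: cvgD (Fl i) IHr.
Qed.

Lemma coef_cvgM P p Q q : coef_cvg P p -> coef_cvg Q q -> coef_cvg (fun K => P K * Q K) (p * q).
Proof.
move=> Pp Qq i; rewrite coefM; under eq_fun do rewrite coefM.
by apply: cvg_sumr => j; apply: cvgM; [exact: Pp|exact: Qq].
Qed.

Lemma coef_cvgX P p k : coef_cvg P p -> coef_cvg (fun K => P K ^+ k) (p ^+ k).
Proof.
move=> Pp; elim: k => [|k IHk].
  rewrite expr0; under eq_fun do rewrite expr0; exact: coef_cvg_cst.
rewrite exprS; under eq_fun do rewrite exprS; exact: coef_cvgM.
Qed.

Lemma coef_cvg_sum n (c : nat -> nat -> R) (l : nat -> R) (P : nat -> nat -> {poly R}) (p : nat -> {poly R}) :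
  (forall k, c k K @[K --> \oo] --> l k) -> (forall k, coef_cvg (P k) (p k)) ->
  coef_cvg (fun K => \sum_(k < n) c k K *: P k K) (\sum_(k < n) l k *: p k).
Proof.
move=> cl Pp i; rewrite coef_sum; under eq_fun do rewrite coef_sum.
apply: cvg_sumr => k; rewrite coefZ; under eq_fun do rewrite coefZ.
by apply: cvgM; [exact: cl|exact: Pp].
Qed.

End CoefLimits.

(** * Taylor expansions of Binet's function and of its truncations at 0 *)

Section BinetExpansion.
Context {R : realType}.
Implicit Types (t x : R) (K N n j : nat).

Let c : nat -> R := binet_freq.

(** Up to sign, the Taylor coefficient of t^(2 j) in [binet_sum K.+1]; its limit [freq_series j] is
    2 zeta (2 j + 2) / (2 pi)^(2 j + 2). *)
Definition freq_sum K j : R := \sum_(k < K.+1) 2 / c k ^+ (2 * j).+2.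

Let c0 k : 0 < c k. Proof. exact: binet_freq_gt0. Qed.

Let freq_term_gt0 k j : 0 < 2 / c k ^+ (2 * j).+2.
Proof. by rewrite divr_gt0// exprn_gt0. Qed.

Let freq_sum_le K j : freq_sum K j <= 2.
Proof.
(* All frequencies are at least 1, so the sum is dominated termwise by 4 times [binet_sum] at t = 1,
   which is itself at most 1 / 2. *)
apply: (@le_trans _ _ (4 * binet_sum K.+1 1)); last first.
  by have := @binet_sum_le R K.+1 1 ltr01; rewrite mul1r; lra.
rewrite /binet_sum mulr_sumr; apply: ler_sum => k _; rewrite /binet_term expr1n -/(c k).
have c1 : 1 <= c k.
  rewrite /c /binet_freq; have := pi_ge2 R; have : 1 <= k.+1%:R :> R by rewrite ler1n.
  by move: (pi : R) (k.+1%:R) => p q; nra.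
have h : c k ^+ 2 <= c k ^+ (2 * j).+2 by rewrite ler_weXn2l.
have h1 : 1 <= c k ^+ 2 by rewrite exprn_ege1.
have d0 : 0 < c k ^+ 2 + 1 by rewrite ltr_wpDl ?sqr_ge0.
rewrite mulrA ler_pdivrMr ?exprn_gt0// mulrAC ler_pdivlMr//.
by move: h h1; move: (c k ^+ 2) (c k ^+ (2 * j).+2) => u v; lra.
Qed.

Definition freq_series j : R := limn (fun K => freq_sum K j).

Lemma freq_sum_cvg j : freq_sum K j @[K --> \oo] --> freq_series j.
Proof.
apply: nondecreasing_is_cvgn; last by exists 2 => _ [K _ <-]; exact: freq_sum_le.
apply/nondecreasing_seqP => K; rewrite /freq_sum [leRHS]big_ord_recr /= lerDl.
exact: ltW.
Qed.

(** A finite geometric series in - t^2 / c^2 with its exact remainder. *)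
Let binet_term_taylor k N t :
  `|binet_term k t - \sum_(j < N) (-1) ^+ j * (2 / c k ^+ (2 * j).+2 * t ^+ (2 * j))|
    <= 2 / c k ^+ (2 * N).+2 * t ^+ (2 * N).
Proof.
have d0 : 0 < c k ^+ 2 + t ^+ 2 by rewrite ltr_pwDl ?exprn_gt0 ?sqr_ge0.
have -> : binet_term k t - \sum_(j < N) (-1) ^+ j * (2 / c k ^+ (2 * j).+2 * t ^+ (2 * j)) =
    (-1) ^+ N * (t ^+ (2 * N) / c k ^+ (2 * N) * (2 / (c k ^+ 2 + t ^+ 2))).
  elim: N => [|N IHN]; first by rewrite big_ord0 !expr0 subr0 divr1 !mul1r.
  have -> : (2 * N.+1)%N = (2 * N).+2 by rewrite mulnS.
  rewrite big_ord_recr opprD addrA IHN /= !exprS expr0.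
  have ck := lt0r_neq0 (c0 k); have dn := lt0r_neq0 d0.
  have : c k ^+ (2 * N) != 0 by rewrite expf_neq0.
  move: (t ^+ (2 * N)) (c k ^+ (2 * N)) ((-1) ^+ N : R) => u v w v0.
  by move: ck dn; rewrite !expr2; move: (c k) => q q0 dn; field; rewrite dn v0 q0.
have tN : 0 <= t ^+ (2 * N) by rewrite exprM exprn_ge0 ?sqr_ge0.
have -> : 2 / c k ^+ (2 * N).+2 * t ^+ (2 * N) = t ^+ (2 * N) / c k ^+ (2 * N) * (2 / c k ^+ 2).
  have -> : (2 * N).+2 = (2 * N + 2)%N by rewrite addn2.
  by rewrite exprD invfM; move: (c k ^+ (2 * N))^-1 (c k ^+ 2)^-1 (t ^+ (2 * N)) => u v w; ring.
rewrite normrM normrX normrN1 expr1n mul1r.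
have q0 : 0 <= t ^+ (2 * N) / c k ^+ (2 * N) by rewrite divr_ge0// exprn_ge0 ?ltW.
rewrite ger0_norm; last by apply: mulr_ge0 => //; rewrite divr_ge0// ltW.
apply: ler_wpM2l => //; apply: ler_wpM2l => //.
by rewrite lef_pV2 ?posrE ?exprn_gt0// lerDl sqr_ge0.
Qed.

Let exchange_taylor K N t : \sum_(k < K.+1) \sum_(j < N) (-1) ^+ j * (2 / c k ^+ (2 * j).+2 * t ^+ (2 * j)) =
  \sum_(j < N) (-1) ^+ j * (freq_sum K j * t ^+ (2 * j)).
Proof.
rewrite exchange_big; apply: eq_bigr => j _.
by rewrite /freq_sum mulr_suml mulr_sumr.
Qed.

Lemma binet_sum_taylor K N t :
  `|binet_sum K.+1 t - \sum_(j < N) (-1) ^+ j * (freq_sum K j * t ^+ (2 * j))|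
    <= freq_sum K N * t ^+ (2 * N).
Proof.
rewrite -exchange_taylor /binet_sum -sumrB; apply: le_trans (ler_norm_sum _ _ _) _.
by rewrite /freq_sum mulr_suml; apply: ler_sum => k _; exact: binet_term_taylor.
Qed.

Let cvg_partial (a : nat -> nat -> R) (l u : nat -> R) N :
  (forall j, a K j @[K --> \oo] --> l j) ->
  \sum_(j < N) (-1) ^+ j * (a K j * u j) @[K --> \oo] --> \sum_(j < N) (-1) ^+ j * (l j * u j).
Proof.
move=> al; elim: N => [|N IHN].
  by rewrite big_ord0; under eq_fun do rewrite big_ord0; exact: cvg_cst.
rewrite big_ord_recr; under eq_fun do rewrite big_ord_recr.
apply: cvgD IHN _; apply: cvgMr; apply: cvgMl; exact: al.
Qed.

Lemma binet_taylor N t : 0 < t ->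
  `|binet t - \sum_(j < N) (-1) ^+ j * (freq_series j * t ^+ (2 * j))|
    <= freq_series N * t ^+ (2 * N).
Proof.
move=> t0.
have C1 : binet_sum K.+1 t @[K --> \oo] --> binet t.
  apply/cvgrPdist_le => e e0; near=> K.
  have /andP[h0 h1] := binet_sum_approx t0 (ltn0Sn K).
  rewrite ger0_norm//; apply: (le_trans h1).
  rewrite ler_pdivrMr ?ltr0n// mulrC -ler_pdivrMr//; apply: (@le_trans _ _ K%:R); last by rewrite ler_nat.
  by near: K; exact: nbhs_infty_ger.
have C2 := @cvg_partial _ _ (fun j => t ^+ (2 * j)) N freq_sum_cvg.
have C3 := cvg_norm (cvgB C1 C2).
have C4 : freq_sum K N * t ^+ (2 * N) @[K --> \oo] --> freq_series N * t ^+ (2 * N).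
  by apply: cvgMl; exact: freq_sum_cvg.
apply: (ler_cvg_to (C3 _ _) C4); apply: nearW => K.
exact: binet_sum_taylor.
Unshelve. all: by end_near. Qed.

(** Watson's lemma: the Taylor estimate, error included, is integrated against e^(-x t). *)
Lemma laplace_binet_sum_taylor K N x : 0 < x ->
  `|laplace (binet_sum K.+1) x - \sum_(j < N) (-1) ^+ j * ((2 * j)`!%:R * freq_sum K j / x ^+ (2 * j).+1)|
    <= (2 * N)`!%:R * freq_sum K N / x ^+ (2 * N).+1.
Proof.
move=> x0; pose m j t := t ^+ (2 * j) * expR (- (x * t)).
have im j : integrable_on hline (m j) by exact: integrable_on_exprn_expRN.
have mE j : int_on hline (m j) = (2 * j)`!%:R / x ^+ (2 * j).+1 by exact: int_on_exprn_expRN.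
pose S t := \sum_(j < N) (-1) ^+ j * freq_sum K j * m j t.
have iS : integrable_on hline S.
  by apply: (@integrable_on_sum _ _ _ (fun j t => (-1) ^+ j * freq_sum K j * m j t)) => j _; exact: integrable_onZ.
have SE : int_on hline S = \sum_(j < N) (-1) ^+ j * ((2 * j)`!%:R * freq_sum K j / x ^+ (2 * j).+1).
  rewrite (@int_on_sum _ _ _ (fun j t => (-1) ^+ j * freq_sum K j * m j t)); last by move=> j _; exact: integrable_onZ.
  by apply: eq_bigr => j _; rewrite int_onZ// mE; ring.
have mb := @measurable_binet_sum R K.+1.
have il : integrable_on hline (fun t => expR (- (x * t)) * binet_sum K.+1 t).
  apply: (integrable_onW _ (@integrable_on_binet_sum R K.+1)); first by apply: measurable_onT; meas.
  move=> t; rewrite in_hline => t0; rewrite normrM !ger0_norm ?expR_ge0 ?binet_sum_ge0//.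
  by rewrite ler_piMl ?binet_sum_ge0// -expR0 ler_expR oppr_le0 mulr_ge0 ?ltW.
have rhsE : (2 * N)`!%:R * freq_sum K N / x ^+ (2 * N).+1 = int_on hline (fun t => freq_sum K N * m N t).
  by rewrite int_onZ// mE mulrCA mulrA.
rewrite -SE rhsE /laplace -int_onB//; apply: normr_int_on_le.
- by apply: integrable_on_measurable; exact: integrable_onB.
- exact: integrable_onZ.
move=> t; rewrite in_hline => t0.
have -> : expR (- (x * t)) * binet_sum K.+1 t - S t =
  expR (- (x * t)) * (binet_sum K.+1 t - \sum_(j < N) (-1) ^+ j * (freq_sum K j * t ^+ (2 * j))).
  by rewrite mulrBr; congr (_ - _); rewrite /S mulr_sumr; apply: eq_bigr => j _; rewrite /m; ring.
rewrite normrM gtr0_norm ?expR_gt0// mulrC /m mulrA ler_wpM2r ?expR_ge0//.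
exact: binet_sum_taylor.
Qed.

End BinetExpansion.

(** * Stirling coefficients *)

Section StirlingCoefficients.
Context {R : realType}.
Implicit Types (s x : R) (K N n i j : nat) (a : nat -> R).

Let coef_step2 e N a i : (i < N)%N ->
  (\sum_(j < N) a j *: 'X^(e + 2 * j))`_(e + 2 * i) = a i.
Proof.
move=> iN; rewrite coef_sum (bigD1 (Ordinal iN))//= coefZ coefXn eqxx mulr1 big1 ?addr0// => j.
by rewrite -val_eqE /= coefZ coefXn eqn_add2l eqn_mul2l /= eq_sym => /negbTE ->; rewrite mulr0.
Qed.

Let coef_step2_odd e N a i : odd i != odd e -> (\sum_(j < N) a j *: 'X^(e + 2 * j))`_i = 0.
Proof.
move=> ie; rewrite coef_sum big1// => j _; rewrite coefZ coefXn.
case: eqP => [E|_]; last by rewrite mulr0.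
by move: ie; rewrite E oddD mul2n odd_double addbF eqxx.
Qed.

(** Truncated expansion of s / (e^s - 1) = 1 - s / 2 + s^2 binet s, the generating function of B_i /
    i!. This is where the Bernoulli numbers enter. *)
Let bernoulli_poly N : {poly R} :=
  1 + (- 2^-1) *: 'X + \sum_(j < N) ((-1) ^+ j * freq_series j) *: 'X^(2 + 2 * j).

Let near_bernoulli N :
  near_poly (2 * N) (fun s => 1 - 2^-1 * s + s ^+ 2 * binet s) (bernoulli_poly N).
Proof.
have C0 : 0 <= freq_series N :> R.
  apply: le_trans (normr_ge0 _) _; last first.
    by have := @binet_taylor R N 1 ltr01; rewrite [leRHS]mulrC expr1n mul1r; apply.
exists (freq_series N) => // s /andP[s0 s1].
have -> : (bernoulli_poly N).[s] = 1 - 2^-1 * s +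
    s ^+ 2 * \sum_(j < N) (-1) ^+ j * (freq_series j * s ^+ (2 * j)).
  rewrite !hornerD hornerC hornerZ hornerX mulNr horner_sum mulr_sumr; congr (_ + _).
  by apply: eq_bigr => j _; rewrite hornerZ hornerXn exprD; ring.
rewrite opprD addrACA subrr add0r -mulrBr normrM ger0_norm ?sqr_ge0//.
have h := binet_taylor N s0.
have sN : 0 <= freq_series N * s ^+ (2 * N) by rewrite mulr_ge0// exprn_ge0// ltW.
apply: (@le_trans _ _ (s ^+ 2 * (freq_series N * s ^+ (2 * N)))).
  by rewrite ler_wpM2l ?sqr_ge0.
by rewrite ler_piMl// exprn_ile1// ltW.
Qed.

Let near_expR_div N :
  near_poly N (fun s => (expR s - 1) / s) (\sum_(k < N) (k.+1`!%:R)^-1 *: 'X^k).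
Proof.
have [|||C C0 h] := @near_poly_expR R N.+1 id 'X.
- by move=> s /andP[/ltW].
- by exists 1 => // s /andP[s0 _]; rewrite horner0 subr0 expr1 mul1r gtr0_norm.
- by apply: eq_near_poly (near_poly_horner _ _) => s _; rewrite hornerX.
exists C => // s s01; have /andP[s0 s1] := s01.
have := h s s01; rewrite exprS mulrCA -ler_pdivrMl// => {h}.
rewrite -[X in X * `|_|](gtr0_norm (_ : 0 < s^-1)) ?invr_gt0// -normrM.
rewrite big_ord_recl hornerD hornerZ expr0 hornerC fact0 invr1 mulr1 !horner_sum.
suff -> : \sum_(k < N) ((bump 0 k)`!%:R^-1 *: 'X^(bump 0 k)).[s] =
  s * \sum_(k < N) ((k.+1)`!%:R^-1 *: 'X^k).[s] :> R.
  by rewrite opprD addrA mulrBr mulKf ?gt_eqF// mulrC.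
by rewrite mulr_sumr; apply: eq_bigr => k _; rewrite !hornerZ !hornerXn exprS mulrCA.
Qed.

(** The expansions of s / (e^s - 1) and (e^s - 1) / s multiply to that of 1, and expansions are
    unique. *)
Let bernoulli_conv N i : (i < N)%N ->
  \sum_(k < i.+1) (bernoulli_poly N)`_k * ((i - k).+1`!%:R)^-1 = (i == 0)%:R.
Proof.
move=> iN; have h : near_poly N (fun=> 1 : R) 1.
  by apply: eq_near_poly (near_poly_horner N 1) => s _; rewrite hornerC.
have NN : (N <= 2 * N)%N by rewrite leq_pmull.
have := near_polyM (near_polyW NN (near_bernoulli N)) (near_expR_div N).
move=> /(eq_near_poly (g := fun=> 1 : R)) H.
have /near_poly_uniq/(_ h i iN) : near_poly N (fun=> 1 : R)
    (bernoulli_poly N * (\sum_(k < N) (k.+1`!%:R)^-1 *: 'X^k)).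
  apply: H => s /andP[s0 _]; have e0 : expR s - 1 != 0.
    by rewrite subr_eq0 gt_eqF// expR_gt1.
  rewrite /binet; move: e0; move: (lt0r_neq0 s0) (expR s) => s0' e e0.
  by field; rewrite s0' e0.
rewrite coefM coef1 => <-; apply: eq_bigr => k _; congr (_ * _).
rewrite -(poly_def N (fun k => (k.+1`!%:R)^-1)) coef_poly ifT//; exact: leq_ltn_trans (leq_subr _ _) iN.
Qed.

(** Divided by (i + 1)!, the recursion [bernoulli_rec] becomes the relation [bernoulli_conv], which
    determines the coefficients one after the other. *)
Let coef_bernoulli_poly N i : (i < N)%N -> (bernoulli_poly N)`_i = bernoulli R i / i`!%:R.
Proof.
have f0 m : m`!%:R != 0 :> R by rewrite pnatr_eq0 -lt0n fact_gt0.
elim/ltn_ind: i => i IHi iN; have := bernoulli_conv iN.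
have : \sum_(k < i.+1) bernoulli R k / k`!%:R * ((i - k).+1`!%:R)^-1 = (i == 0)%:R :> R.
  have -> : (i == 0)%:R = (i == 0)%:R / (i.+1)`!%:R :> R.
    by case: eqVneq => [->|_]; rewrite ?mul0r// factS fact0 muln1 divr1.
  rewrite -(bernoulli_rec R i) mulr_suml; apply: eq_bigr => k _.
  have ki : (k <= i)%N by rewrite -ltnS.
  have G (u v w b B : R) : w != 0 -> b * (u * v) = w -> B / u * v^-1 = b * B / w.
    move=> w0 E; rewrite -E in w0 *; field.
    by move: w0; rewrite !mulf_eq0 !negb_or => /and3P[-> -> ->].
  apply: G; first exact: f0.
  by rewrite -subSn// -!natrM bin_fact// leqW.
rewrite !big_ord_recr /= subnn !divr1 => <- /eqP.
rewrite (eq_bigr (fun k : 'I_i => bernoulli R k / k`!%:R * ((i - k).+1`!%:R)^-1)); last first.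
  by move=> k _; rewrite IHi//; exact: ltn_trans iN.
by move=> /eqP/addrI.
Qed.

(** In classical terms, Euler's formula for zeta (2 j + 2). *)
Lemma freq_series_bernoulli j :
  (-1) ^+ j * freq_series j = bernoulli R (2 * j).+2 / ((2 * j).+2)`!%:R.
Proof.
(* The truncation is taken long enough both to read off the coefficient of index 2 j + 2 and to
   contain the summand j. *)
rewrite -(@coef_bernoulli_poly (2 * j).+3)// /bernoulli_poly !coefD coefC coefZ coefX /= mulr0 !add0r.
have jN : (j < (2 * j).+3)%N by rewrite !ltnS; apply: leq_trans (leqnSn _); rewrite leqW// leq_pmull.
by have := @coef_step2 2 _ (fun j => (-1) ^+ j * freq_series j) _ jN.
Qed.

(** Generic in [a]: with [freq_series] it is [stirling_series], with [freq_sum K] it is the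
    expansion of the truncated Laplace transform in s = 1 / x. The former is the coefficientwise
    limit of the latter. *)
Let stirling_poly a n : {poly R} :=
  \sum_(j < n) ((-1) ^+ j * ((2 * j)`!%:R * a j)) *: 'X^(1 + 2 * j).

Let stirling_seriesE n : stirling_series R n = stirling_poly freq_series n.
Proof.
rewrite /stirling_series big_add1 big_mkord; apply: eq_bigr => j _.
have -> : (2 * j.+1)%N = (2 * j).+2 by rewrite mulnS.
rewrite subn1 /=; congr (_ *: _).
rewrite mulrCA freq_series_bernoulli !factS !natrM.
have : (2 * j)`!%:R != 0 :> R by rewrite pnatr_eq0 -lt0n fact_gt0.
move: ((2 * j)`!%:R : R) (bernoulli _ _) => f B f0.
have h1 : (2 * j).+1%:R != 0 :> R by rewrite pnatr_eq0.
have h2 : (2 * j).+2%:R != 0 :> R by rewrite pnatr_eq0.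
move: h1 h2; move: ((2 * j).+1%:R : R) ((2 * j).+2%:R : R) => u v u0 v0.
by field; rewrite u0 v0 f0.
Qed.

Let exp_poly a n : {poly R} := \sum_(k < n.+1) (k`!%:R)^-1 *: stirling_poly a n ^+ k.

Let mu K s := laplace (@binet_sum R K.+1) s^-1.

Let near_laplace K N : near_poly (2 * N).+1 (mu K) (stirling_poly (freq_sum K) N).
Proof.
have C0 : 0 <= freq_sum K N :> R.
  apply: le_trans (normr_ge0 _) _; last first.
    by have := @binet_sum_taylor R K N 1; rewrite [leRHS]mulrC expr1n mul1r; apply.
exists ((2 * N)`!%:R * freq_sum K N); first by rewrite mulr_ge0.
move=> s /andP[s0 s1]; have is0 : 0 < s^-1 by rewrite invr_gt0.
have := laplace_binet_sum_taylor K N is0; rewrite exprVn invrK.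
suff -> : (stirling_poly (freq_sum K) N).[s] =
  \sum_(j < N) (-1) ^+ j * ((2 * j)`!%:R * freq_sum K j / s^-1 ^+ (2 * j).+1) by [].
rewrite horner_sum; apply: eq_bigr => j _.
by rewrite hornerZ hornerXn exprVn invrK [RHS]mulrA.
Qed.

Let near_exp_laplace K n : near_poly n.+1 (fun s => expR (mu K s)) (exp_poly (freq_sum K) n).
Proof.
apply: near_poly_expR.
- move=> s /andP[s0 _]; apply: int_on_ge0 => t _.
  by rewrite mulr_ge0 ?expR_ge0 ?binet_sum_ge0.
- by have := near_laplace K 0; rewrite /stirling_poly big_ord0.
- by apply: near_polyW (near_laplace K n); rewrite ltnS leq_pmull.
Qed.

(** Expansion of the same exponential as cosh + sinh, the even exponents coming from cosh and the
    odd ones from sinh. *)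
Let moment_poly K n : {poly R} :=
  1 + \sum_(j < n.+1) ((-1) ^+ j * cosh_moment K j) *: 'X^(2 + 2 * j)
    + \sum_(j < n.+1) ((-1) ^+ j * sinh_moment K j) *: 'X^(1 + 2 * j).

Let near_moment K n : near_poly n.+1 (fun s => expR (mu K s)) (moment_poly K n).
Proof.
have Cs : 0 <= sinh_moment K n.+1 :> R.
  by have := @sinh_rem_le R K n.+1 1 ltr01; rewrite expr1n divr1; apply: le_trans.
have Cc : 0 <= cosh_moment K n.+1 :> R.
  by have := @cosh_rem_le R K n.+1 1 ltr01; rewrite expr1n divr1; apply: le_trans.
have -> : (fun s => expR (mu K s)) = (fun s => cosh (mu K s) + sinh (mu K s)).
  by apply/funext => s; rewrite cosh_sinh_add.
apply: near_polyD.
- apply: (@near_polyW _ (2 * n.+1).+2); first by do 2!apply: leqW; rewrite leq_pmull.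
  exists (cosh_moment K n.+1) => // s /andP[s0 s1]; have is0 : 0 < s^-1 by rewrite invr_gt0.
  have := cosh_rem_le K n.+1 is0; rewrite /cosh_rem -/(mu K s) exprVn invrK hornerD hornerC opprD addrA.
  suff -> : (\sum_(j < n.+1) ((-1) ^+ j * cosh_moment K j) *: 'X^(2 + 2 * j)).[s] =
    \sum_(j < n.+1) (-1) ^+ j * (cosh_moment K j / s^-1 ^+ (2 * j).+2) :> R by [].
  rewrite horner_sum; apply: eq_bigr => j _.
  by rewrite hornerZ hornerXn exprVn invrK [RHS]mulrA.
- apply: (@near_polyW _ (2 * n.+1).+1); first by apply: leqW; rewrite leq_pmull.
  exists (sinh_moment K n.+1) => // s /andP[s0 s1]; have is0 : 0 < s^-1 by rewrite invr_gt0.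
  have := sinh_rem_le K n.+1 is0; rewrite /sinh_rem -/(mu K s) exprVn invrK.
  suff -> : (\sum_(j < n.+1) ((-1) ^+ j * sinh_moment K j) *: 'X^(1 + 2 * j)).[s] =
    \sum_(j < n.+1) (-1) ^+ j * (sinh_moment K j / s^-1 ^+ (2 * j).+1) :> R by [].
  rewrite horner_sum; apply: eq_bigr => j _.
  by rewrite hornerZ hornerXn exprVn invrK [RHS]mulrA.
Qed.

Let moment_coef K n : (moment_poly K n)`_n = (exp_poly (freq_sum K) n)`_n.
Proof. exact: near_poly_uniq (near_moment K n) (near_exp_laplace K n) n (ltnSn n). Qed.

Let exp_poly_cvg n : (exp_poly (freq_sum K) n)`_n @[K --> \oo] --> (-1) ^+ n * stirling_coef R n.
Proof.
rewrite /stirling_coef signMK stirling_seriesE.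
have cS : coef_cvg (fun K => stirling_poly (freq_sum K) n) (stirling_poly freq_series n).
  refine (@coef_cvg_sum _ n (fun j K => (-1) ^+ j * ((2 * j)`!%:R * freq_sum K j))
    (fun j => (-1) ^+ j * ((2 * j)`!%:R * freq_series j))
    (fun j _ => 'X^(1 + 2 * j)) (fun j => 'X^(1 + 2 * j)) _ _).
    by move=> j; apply: cvgMr; apply: cvgMr; exact: freq_sum_cvg.
  by move=> j; exact: coef_cvg_cst.
refine (@coef_cvg_sum _ n.+1 (fun k _ => (k`!%:R)^-1) (fun k => (k`!%:R)^-1)
  (fun k K => stirling_poly (freq_sum K) n ^+ k) (fun k => stirling_poly freq_series n ^+ k) _ _ n).
  by move=> k; exact: cvg_cst.
by move=> k; exact: coef_cvgX.
Qed.

(** An odd coefficient of [moment_poly] sees only the sinh part, so for each K the moment is, up to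
    sign, a coefficient of [exp_poly]. The limit in K is taken there, in a polynomial expression of
    the [freq_sum]. *)
Lemma sinh_moment_cvg n :
  sinh_moment K n @[K --> \oo] --> (-1) ^+ n.+1 * stirling_coef R (2 * n).+1.
Proof.
have -> : (-1) ^+ n.+1 * stirling_coef R (2 * n).+1 =
    (-1) ^+ n * ((-1) ^+ (2 * n).+1 * stirling_coef R (2 * n).+1).
  by rewrite !exprS exprM sqrrN expr1n expr1n; ring.
have -> : sinh_moment ^~ n = (fun K => (-1) ^+ n * (exp_poly (freq_sum K) (2 * n).+1)`_(2 * n).+1).
  apply/funext => K; rewrite -moment_coef /moment_poly !coefD coef1 [_%:R]mulr0n add0r.
  have -> := @coef_step2_odd 2 (2 * n).+2 (fun j => (-1) ^+ j * cosh_moment K j) (2 * n).+1;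
    last by rewrite /= mul2n odd_double.
  have nN : (n < (2 * n).+2)%N by rewrite !ltnS leqW// leq_pmull.
  have := @coef_step2 1 _ (fun j => (-1) ^+ j * sinh_moment K j) _ nN.
  by rewrite add0r => ->; rewrite signMK.
by apply: cvgMr; exact: exp_poly_cvg.
Qed.

Lemma cosh_moment_cvg n :
  cosh_moment K n @[K --> \oo] --> (-1) ^+ n * stirling_coef R (2 * n).+2.
Proof.
have -> : (-1) ^+ n * stirling_coef R (2 * n).+2 =
    (-1) ^+ n * ((-1) ^+ (2 * n).+2 * stirling_coef R (2 * n).+2).
  by rewrite !exprS exprM sqrrN expr1n expr1n; ring.
have -> : cosh_moment ^~ n = (fun K => (-1) ^+ n * (exp_poly (freq_sum K) (2 * n).+2)`_(2 * n).+2).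
  apply/funext => K; rewrite -moment_coef /moment_poly !coefD coef1 [_%:R]mulr0n add0r.
  have -> := @coef_step2_odd 1 (2 * n).+3 (fun j => (-1) ^+ j * sinh_moment K j) (2 * n).+2;
    last by rewrite /= mul2n odd_double.
  have nN : (n < (2 * n).+3)%N by rewrite !ltnS; apply: leq_trans (leqnSn _); rewrite leqW// leq_pmull.
  have := @coef_step2 2 _ (fun j => (-1) ^+ j * cosh_moment K j) _ nN.
  by rewrite addr0 => ->; rewrite signMK.
by apply: cvgMr; exact: exp_poly_cvg.
Qed.

Lemma stirling_coef0 : stirling_coef R 0 = 1.
Proof. by rewrite /stirling_coef big_ord1 !expr0 mul1r fact0 invr1 scale1r coefC. Qed.

End StirlingCoefficients.

(** * Remainders of the scaled gamma function and of its inverse *)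

Section GammaRemainders.
Context {R : realType}.
Variable z : R.
Hypothesis z0 : 0 < z.
Implicit Types (N n : nat).

Let g := stirling_coef R.
Let mu := laplace (@binet R) z.

(** [sinh_rem] with the moments replaced by their limits. The two signs are left uncombined so that
    each term is literally the limit of the corresponding one. *)
Definition sinh_tail N := sinh mu - \sum_(n < N) (-1) ^+ n * ((-1) ^+ n.+1 * g (2 * n).+1 / z ^+ (2 * n).+1).
Definition cosh_tail N := cosh mu - 1 - \sum_(n < N) (-1) ^+ n * ((-1) ^+ n * g (2 * n).+2 / z ^+ (2 * n).+2).

Let cvg_partial (m : nat -> nat -> R) (l u : nat -> R) N :
  (forall j, m K j @[K --> \oo] --> l j) ->
  \sum_(j < N) (-1) ^+ j * (m K j / u j) @[K --> \oo] --> \sum_(j < N) (-1) ^+ j * (l j / u j).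
Proof.
move=> ml; elim: N => [|N IHN].
  by rewrite big_ord0; under eq_fun do rewrite big_ord0; exact: cvg_cst.
rewrite big_ord_recr; under eq_fun do rewrite big_ord_recr.
apply: cvgD IHN _; apply: cvgMr; apply: cvgMl; exact: ml.
Qed.

Let ge_lim (L l : R) (u : nat -> R) : u K @[K --> \oo] --> l -> (forall K, L <= u K) -> L <= l.
Proof.
by move=> ul Lu; apply: (ler_cvg_to (cvg_cst L) ul); apply: nearW => K; exact: Lu.
Qed.

Let expR_mu_cvg : expR (laplace (@binet_sum R K.+1) z) @[K --> \oo] --> expR mu.
Proof.
by apply: continuous_cvg; [exact: continuous_expR|exact: laplace_binet_sum_cvg].
Qed.

Let expRN_mu_cvg : expR (- laplace (@binet_sum R K.+1) z) @[K --> \oo] --> expR (- mu).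
Proof.
by apply: continuous_cvg; [exact: continuous_expR|apply: cvgN; exact: laplace_binet_sum_cvg].
Qed.

Lemma sinh_tail_gt0 N : 0 < (-1) ^+ N * sinh_tail N.
Proof.
have [L L0 LK] := sinh_rem_gt0 N z0; apply: lt_le_trans L0 _.
apply: (ge_lim _ LK); apply: cvgMr; apply: cvgB.
  by rewrite /sinh; apply: cvgMl; apply: cvgB; [exact: expR_mu_cvg|exact: expRN_mu_cvg].
exact: (@cvg_partial (@sinh_moment R) _ (fun n => z ^+ (2 * n).+1) N (@sinh_moment_cvg R)).
Qed.

Lemma cosh_tail_gt0 N : 0 < (-1) ^+ N * cosh_tail N.
Proof.
have [L L0 LK] := cosh_rem_gt0 N z0; apply: lt_le_trans L0 _.
apply: (ge_lim _ LK); apply: cvgMr; apply: cvgB.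
  apply: cvgB; last exact: cvg_cst.
  by rewrite /cosh; apply: cvgMl; apply: cvgD; [exact: expR_mu_cvg|exact: expRN_mu_cvg].
exact: (@cvg_partial (@cosh_moment R) _ (fun n => z ^+ (2 * n).+2) N (@cosh_moment_cvg R)).
Qed.

Lemma sinh_tail_step N : (-1) ^+ N.+1 * (g (2 * N).+1 / z ^+ (2 * N).+1) =
  (-1) ^+ N * sinh_tail N + (-1) ^+ N.+1 * sinh_tail N.+1.
Proof.
have -> : sinh_tail N.+1 = sinh_tail N -
    (-1) ^+ N * ((-1) ^+ N.+1 * g (2 * N).+1 / z ^+ (2 * N).+1).
  by rewrite /sinh_tail big_ord_recr opprD addrA.
have := sqrr_sign R N; rewrite ?(exprS (-1) N); move: ((-1) ^+ N : R) (g _) (z ^+ _) => e q r h.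
transitivity (e ^+ 2 * (-1 * e * (q / r))); last by ring.
by rewrite h mul1r.
Qed.

Lemma cosh_tail_step N : (-1) ^+ N * (g (2 * N).+2 / z ^+ (2 * N).+2) =
  (-1) ^+ N * cosh_tail N + (-1) ^+ N.+1 * cosh_tail N.+1.
Proof.
have -> : cosh_tail N.+1 = cosh_tail N -
    (-1) ^+ N * ((-1) ^+ N * g (2 * N).+2 / z ^+ (2 * N).+2).
  by rewrite /cosh_tail big_ord_recr opprD addrA.
have := sqrr_sign R N; rewrite ?(exprS (-1) N); move: ((-1) ^+ N : R) (g _) (z ^+ _) => e q r h.
transitivity (e ^+ 2 * (e * (q / r))); last by ring.
by rewrite h mul1r.
Qed.

Let Gamma_rem_step N : @Gamma_rem R N.+1 z = Gamma_rem N z - (-1) ^+ N * (g N / z ^+ N).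
Proof. by rewrite /Gamma_rem big_nat_recr//= opprD addrA. Qed.

Let Gamma_inv_rem_step N : Gamma_inv_rem N.+1 z = Gamma_inv_rem N z - g N / z ^+ N.
Proof. by rewrite /Gamma_inv_rem big_nat_recr//= opprD addrA. Qed.

Let sign_odd N : (-1) ^+ (2 * N).+1 = -1 :> R.
Proof. by rewrite exprS exprM sqrrN !expr1n mulr1. Qed.

Let sinh_tailS N : sinh_tail N.+1 = sinh_tail N + g (2 * N).+1 / z ^+ (2 * N).+1.
Proof.
rewrite /sinh_tail big_ord_recr opprD addrA /=; congr (_ + _).
have := sqrr_sign R N; rewrite ?(exprS (-1) N); move: ((-1) ^+ N : R) (g _) (z ^+ _) => e q r h.
transitivity (e ^+ 2 * (q / r)); first by ring.
by rewrite h mul1r.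
Qed.

Let cosh_tailS N : cosh_tail N.+1 = cosh_tail N - g (2 * N).+2 / z ^+ (2 * N).+2.
Proof.
rewrite /cosh_tail big_ord_recr opprD addrA /=; congr (_ + _).
have := sqrr_sign R N; move: ((-1) ^+ N : R) (g _) (z ^+ _) => e q r h.
transitivity (- (e ^+ 2 * (q / r))); first by ring.
by rewrite h mul1r.
Qed.

(** Induction by two terms at a time: an odd term moves [sinh_tail] one step, an even one moves
    [cosh_tail]. The constant term of the expansion is the 1 subtracted in [cosh_tail]. *)
Lemma Gamma_rem_odd N : Gamma_rem (2 * N).+1 z = sinh_tail N + cosh_tail N.
Proof.
elim: N => [|N IHN].
  rewrite Gamma_rem_step /Gamma_rem big_nil scaled_Gamma_laplace// /g stirling_coef0.
  rewrite /sinh_tail /cosh_tail !big_ord0 !expr0 -/mu -cosh_sinh_add.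
  by move: (cosh mu) (sinh mu) => p q; field.
have -> : (2 * N.+1).+1 = (2 * N).+3 by rewrite mulnS.
rewrite Gamma_rem_step Gamma_rem_step IHN sinh_tailS cosh_tailS (exprS (-1) (2 * N).+1) sign_odd.
by ring.
Qed.

Lemma Gamma_rem_even N : Gamma_rem (2 * N).+2 z = sinh_tail N.+1 + cosh_tail N.
Proof. by rewrite Gamma_rem_step Gamma_rem_odd sinh_tailS sign_odd; ring. Qed.

Lemma Gamma_inv_rem_odd N : Gamma_inv_rem (2 * N).+1 z = cosh_tail N - sinh_tail N.
Proof.
elim: N => [|N IHN].
  rewrite Gamma_inv_rem_step /Gamma_inv_rem big_nil scaled_Gamma_laplace// /g stirling_coef0.
  rewrite /sinh_tail /cosh_tail !big_ord0 !expr0 -/mu -expRN -cosh_sinh_sub.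
  by move: (cosh mu) (sinh mu) => p q; field.
have -> : (2 * N.+1).+1 = (2 * N).+3 by rewrite mulnS.
by rewrite Gamma_inv_rem_step Gamma_inv_rem_step IHN sinh_tailS cosh_tailS; ring.
Qed.

Lemma Gamma_inv_rem_even N : Gamma_inv_rem (2 * N).+2 z = cosh_tail N - sinh_tail N.+1.
Proof. by rewrite Gamma_inv_rem_step Gamma_inv_rem_odd sinh_tailS; ring. Qed.

End GammaRemainders.

Theorem theorem1p1 (R : realType) (z : R) (N : nat) (z_gt0 : 0 < z)
    (N_ge1 : (1 <= N)%N) :
  let g : nat -> R := stirling_coef R in
  let Rem : nat -> R -> R := @Gamma_rem R in
  let Rem' : nat -> R -> R := @Gamma_inv_rem R in
  (0 <= (-1) ^+ N * g (2 * N - 1)%N /\ 0 <= (-1) ^+ N.+1 * g (2 * N)%N)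
  /\
  (exists Theta1 Theta2 Theta3 : R,
    (0 < Theta1 < 1) /\ (0 < Theta2 < 1) /\ (0 < Theta3 < 1) /\
    (-1) ^+ N.+1 * Rem (2 * N - 1)%N z =
        Theta1 * (-1) ^+ N * (g (2 * N - 1)%N / z ^+ (2 * N - 1))
      + Theta2 * (-1) ^+ N.+1 * (g (2 * N)%N / z ^+ (2 * N)) /\
    (-1) ^+ N.+1 * Rem (2 * N)%N z =
        Theta2 * (-1) ^+ N.+1 * (g (2 * N)%N / z ^+ (2 * N))
      - Theta3 * (-1) ^+ N.+1 * (g (2 * N + 1)%N / z ^+ (2 * N + 1)) /\
    (-1) ^+ N * Rem' (2 * N - 1)%N z =
        Theta1 * (-1) ^+ N * (g (2 * N - 1)%N / z ^+ (2 * N - 1))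
      - Theta2 * (-1) ^+ N.+1 * (g (2 * N)%N / z ^+ (2 * N)) /\
    (-1) ^+ N.+1 * Rem' (2 * N)%N z =
        Theta2 * (-1) ^+ N.+1 * (g (2 * N)%N / z ^+ (2 * N))
      + Theta3 * (-1) ^+ N.+1 * (g (2 * N + 1)%N / z ^+ (2 * N + 1)))
  /\
  (`|Rem (2 * N - 1)%N z| = (-1) ^+ N.+1 * Rem (2 * N - 1)%N z /\
   (-1) ^+ N.+1 * Rem (2 * N - 1)%N z <
       (-1) ^+ N * (g (2 * N - 1)%N / z ^+ (2 * N - 1))
     + (-1) ^+ N.+1 * (g (2 * N)%N / z ^+ (2 * N)))
  /\
  `|Rem (2 * N)%N z| <
     Num.max ((-1) ^+ N.+1 * (g (2 * N)%N / z ^+ (2 * N)))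
             ((-1) ^+ N.+1 * (g (2 * N + 1)%N / z ^+ (2 * N + 1)))
  /\
  `|Rem' (2 * N - 1)%N z| <
     Num.max ((-1) ^+ N * (g (2 * N - 1)%N / z ^+ (2 * N - 1)))
             ((-1) ^+ N.+1 * (g (2 * N)%N / z ^+ (2 * N)))
  /\
  (`|Rem' (2 * N)%N z| = (-1) ^+ N.+1 * Rem' (2 * N)%N z /\
   (-1) ^+ N.+1 * Rem' (2 * N)%N z <
       (-1) ^+ N.+1 * (g (2 * N)%N / z ^+ (2 * N))
     + (-1) ^+ N.+1 * (g (2 * N + 1)%N / z ^+ (2 * N + 1))).
Proof.
(* With N = M + 1 the indices 2 N - 1, 2 N, 2 N + 1 are 2 M + 1, 2 M + 2, 2 M + 3. The odd terms lie
   between the sinh tails M, M + 1, M + 2 and the even term between the cosh tails M, M + 1. *)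
move=> g Rem Rem'; case: N N_ge1 => // M _.
have -> : (2 * M.+1)%N = (2 * M).+2 by rewrite mulnS.
have -> : ((2 * M).+2 + 1)%N = (2 * M.+1).+1 by rewrite addn1 mulnS.
rewrite subn1 [(2 * M).+2.-1]/=.
have sgnE : (-1) ^+ M.+2 = (-1) ^+ M :> R by rewrite !exprS; ring.
have signN x : (-1) ^+ M.+1 * x = - ((-1) ^+ M * x) :> R by rewrite exprS mulN1r mulNr.
have pos1 k c d : 0 < c * (d / z ^+ k) -> 0 <= c * d :> R.
  by rewrite mulrA pmulr_lgt0 ?invr_gt0 ?exprn_gt0// => /ltW.
have nsgn x : `|x| = `|(-1) ^+ M * x| :> R by rewrite normrM normrX normrN1 expr1n mul1r.
have nsgn' x : `|x| = `|(-1) ^+ M.+1 * x| :> R by rewrite normrM normrX normrN1 expr1n mul1r.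
have := sinh_tail_step z M.+1; have := cosh_tail_step z M; have := sinh_tail_step z M.
have := cosh_tail_gt0 z_gt0 M.+1; have := cosh_tail_gt0 z_gt0 M.
have := sinh_tail_gt0 z_gt0 M.+2; have := sinh_tail_gt0 z_gt0 M.+1; have := sinh_tail_gt0 z_gt0 M.
have : (-1) ^+ M.+2 * Rem (2 * M).+1 z = (-1) ^+ M * sinh_tail z M + (-1) ^+ M * cosh_tail z M.
  by rewrite /Rem Gamma_rem_odd// sgnE mulrDr.
have : (-1) ^+ M.+2 * Rem (2 * M).+2 z = (-1) ^+ M * cosh_tail z M - (-1) ^+ M.+1 * sinh_tail z M.+1.
  by rewrite /Rem Gamma_rem_even// sgnE signN opprK mulrDr addrC.
have : (-1) ^+ M.+1 * Rem' (2 * M).+1 z = (-1) ^+ M * sinh_tail z M - (-1) ^+ M * cosh_tail z M.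
  by rewrite /Rem' Gamma_inv_rem_odd// signN mulrBr opprB.
have : (-1) ^+ M.+2 * Rem' (2 * M).+2 z = (-1) ^+ M * cosh_tail z M + (-1) ^+ M.+1 * sinh_tail z M.+1.
  by rewrite /Rem' Gamma_inv_rem_even// sgnE signN mulrBr.
rewrite -/g !sgnE.
rewrite (nsgn (Rem (2 * M).+1 z)) (nsgn (Rem (2 * M).+2 z)) (nsgn' (Rem' (2 * M).+1 z)) (nsgn (Rem' (2 * M).+2 z)).
(* From here on only five positive numbers matter: the signed tails [s0], [s1], [s2] of sinh and
   [k0], [k1] of cosh. The three terms are s0 + s1, k0 + k1, s1 + s2, and the four signed remainders
   are s0 + k0, k0 - s1, s0 - k0, k0 + s1. *)
move: ((-1) ^+ M * sinh_tail z M.+2) ((-1) ^+ M.+1 * sinh_tail z M.+1) ((-1) ^+ M.+1 * cosh_tail z M.+1).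
move: ((-1) ^+ M * sinh_tail z M) ((-1) ^+ M * cosh_tail z M) => s0 k0 s2 s1 k1.
move=> r4 r3 r2 r1 s0_gt0 s1_gt0 s2_gt0 k0_gt0 k1_gt0 E1 E2 E3.
(* Each Theta is the share of a tail in the term that it forms with its successor. The same three
   values serve in all four formulas because the same [s0], [k0], [s1] occur there. *)
have theta u v : 0 < u -> 0 < v -> (0 < u / (u + v) < 1) /\ u / (u + v) * (u + v) = u :> R.
  move=> u0 v0; have uv := addr_gt0 u0 v0.
  by rewrite divr_gt0// ltr_pdivrMr// mul1r ltrDl v0 divfK ?gt_eqF.
(* The distance of two positive numbers is less than the larger one, which in turn is less than the
   term containing it. *)
have normB_max u v u' v' : 0 < u -> 0 < v -> 0 < u' -> 0 < v' ->
    `|u - v| < Num.max (u + u') (v + v') :> R.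
  by move=> *; rewrite lt_max; case: (leP v u) => uv;
    [rewrite ger0_norm ?subr_ge0//|rewrite ltr0_norm ?subr_lt0//]; apply/orP; [left|right]; lra.
have [t1 q1] := theta _ _ s0_gt0 s1_gt0; have [t2 q2] := theta _ _ k0_gt0 k1_gt0.
have [t3 q3] := theta _ _ s1_gt0 s2_gt0.
split; [|split].
- by split; [apply: (pos1 (2 * M).+1); rewrite E1|apply: (pos1 (2 * M).+2); rewrite E2]; exact: addr_gt0.
- exists (s0 / (s0 + s1)), (k0 / (k0 + k1)), (s1 / (s1 + s2)).
  rewrite r1 r2 r3 r4 -!(mulrA (_ / _)) E1 E2 E3 q1 q2 q3; do 3!split => //.
rewrite r1 r2 r3 r4 E1 E2 E3 (gtr0_norm (addr_gt0 s0_gt0 k0_gt0)) (gtr0_norm (addr_gt0 k0_gt0 s1_gt0)).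
split; first by split => //; lra.
split; first exact: normB_max.
split; first exact: normB_max.
by split => //; lra.
Qed.
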